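(* Let $\xi_1,\dots,\xi_n$ be independent real random variables with $\mathbf{E}\xi_i=0$, satisfying Bernstein's condition: there is a constant $\varepsilon>0$ such that $|\mathbf{E}\xi_i^k|\le \frac12 k!\,\varepsilon^{k-2}\mathbf{E}\xi_i^2$ for all $k\ge 3$ and $i=1,\dots,n$. Let $S_n=\sum_{i=1}^n\xi_i$ and $\sigma^2=\sum_{i=1}^n\mathbf{E}\xi_i^2>0$. Then for all $x\ge 0$, \[ \mathbf{P}(S_n>x\sigma)\le B_n\Big(x,\frac{\varepsilon}{\sigma}\Big)\,F_2\Big(x,\frac{\varepsilon}{\sigma}\Big)\le B_n\Big(x,\frac{\varepsilon}{\sigma}\Big), \] where \[ F_2\Big(x,\frac{\varepsilon}{\sigma}\Big)=\Big(M(x)+27.99\,R(x\varepsilon/\sigma)\frac{\varepsilon}{\sigma}\Big)\wedge 1 . \] Moreover, $R$ is increasing, so for all $0\le x\le \alpha\sigma/\varepsilon$ with $0\le\alpha<\frac13$ one has $R(x\varepsilon/\sigma)\le R(\alpha)$; and $27.99R(0.1)\le 88.41$.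
   Context: $\Phi$ is the standard normal distribution function and $M(x)=(1-\Phi(x))e^{x^2/2}$. For $x\ge0$ and $r=\varepsilon/\sigma$, set $\widehat{x}=\frac{2x}{1+\sqrt{1+2xr}}$, $B(x,r)=\exp\{-\widehat{x}^2/2\}$, $\psi(t)=t-\log(1+t)$, and \[ B_n(x,r)=B(x,r)\exp\Big\{-n\,\psi\Big(\frac{\widehat{x}^2}{2n\sqrt{1+2xr}}\Big)\Big\}. \] The function $R$ is defined by $R(t)=\frac{(1-t+6t^2)^3}{(1-3t)^{3/2}(1-t)^7}$ for $0\le t<\frac13$ and $R(t)=\infty$ for $t\ge\frac13$. $a\wedge b=\min\{a,b\}$. *)

(* Defs.v *)
From HB Require Import structures.
From mathcomp Require Import all_boot all_order all_algebra.
From mathcomp Require Import all_classical all_reals all_analysis.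
From mathcomp Require Import normal_distribution.

Set Implicit Arguments.
Unset Strict Implicit.
Unset Printing Implicit Defensive.

Import Order.TTheory GRing.Theory Num.Def Num.Theory.
Import numFieldTopology.Exports.

Local Open Scope classical_set_scope.
Local Open Scope ring_scope.

Section defs.
Variable R : realType.

Definition Phi (x : R) : R := fine (normal_prob 0 1 `]-oo, x]).

Definition Mills (x : R) : R := (1 - Phi x) * expR (x ^+ 2 / 2).

Definition xhat (x r : R) : R := 2 * x / (1 + Num.sqrt (1 + 2 * x * r)).

Definition Bfun (x r : R) : R := expR (- (xhat x r ^+ 2) / 2).

Definition psi (t : R) : R := t - ln (1 + t).

Definition Bn (n : nat) (x r : R) : R :=
  Bfun x r * expR (- (n%:R) *
    psi (xhat x r ^+ 2 / (2 * n%:R * Num.sqrt (1 + 2 * x * r)))).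

Definition Rfun (t : R) : \bar R :=
  if t < 1 / 3 then
    ((1 - t + 6 * t ^+ 2) ^+ 3 /
       (powR (1 - 3 * t) (3 / 2) * (1 - t) ^+ 7))%:E
  else +oo%E.

Definition F2 (x r : R) : R :=
  fine (Order.min ((Mills x)%:E + (2799 / 100)%:E * Rfun (x * r) * r%:E) 1)%E.

End defs.

(* Mutual independence of a finite family of real random variables:
   P(/\_j X_j \in B_j) = prod_j P(X_j \in B_j) for all Borel sets B_j
   (taking B_j = setT recovers every subfamily). *)
Definition mutually_independent {d} {T : measurableType d} {R : realType}
  (P : probability T R) (n : nat) (X : 'I_n -> T -> R) : Prop :=
  forall B : 'I_n -> set R, (forall j, measurable (B j)) ->
    P (\bigcap_(j in [set: 'I_n]) (X j @^-1` B j)) =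
    (\prod_(j < n) P (X j @^-1` B j))%E.

(* Main.v *)
(** Put t = x eps / sigma, lam = xhat / (sigma sqrt(1+2t)) and let Q have
    density e^(lam S) / E e^(lam S). Then
      P(S > x sigma) = e^(-lam x sigma) E e^(lam S) E_Q[h(W)],
    where W is S standardised under Q, h(w) = e^(-a(w-c)) 1_{w > c}, a = lam times the
    Q-deviation of S, and c >= 0 because E_Q S <= x sigma. Bernstein's condition and AM-GM bound
    the prefactor by B_n. Stein's method, with a concentration inequality to handle the jump of h,
    gives E_Q[h(W)] <= M(a) + 7 rho as soon as E Y^4 <= rho^2 E Y^2 for each of the standardised
    summands Y. Bernstein's condition controls the tilted moments, so that a is at least
    x q / (1 + 3t/2) and rho is a multiple of eps / (sigma q^2), with R(t) = q^(-3) (1-t)^(-4);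
    one-variable estimates in t then turn M(a) + 7 rho into M(x) + 27.99 R(t) eps / sigma. *)

Require Import Defs.
From HB Require Import structures.
From mathcomp Require Import all_boot all_order all_algebra.
From mathcomp Require Import all_classical all_reals all_analysis.
From mathcomp Require Import normal_distribution.
From mathcomp Require Import measurable_realfun.
From mathcomp Require Import ring lra.

Import Order.TTheory GRing.Theory Num.Def Num.Theory.
Import numFieldTopology.Exports numFieldNormedType.Exports.

Local Open Scope classical_set_scope.
Local Open Scope ring_scope.

(** * Mills' ratio *)

Section Mills.
Context {R : realType}.
Implicit Types x y a b c : R.

(** The tilt minimises Bernstein's exponent -lam x sigma + lam^2 sigma^2 / (2 (1 - lam eps)). The
    lam-derivative of its second term is also the bound found for E_Q S, so at the minimum that
    bound equals x sigma: hence c >= 0, and hence the formula for xhat.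

    In Stein's method the constant must not depend on a, which can be arbitrarily large, although h
    jumps at c and may drop steeply after it. The derivative of the Stein solution f is w f(w) +
    h(w) minus a constant. The part w f(w) has Lipschitz bounds free of a. The part h is compared
    with increments of its primitive; the error is the indicator of a short interval plus a tail
    weighted by 1 - e^(-aL), and concentration gives both a bound of the same form. The condition E
    Y^4 <= rho^2 E Y^2 is imposed on each summand because it passes to E |Y| <= rho and E |Y|^3 <=
    rho E Y^2.

    At the end all terms are divided by R(t). In units of eps / sigma the term 7 rho is then at most
    26.09 + 4t and M(a) - M(x) at most 1.9 - 4t, which add up to 27.99. *)

Lemma le_of_is_derive_ge0 (f df : R -> R) (a b : R) : a <= b ->
  (forall x, a < x < b -> is_derive x 1 f (df x)) ->
  (forall x, a < x < b -> 0 <= df x) ->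
  {within `[a, b], continuous f} -> f a <= f b.
Proof.
move=> ab dfE df0 cf; rewrite le_eqVlt in ab.
have [->//|{}ab] := predU1P ab.
have dfE' x : x \in `]a, b[ -> is_derive x 1 f (df x).
  by rewrite in_itv/=; exact: dfE.
have [c cab E] := MVT ab dfE' cf.
rewrite -subr_ge0 E mulr_ge0 ?subr_ge0 ?(ltW ab)// df0//.
Qed.

Lemma is_derive_continuous (f : R -> R) x d : is_derive x 1 f d -> {for x, continuous f}.
Proof. by move=> h; apply/differentiable_continuous/derivable1_diffP; exact: ex_derive. Qed.

Lemma continuous_within (f : R -> R) a b :
  (forall x, a <= x <= b -> {for x, continuous f}) -> {within `[a, b], continuous f}.
Proof.
move=> h; apply: continuous_in_subspaceT => x; rewrite inE/= in_itv/=; exact: h.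
Qed.

Lemma le_of_derive_ge0 (f df : R -> R) (a b : R) : a <= b ->
  (forall x, a <= x <= b -> is_derive x 1 f (df x)) ->
  (forall x, a < x < b -> 0 <= df x) -> f a <= f b.
Proof.
move=> ab dfE df0; apply: (le_of_is_derive_ge0 _ df) => //.
  by move=> x /andP[? ?]; apply: dfE; rewrite !ltW.
by apply: continuous_within => x xab; apply: is_derive_continuous (dfE _ xab).
Qed.

Definition phi (x : R) : R := normal_pdf 0 1 x.
(** This is 1 / sqrt(2 pi), the value of the density at 0 and the constant in the equation M' = x M
    - [phi0]. *)
Definition phi0 : R := normal_peak 1.

Lemma phiE x : phi x = phi0 * expR (- (x ^+ 2) / 2).
Proof.
rewrite /phi normal_pdfE ?oner_neq0//= /normal_fun /phi0 subr0.
by rewrite expr1n.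
Qed.

Lemma phi0_gt0 : 0 < phi0.
Proof. by rewrite normal_peak_gt0 ?oner_neq0. Qed.

Lemma is_derive_Phi x : is_derive x 1 (@Phi R) (phi x).
Proof.
have fi : (@lebesgue_measure R).-integrable [set` Interval -oo%O (BRight (x + 1))] (EFin \o phi).
  by apply: (@integrableS _ _ _ _ setT) => //; exact: integrable_normal_pdf.
have xu : x < x + 1 by rewrite ltrDl.
have cphi : {for x, continuous phi}.
  have := @continuous_normal_pdf R 0 1 (oner_neq0 _) x; exact.
have [|h1] := continuous_FTC1 xu fi _ cphi; first by rewrite ltNyr.
by rewrite derive1E => h2; exact: (DeriveDef h1).
Qed.

Lemma Phi_ge0 x : 0 <= Phi x.
Proof. by rewrite /Phi fine_ge0. Qed.

Lemma Phi_le1 x : Phi x <= 1.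
Proof.
have h := probability_le1 (normal_prob (0:R) 1) (measurable_itv `]-oo, x]).
rewrite /Phi -[leRHS]/(fine 1%E) fine_le// ge0_fin_numE//.
by rewrite (le_lt_trans h)// ltry.
Qed.

(** Under the standard normal law the identity is a random variable with distribution function
    [Phi]; this yields the limits of [Phi] at both infinities. *)
Let idR : measurableTypeR R -> R := idfun.

#[local] HB.instance Definition _ :=
  @isMeasurableFun.Build _ _ _ _ idR (@measurable_id _ _ setT).

Lemma cvg_Phi_y : Phi x @[x --> +oo] --> (1:R).
Proof.
have := @cvg_cdfy1 _ _ _ (normal_prob (0:R) 1) (idR : {RV normal_prob (0:R) 1 >-> R}).
by move/fine_cvgP => [].
Qed.

Lemma cvg_Phi_Ny : Phi x @[x --> -oo] --> (0:R).
Proof.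
have := @cvg_cdfNy0 _ _ _ (normal_prob (0:R) 1) (idR : {RV normal_prob (0:R) 1 >-> R}).
by move/fine_cvgP => [].
Qed.

Lemma phiN x : phi (- x) = phi x.
Proof. by rewrite !phiE sqrrN. Qed.

Lemma is_derive_phi x : is_derive x 1 phi (- x * phi x).
Proof.
have -> : phi = (fun x => phi0 * expR (- (x ^+ 2) / 2)) by apply/funext => y; rewrite phiE.
apply: is_derive_eq.
by rewrite /= /GRing.scale/=; field.
Qed.

Lemma le_lim_y (f : R -> R) (l b : R) x :
  f y @[y --> +oo] --> l -> (forall y, x <= y -> b <= f y) -> b <= l.
Proof.
move=> fl bf; apply: (cvgr_to_ge fl); near=> y; apply: bf.
by near: y; apply: nbhs_pinfty_ge; exact: num_real.
Unshelve. all: by end_near. Qed.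

(** Since [phi] is even, [Phi z + Phi (- z)] has derivative zero, and the constant is read off at
    infinity. *)
Lemma Phi_sym x : Phi (- x) = 1 - Phi x.
Proof.
suff H y : Phi y + Phi (- y) = 1 by rewrite -(H x) addrAC subrr add0r.
have dG (z : R) : is_derive z 1 (fun z => Phi z + Phi (- z)) 0.
  have h1 := is_derive_Phi z.
  have h2 := is_derive_Phi (- z).
  have h3 : is_derive z 1 (fun z => Phi (- z)) (- phi (- z)).
    have := @is_derive1_comp R (@Phi R) (fun z => - z) z _ _ h2 (is_deriveN (is_derive_id z 1)).
    by rewrite mulrN1; apply.
  have := is_deriveD h1 h3.
  by rewrite phiN subrr.
have cst (u v : R) : u <= v -> Phi u + Phi (- u) = Phi v + Phi (- v).
  move=> uv; apply/eqP; rewrite eq_le; apply/andP; split.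
    by apply: (le_of_derive_ge0 (fun z => Phi z + Phi (- z)) (fun=> 0)) => // z _.
  rewrite -lerN2; apply: (le_of_derive_ge0 (fun z => - (Phi z + Phi (- z))) (fun=> 0)) => // z _.
  by have := is_deriveN (dG z); rewrite oppr0.
have lim1 : Phi y + Phi (- y) @[y --> +oo] --> (1 + 0 : R).
  by apply: cvgD; [exact: cvg_Phi_y|exact: (cvgNy_compNP (@Phi R) _).1 cvg_Phi_Ny].
rewrite addr0 in lim1.
apply/eqP; rewrite eq_le; apply/andP; split.
  by apply: (le_lim_y _ _ _ y lim1) => z /cst ->.
rewrite -lerN2; apply: (le_lim_y _ _ _ y (cvgN lim1)) => z /cst e.
by rewrite lerN2 -e.
Qed.

Lemma Phi0 : Phi 0 = 1 / 2 :> R.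
Proof. by have := Phi_sym 0; rewrite oppr0; lra. Qed.

Local Notation M := (@Mills R).

Lemma is_derive_Mills x : is_derive x 1 M (x * M x - phi0).
Proof.
have h1 := is_derive_Phi x.
have -> : M = (fun x => (1 - Phi x) * expR (x ^+ 2 / 2)) by [].
apply: is_derive_eq.
rewrite /= /GRing.scale/= phiE /Mills.
have e : expR (- (x ^+ 2) / 2) * expR (x ^+ 2 / 2) = 1.
  by rewrite -expRD mulNr addNr expR0.
transitivity (x * ((1 - Phi x) * expR (x ^+ 2 / 2)) - phi0 * (expR (- (x ^+ 2) / 2) * expR (x ^+ 2 / 2))).
  by field.
by rewrite e mulr1.
Qed.

Lemma Mills_ge0 x : 0 <= M x.
Proof. by rewrite mulr_ge0 ?expR_ge0// subr_ge0 Phi_le1. Qed.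

Lemma MillsDN x : M x + M (- x) = expR (x ^+ 2 / 2).
Proof. by rewrite /Mills Phi_sym sqrrN; ring. Qed.

Lemma Mills0 : M 0 = 1 / 2.
Proof. by rewrite /Mills Phi0 expr0n/= mul0r expR0; field. Qed.

(** The difference [D] has derivative phi(y) / y^2 >= 0 and stays below 1 - Phi(y), which tends to
    0; so [D x] is at most 0. *)
Lemma Mills_le_inv x : 0 < x -> M x <= phi0 / x.
Proof.
move=> x0.
pose D y := 1 - Phi y - phi y / y.
have dD y : x <= y -> is_derive y 1 D (phi y / y ^+ 2).
  move=> xy; have y0 : y != 0 by rewrite gt_eqF// (lt_le_trans x0).
  have h1 := is_derive_Phi y.
  have h2 := is_derive_phi y.
  have h3 : is_derive y 1 (fun y : R => y^-1) (- y ^- 2 *: 1) := is_deriveV (f := id) y0 (is_derive_id y 1).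
  rewrite /D; apply: is_derive_eq; rewrite /= /GRing.scale/=; field.
  by [].
have Dle y : x <= y -> D x <= 1 - Phi y.
  move=> xy; apply: (@le_trans _ _ (D y)).
    apply: (le_of_derive_ge0 D (fun y => phi y / y ^+ 2)) => //.
      by move=> z /andP[+ _]; exact: dD.
    by move=> z _; rewrite divr_ge0 ?sqr_ge0 ?normal_pdf_ge0.
  by rewrite /D gerBl divr_ge0 ?normal_pdf_ge0// (le_trans (ltW x0)).
have D0 : D x <= 0.
  apply: (le_lim_y (fun y => 1 - Phi y)).
    have -> : (0:R) = 1 - 1 by rewrite subrr.
    by apply: cvgB; [exact: cvg_cst|exact: cvg_Phi_y].
  exact: Dle.
have -> : M x = (D x + phi x / x) * expR (x ^+ 2 / 2) by rewrite /D /Mills; congr (_ * _); ring.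
have e : expR (- (x ^+ 2) / 2) * expR (x ^+ 2 / 2) = 1.
  by rewrite -expRD mulNr addNr expR0.
rewrite mulrDl phiE.
have -> : phi0 * expR (- x ^+ 2 / 2) / x * expR (x ^+ 2 / 2) = phi0 / x.
  by rewrite -[RHS]mulr1 -[X in _ = _ * X]e; ring.
by rewrite gerDr mulr_le0_ge0 ?expR_ge0.
Qed.

(** One more term of the asymptotic expansion reverses the monotonicity: [D] now has derivative -3
    phi(y) / y^4, and [D y] is at least -phi0 / y. *)
Lemma Mills_ge_inv x : 0 < x -> phi0 * (x^-1 - x^-1 ^+ 3) <= M x.
Proof.
move=> x0.
pose D y := 1 - Phi y - phi y * (y^-1 - y^-1 ^+ 3).
have dD y : x <= y -> is_derive y 1 D (- (3 * phi y / y ^+ 4)).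
  move=> xy; have y0 : y != 0 by rewrite gt_eqF// (lt_le_trans x0).
  have h1 := is_derive_Phi y.
  have h2 := is_derive_phi y.
  have h3 : is_derive y 1 (fun y : R => y^-1) (- y ^- 2 *: 1) := is_deriveV (f := id) y0 (is_derive_id y 1).
  rewrite /D; apply: is_derive_eq; rewrite /= /GRing.scale/=; field.
  by [].
have Dge y : x <= y -> - (phi0 / y) <= D x.
  move=> xy; have y0 : 0 < y by exact: lt_le_trans xy.
  apply: (@le_trans _ _ (D y)).
    rewrite /D; have := Phi_le1 y.
    suff : phi y * (y^-1 - y^-1 ^+ 3) <= phi0 / y by lra.
    apply: (@le_trans _ _ (phi y / y)).
      by rewrite ler_wpM2l ?normal_pdf_ge0// gerBl exprn_ge0// invr_ge0 ltW.
    by rewrite ler_wpM2r ?invr_ge0 ?(ltW y0)// normal_pdf_ub// oner_neq0.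
  rewrite -lerN2.
  apply: (le_of_derive_ge0 (fun z => - D z) (fun z => 3 * phi z / z ^+ 4)) => //.
    by move=> z /andP[xz _]; have := is_deriveN (dD z xz); rewrite opprK.
  by move=> z _; rewrite divr_ge0 ?exprn_even_ge0// mulr_ge0// normal_pdf_ge0.
have D0 : 0 <= D x.
  rewrite leNgt; apply/negP => D0.
  (* If [D x] were negative, [Dge] would confine [y] to at most phi0 / (- D x); twice that value is
     a contradiction. *)
  pose y := Num.max x (2 * phi0 / - D x).
  have y0 : 0 < y by rewrite lt_max x0.
  have h1 : 2 * phi0 / - D x <= y by rewrite le_max lexx orbT.
  have h2 : - (phi0 / y) <= D x by apply: Dge; rewrite le_max lexx.
  move: h1; rewrite ler_pdivrMr ?oppr_gt0// => h1.
  move: h2; rewrite -mulNr ler_pdivrMr// => h2.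
  by have := phi0_gt0; lra.
have e : expR (- (x ^+ 2) / 2) * expR (x ^+ 2 / 2) = 1.
  by rewrite -expRD mulNr addNr expR0.
have -> : M x = D x * expR (x ^+ 2 / 2) + phi0 * (x^-1 - x^-1 ^+ 3) * (expR (- (x ^+ 2) / 2) * expR (x ^+ 2 / 2)).
  by rewrite /D /Mills phiE; ring.
by rewrite e mulr1 lerDr mulr_ge0// expR_ge0.
Qed.

Lemma Mills_homo x y : x <= y -> M y <= M x.
Proof.
move=> xy; rewrite -lerN2.
apply: (le_of_derive_ge0 (fun z => - M z) (fun z => - (z * M z - phi0))) => // z _.
  by have := is_deriveN (is_derive_Mills z).
rewrite oppr_ge0 subr_le0; have [z0|z0] := leP z 0.
  by rewrite (@le_trans _ _ 0) ?(ltW phi0_gt0)// mulr_le0_ge0// Mills_ge0.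
by have := Mills_le_inv z z0; rewrite ler_pdivlMr// mulrC.
Qed.

(** The function M(z) - phi0 / z is nondecreasing: its derivative is nonnegative by [Mills_ge_inv]
    multiplied by z. Reciprocals of the tilted and the original argument are explicit, so this is
    the form in which M(a) is traded for M(x). *)
Lemma Mills_sub_le a x : 0 < a -> a <= x -> M a - M x <= phi0 * (a^-1 - x^-1).
Proof.
move=> a0 ax; suff : M a - phi0 / a <= M x - phi0 / x by lra.
apply: (le_of_derive_ge0 (fun z => M z - phi0 / z) (fun z => z * M z - phi0 + phi0 / z ^+ 2)) => //.
  move=> z /andP[az _]; have z0 : z != 0 by rewrite gt_eqF// (lt_le_trans a0).
  have h2 := is_derive_Mills z.
  have h3 : is_derive z 1 (fun z : R => z^-1) (- z ^- 2 *: 1) := is_deriveV (f := id) z0 (is_derive_id z 1).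
  apply: is_derive_eq; rewrite /= /GRing.scale/=; field.
  by [].
move=> z /andP[az _]; have z0 : 0 < z by exact: lt_trans az.
have := Mills_ge_inv z z0; rewrite -(ler_pM2l z0) => h.
have e : z * (phi0 * (z^-1 - z^-1 ^+ 3)) = phi0 - phi0 / z ^+ 2.
  by field; rewrite gt_eqF.
by move: h; rewrite e; lra.
Qed.

End Mills.

(** * Numerical bounds for pi and 1 / sqrt(2 pi) *)

Section PiBounds.
Context {R : realType}.
Implicit Types x : R.

Lemma le_of_is_derive_le (f g df dg : R -> R) x : 0 <= x ->
  (forall y : R, is_derive y 1 f (df y)) -> (forall y : R, is_derive y 1 g (dg y)) ->
  (forall y, 0 <= y -> df y <= dg y) -> f 0 = g 0 -> f x <= g x.
Proof.
move=> x0 hf hg h e.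
suff : g 0 - f 0 <= g x - f x by lra.
apply: (le_of_derive_ge0 (fun y => g y - f y) (fun y => dg y - df y)) => // y.

by move=> /andP[y0 _]; rewrite subr_ge0; apply: h; exact: ltW.
Qed.

Lemma sin_le1 x : 0 <= x -> sin x <= x.
Proof.
move=> x0; apply: (le_of_is_derive_le (@sin R) id cos (fun=> 1)) => //; do ?[exact: sin0|by move=> y _; exact: cos_le1].
Qed.

Lemma cos_ge2 x : 0 <= x -> 1 - x ^+ 2 / 2 <= cos x.
Proof.
move=> x0; apply: (le_of_is_derive_le (fun x => 1 - x ^+ 2 / 2) (@cos R) (fun x => - x) (fun x => - sin x)) => //;
  do ?[by rewrite cos0; field
  |by move=> y y0; rewrite lerN2 sin_le1
  |by move=> y; apply: is_derive_eq; rewrite /= /GRing.scale/=; lra].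
Qed.

Lemma sin_ge3 x : 0 <= x -> x - x ^+ 3 / 6 <= sin x.
Proof.
move=> x0; apply: (le_of_is_derive_le (fun x => x - x ^+ 3 / 6) (@sin R) (fun x => 1 - x ^+ 2 / 2) (@cos R)) => //;
  do ?[by rewrite sin0; field
  |by move=> y y0; rewrite cos_ge2
  |by move=> y; apply: is_derive_eq; rewrite /= /GRing.scale/=; lra].
Qed.

Lemma cos_le4 x : 0 <= x -> cos x <= 1 - x ^+ 2 / 2 + x ^+ 4 / 24.
Proof.
move=> x0; apply: (le_of_is_derive_le (@cos R) (fun x => 1 - x ^+ 2 / 2 + x ^+ 4 / 24) (fun x => - sin x) (fun x => - (x - x ^+ 3 / 6))) => //;
  do ?[by rewrite cos0; field
  |by move=> y y0; rewrite lerN2 sin_ge3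
  |by move=> y; apply: is_derive_eq; rewrite /= /GRing.scale/=; lra].
Qed.

(** The fourth-order Taylor bound for the cosine is already negative at 8/5; in [pi_gt] the
    second-order one is still positive at 1.41. *)
Lemma pi_lt : pi < 16 / 5 :> R.
Proof.
have c : cos (8 / 5) < 0 :> R.
  by apply: (le_lt_trans (cos_le4 _ _)); lra.
have := pi_ge2 R.
have : ~~ (- (pi / 2) <= (8 / 5 : R) <= pi / 2).
  by apply: contraTN c => /cos_ge0_pihalf; rewrite -leNgt.
by rewrite negb_and -!ltNge => /orP[]; lra.
Qed.

Lemma pi_gt : 141 / 50 < pi :> R.
Proof.
have c : 0 < cos (141 / 100) :> R.
  by apply: (lt_le_trans _ (cos_ge2 _ _)); lra.
have := pi_ge2 R => p2.
rewrite ltNge; apply/negP => h.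
have : cos (141 / 100) <= cos (pi / 2) :> R.
  have [->//|ne] := eqVneq (141 / 100 : R) (pi / 2).
  by rewrite ltW// ltr_cos ?in_itv/=; lra.
by rewrite cos_pihalf; lra.
Qed.

Lemma phi0_sqr : (phi0 : R) ^+ 2 * (2 * pi) = 1.
Proof.
have p0 : 0 < 2 * pi :> R by rewrite mulr_gt0// pi_gt0.
rewrite /phi0 /normal_peak (_ : _ *+ 2 = 2 * pi); last by rewrite expr1n mul1r mulr_natl.
by rewrite exprVn sqr_sqrtr ?(ltW p0)// mulVf// gt_eqF.
Qed.

(** The lower bound enters the constant 7 of the Stein estimate, the upper bound the constant
    27.99. *)
Lemma phi0_bounds : 39 / 100 <= (phi0 : R) <= 422 / 1000.
Proof.
have h := phi0_sqr; have := pi_lt; have := pi_gt; have := @phi0_gt0 R => p0 pg pl.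
apply/andP; split; rewrite leNgt; apply/negP => hlt.
  have : (phi0 : R) ^+ 2 <= (39 / 100) ^+ 2 by rewrite ler_sqr ?nnegrE; lra.
  nra.
have : (422 / 1000) ^+ 2 <= (phi0 : R) ^+ 2 by rewrite ler_sqr ?nnegrE; lra.
nra.
Qed.

End PiBounds.

(** * Stein's equation for an exponential tail *)

(** The functions to be estimated are given by two formulas, each differentiable on the whole line,
    that agree at [c]. Monotonicity is checked on either side, so nothing is differentiated across
    the corner. *)
Lemma le_of_glue {R : realType} (F1 F2 d1 d2 : R -> R) (c x y : R) : x <= y ->
  (forall w : R, is_derive w 1 F1 (d1 w)) -> (forall w : R, is_derive w 1 F2 (d2 w)) ->
  F1 c = F2 c ->
  (forall w, x <= w <= y -> w <= c -> 0 <= d1 w) ->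
  (forall w, x <= w <= y -> c <= w -> 0 <= d2 w) ->
  (if x <= c then F1 x else F2 x) <= (if y <= c then F1 y else F2 y).
Proof.
move=> xy h1 h2 e p1 p2; case: ifPn => xc; case: ifPn => yc.
- apply: (le_of_derive_ge0 F1 d1) => // w /andP[/ltW xw /ltW wy].
  by apply: p1; rewrite ?xw ?wy// (le_trans wy).
- rewrite -ltNge in yc; apply: (@le_trans _ _ (F1 c)).
    apply: (le_of_derive_ge0 F1 d1) => // w /andP[/ltW xw /ltW wy].
    by apply: p1 => //; rewrite xw (le_trans wy)// ltW.
  rewrite e; apply: (le_of_derive_ge0 F2 d2) => //; first exact: ltW.
  move=> w /andP[/ltW xw /ltW wy]; apply: p2 => //.
  by rewrite wy andbT (le_trans xc).
- by move: xc; rewrite (le_trans xy yc).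
- rewrite -ltNge in xc; apply: (le_of_derive_ge0 F2 d2) => // w /andP[/ltW xw /ltW wy].
  by apply: p2; rewrite ?xw ?wy// (le_trans (ltW xc)).
Qed.

Section glue.
Context {R : realType} (F1 F2 d1 d2 : R -> R) (c : R).
Hypothesis dF1 : forall w : R, is_derive w 1 F1 (d1 w).
Hypothesis dF2 : forall w : R, is_derive w 1 F2 (d2 w).
Hypothesis F12 : F1 c = F2 c.
Let F (w : R) := if w <= c then F1 w else F2 w.

(** Both [F w + w] and [w - F w] are nondecreasing. *)
Lemma lip_of_glue (u v : R) :
  (forall w, w <= c -> `|d1 w| <= 1) -> (forall w, c <= w -> `|d2 w| <= 1) ->
  `|F u - F v| <= `|u - v|.
Proof.
move=> b1 b2; wlog uv : u v / u <= v.
  move=> H; have [/H//|/ltW/H] := leP u v.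
  by rewrite distrC [leRHS]distrC.
have D1 (w : R) : is_derive w 1 (fun w => F1 w + w) (d1 w + 1).
  by have h := dF1 w; apply: is_derive_eq.
have D2 (w : R) : is_derive w 1 (fun w => F2 w + w) (d2 w + 1).
  by have h := dF2 w; apply: is_derive_eq.
have D3 (w : R) : is_derive w 1 (fun w => w - F1 w) (1 - d1 w).
  by have h := dF1 w; apply: is_derive_eq.
have D4 (w : R) : is_derive w 1 (fun w => w - F2 w) (1 - d2 w).
  by have h := dF2 w; apply: is_derive_eq.
have e1 : F1 c + c = F2 c + c by rewrite F12.
have e2 : c - F1 c = c - F2 c by rewrite F12.
have H1 := le_of_glue _ _ _ _ c u v uv D1 D2 e1.
have H2 := le_of_glue _ _ _ _ c u v uv D3 D4 e2.
have {}H1 : F u + u <= F v + v.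
  have : (if u <= c then F1 u + u else F2 u + u) <= (if v <= c then F1 v + v else F2 v + v).
    apply: H1 => w _; first by move=> /b1; rewrite ler_norml; lra.
    by move=> /b2; rewrite ler_norml; lra.
  by rewrite /F; do 2 case: ifP => _.
have {}H2 : u - F u <= v - F v.
  have : (if u <= c then u - F1 u else u - F2 u) <= (if v <= c then v - F1 v else v - F2 v).
    apply: H2 => w _; first by move=> /b1; rewrite ler_norml; lra.
    by move=> /b2; rewrite ler_norml; lra.
  by rewrite /F; do 2 case: ifP => _.
by rewrite (ler0_norm (x := u - v)) ?subr_le0// ler_norml; lra.
Qed.

(** [G] plays the role of the derivative at [w]. The function F(v) - v G, corrected by +L (v - w)^2
    / 2 to the right of [w] and by -L (v - w)^2 / 2 to the left, is nondecreasing between [w] and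
    [w + y]. *)
Lemma taylor_of_glue (w y G L : R) :
  (forall v, v <= c -> `|d1 v - G| <= L * `|v - w|) ->
  (forall v, c <= v -> `|d2 v - G| <= L * `|v - w|) ->
  y ^+ 2 * G - y * (F (w + y) - F w) <= L * `|y| ^+ 3 / 2.
Proof.
move=> gl gr; have [y0|y0] := leP 0 y.
- have D1 (v : R) : is_derive v 1 (fun v => F1 v - v * G + L * (v - w) ^+ 2 / 2) (d1 v - G + L * (v - w)).
    by have h := dF1 v; apply: is_derive_eq; rewrite /= /GRing.scale/=; field.
  have D2 (v : R) : is_derive v 1 (fun v => F2 v - v * G + L * (v - w) ^+ 2 / 2) (d2 v - G + L * (v - w)).
    by have h := dF2 v; apply: is_derive_eq; rewrite /= /GRing.scale/=; field.
  have wy : w <= w + y by rewrite lerDl.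
  have e1 : F1 c - c * G + L * (c - w) ^+ 2 / 2 = F2 c - c * G + L * (c - w) ^+ 2 / 2 by rewrite F12.
  have H := le_of_glue _ _ _ _ c w (w + y) wy D1 D2 e1.
  have {}H : F w - w * G <= F (w + y) - (w + y) * G + L * y ^+ 2 / 2.
    have : (if w <= c then F1 w - w * G + L * (w - w) ^+ 2 / 2
         else F2 w - w * G + L * (w - w) ^+ 2 / 2) <=
       (if w + y <= c then F1 (w + y) - (w + y) * G + L * (w + y - w) ^+ 2 / 2
         else F2 (w + y) - (w + y) * G + L * (w + y - w) ^+ 2 / 2).
      apply: H => v /andP[wv _].
        by move=> /gl; rewrite (ger0_norm (x := v - w)) ?subr_ge0// ler_norml; lra.
      by move=> /gr; rewrite (ger0_norm (x := v - w)) ?subr_ge0// ler_norml; lra.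
    have -> : w + y - w = y by ring.
    by rewrite subrr /F; do 2 case: ifP => _; lra.
  rewrite ger0_norm//.
  have : 0 <= y * (F (w + y) - (w + y) * G + L * y ^+ 2 / 2 - (F w - w * G)).
    by rewrite mulr_ge0// subr_ge0.
  by lra.
- have D1 (v : R) : is_derive v 1 (fun v => F1 v - v * G - L * (v - w) ^+ 2 / 2) (d1 v - G - L * (v - w)).
    by have h := dF1 v; apply: is_derive_eq; rewrite /= /GRing.scale/=; field.
  have D2 (v : R) : is_derive v 1 (fun v => F2 v - v * G - L * (v - w) ^+ 2 / 2) (d2 v - G - L * (v - w)).
    by have h := dF2 v; apply: is_derive_eq; rewrite /= /GRing.scale/=; field.
  have wy : w + y <= w by rewrite gerDl ltW.
  have e1 : F1 c - c * G - L * (c - w) ^+ 2 / 2 = F2 c - c * G - L * (c - w) ^+ 2 / 2 by rewrite F12.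
  have H := le_of_glue _ _ _ _ c (w + y) w wy D1 D2 e1.
  have {}H : F (w + y) - (w + y) * G - L * y ^+ 2 / 2 <= F w - w * G.
    have : (if w + y <= c then F1 (w + y) - (w + y) * G - L * (w + y - w) ^+ 2 / 2
         else F2 (w + y) - (w + y) * G - L * (w + y - w) ^+ 2 / 2) <=
       (if w <= c then F1 w - w * G - L * (w - w) ^+ 2 / 2
         else F2 w - w * G - L * (w - w) ^+ 2 / 2).
      apply: H => v /andP[_ wv].
        by move=> /gl; rewrite (ler0_norm (x := v - w)) ?subr_le0// ler_norml; lra.
      by move=> /gr; rewrite (ler0_norm (x := v - w)) ?subr_le0// ler_norml; lra.
    have -> : w + y - w = y by ring.
    by rewrite subrr /F; do 2 case: ifP => _; lra.
  rewrite ltr0_norm//.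
  have : 0 <= - y * (F w - w * G - (F (w + y) - (w + y) * G - L * y ^+ 2 / 2)).
    by rewrite mulr_ge0 ?subr_ge0// oppr_ge0 ltW.
  by lra.
Qed.

End glue.

Lemma is_derive_add_linear {R : realType} (F : R -> R) (d p v : R) :
  is_derive v 1 F d -> is_derive v 1 (fun w => F w + p * w) (d + p).
Proof. by move=> h; apply: is_derive_eq; rewrite /= /GRing.scale/=; ring. Qed.

Lemma is_derive_exp_primitive {R : realType} (a c v : R) : a != 0 ->
  is_derive v 1 (fun w => (1 - expR (- a * (w - c))) / a) (expR (- a * (v - c))).
Proof. by move=> a0; apply: is_derive_eq; rewrite /= /GRing.scale/=; field. Qed.

Lemma is_derive_sub {R : realType} (F G : R -> R) (d e v : R) :
  is_derive v 1 F d -> is_derive v 1 G e -> is_derive v 1 (fun w => F w - G w) (d - e).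
Proof. by move=> h1 h2; apply: is_derive_eq. Qed.

Section Stein.
Context {R : realType} (a c : R).
Hypothesis (a0 : 0 < a) (c0 : 0 <= c).
Local Notation M := (@Mills R).

(* tail_mean is the mean of exp_tail under the standard normal law, and stein_sol is the bounded
   solution f of f'(w) = w f(w) + exp_tail w - tail_mean. *)
Definition exp_tail (w : R) : R := if w <= c then 0 else expR (- a * (w - c)).
Definition exp_prim (w : R) : R := if w <= c then 0 else (1 - expR (- a * (w - c))) / a.
Definition tail_mean : R := expR (- c ^+ 2 / 2) * M (a + c).
(** The solution is e^(w^2/2) times the integral of (h - p) e^(-u^2/2) over u < w, where h is
    [exp_tail] and p is [tail_mean]; Mills' ratio expresses it in closed form on each side of
    [c]. *)
Let f1 (w : R) : R := - (tail_mean / phi0) * M (- w).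
Let f2 (w : R) : R := (tail_mean * M w - expR (- a * (w - c)) * M (w + a)) / phi0.
Definition stein_sol (w : R) : R := if w <= c then f1 w else f2 w.

Lemma Mills_mul_le (z : R) : z * M z <= phi0.
Proof.
have [z0|z0] := leP z 0.
  by rewrite (@le_trans _ _ 0) ?(ltW phi0_gt0)// mulr_le0_ge0// Mills_ge0.
by have := Mills_le_inv z z0; rewrite ler_pdivlMr// mulrC.
Qed.

Lemma Mills_le_half (z : R) : 0 <= z -> M z <= 1 / 2.
Proof. by move=> z0; rewrite -(@Mills0 R); apply: Mills_homo. Qed.

Lemma tail_mean_ge0 : 0 <= tail_mean.
Proof. by rewrite mulr_ge0 ?expR_ge0 ?Mills_ge0. Qed.

Lemma expR_half_sqr : expR (- c ^+ 2 / 2) * expR (c ^+ 2 / 2) = 1.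
Proof. by rewrite -expRD mulNr addNr expR0. Qed.

(** Because e^(-c^2/2) M(-c) = Phi(c). Up to the factor -1 / phi0 this is the value of the solution
    at [c], where its left branch is largest in modulus. *)
Lemma tail_mean_MillsN : tail_mean * M (- c) = M (a + c) * Phi c.
Proof.
rewrite /tail_mean [M (- c)]/Mills sqrrN Phi_sym.
transitivity (M (a + c) * Phi c * (expR (- c ^+ 2 / 2) * expR (c ^+ 2 / 2))); first ring.
by rewrite expR_half_sqr mulr1.
Qed.

Lemma tail_mean_le : tail_mean <= 1 - Phi c.
Proof.
have -> : 1 - Phi c = expR (- c ^+ 2 / 2) * M c.
  rewrite /Mills; transitivity ((1 - Phi c) * (expR (- c ^+ 2 / 2) * expR (c ^+ 2 / 2))); last ring.
  by rewrite expR_half_sqr mulr1.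
by rewrite ler_wpM2l ?expR_ge0//; apply: Mills_homo; rewrite lerDr ltW.
Qed.

Lemma tail_mean_le1 : tail_mean <= 1.
Proof. by rewrite (le_trans tail_mean_le)// gerBl Phi_ge0. Qed.

Let df1 (w : R) : is_derive w 1 f1 (w * f1 w - tail_mean).
Proof.
have h := is_derive_Mills (- w).
have h3 : is_derive w 1 (fun z => M (- z)) (- (- w * M (- w) - phi0)).
  have := @is_derive1_comp R M (fun z => - z) w _ _ h (is_deriveN (is_derive_id w 1)).
  by rewrite mulrN1; apply.
rewrite /f1; apply: is_derive_eq; rewrite /= /GRing.scale/=; field.
by rewrite gt_eqF// phi0_gt0.
Qed.

Let df2 (w : R) : is_derive w 1 f2 (w * f2 w - tail_mean + expR (- a * (w - c))).
Proof.
have h := is_derive_Mills w.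
have h3 : is_derive w 1 (fun z => M (z + a)) ((w + a) * M (w + a) - phi0).
  have := @is_derive1_comp R M (fun z => z + a) w _ _ (is_derive_Mills (w + a)) (is_deriveD (is_derive_id w 1) (is_derive_cst a w 1)).
  by rewrite addr0 mulr1; apply.
rewrite /f2; apply: is_derive_eq; rewrite /= /GRing.scale/=; field.
by rewrite gt_eqF// phi0_gt0.
Qed.

Let f12 : f1 c = f2 c.
Proof.
rewrite /f1 /f2 subrr mulr0 expR0 mul1r.
have : tail_mean * (M c + M (- c)) = M (c + a).
  rewrite MillsDN /tail_mean; transitivity (M (a + c) * (expR (- c ^+ 2 / 2) * expR (c ^+ 2 / 2))); first ring.
  by rewrite expR_half_sqr mulr1 addrC.
by move=> <-; field; rewrite gt_eqF// phi0_gt0.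
Qed.

Lemma stein_sol_bound w : `|stein_sol w| <= (2 * phi0)^-1.
Proof.
have p0 := @phi0_gt0 R; have i0 : 0 < (phi0 : R)^-1 by rewrite invr_gt0.
have -> : (2 * phi0)^-1 = (1 / 2) / phi0 :> R by field; rewrite gt_eqF.
rewrite /stein_sol; case: ifPn => wc.
  have n0 : 0 <= tail_mean / phi0 * M (- w).
    by apply: mulr_ge0; [rewrite divr_ge0 ?tail_mean_ge0 ?(ltW p0)|exact: Mills_ge0].
  rewrite /f1 mulNr normrN (ger0_norm n0).
  rewrite mulrAC. rewrite ler_pM2r//.
  apply: (@le_trans _ _ (tail_mean * M (- c))).
    by rewrite ler_wpM2l ?tail_mean_ge0//; apply: Mills_homo; rewrite lerN2.
  rewrite tail_mean_MillsN -[leRHS]mulr1 ler_pM ?Mills_ge0 ?Phi_ge0 ?Phi_le1//.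
  by rewrite Mills_le_half// addr_ge0// ltW.
rewrite -ltNge in wc; have w0 : 0 <= w by rewrite ltW// (le_lt_trans c0).
rewrite /f2 normrM (gtr0_norm (x := phi0^-1)) // ler_pM2r//.
have A : 0 <= tail_mean * M w <= 1 / 2.
  have -> /= : 0 <= tail_mean * M w by apply: mulr_ge0; [exact: tail_mean_ge0|exact: Mills_ge0].
  rewrite -[leRHS]mul1r.
  by rewrite ler_pM ?tail_mean_ge0 ?Mills_ge0 ?tail_mean_le1 ?Mills_le_half.
have B : 0 <= expR (- a * (w - c)) * M (w + a) <= 1 / 2.
  have -> /= : 0 <= expR (- a * (w - c)) * M (w + a).
    by apply: mulr_ge0; [exact: expR_ge0|exact: Mills_ge0].
  rewrite -[leRHS]mul1r.
  rewrite ler_pM ?expR_ge0 ?Mills_ge0 ?Mills_le_half ?addr_ge0 ?(ltW a0)//.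
  by rewrite -expR0 ler_expR mulNr oppr_le0 mulr_ge0 ?(ltW a0)// subr_ge0 ltW.
by rewrite ler_norml; lra.
Qed.

Let d1b (w : R) : w <= c -> -1 <= w * f1 w - tail_mean <= 0.
Proof.
move=> wc; have p0 := @phi0_gt0 R; have i0 : 0 < (phi0 : R)^-1 by rewrite invr_gt0.
have e : w * f1 w - tail_mean = - (tail_mean * (phi0 - (- w) * M (- w)) / phi0).
  by rewrite /f1; field; rewrite gt_eqF.
rewrite e oppr_le0 lerN2 ler_pdivrMr// mul1r; apply/andP; split; last first.
  by rewrite mulr_ge0 ?invr_ge0 ?(ltW p0)// mulr_ge0 ?tail_mean_ge0// subr_ge0 Mills_mul_le.
have pl := tail_mean_le1; have pge := tail_mean_ge0.
have [w0|w0] := leP w 0.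
  have : 0 <= - w * M (- w) by rewrite mulr_ge0 ?Mills_ge0// oppr_ge0.
  by move: (- w * M (- w)) => u; nra.
(* For w > 0 the two parts of p (phi0 + w M(-w)) are at most (1 - Phi c) phi0 and (Phi c) phi0,
   which add up to phi0. *)
have h1 : w * M (- w) <= c * M (- c).
  by rewrite ler_pM ?Mills_ge0 ?(ltW w0)//; apply: Mills_homo; rewrite lerN2.
have h2 : c * M (a + c) <= phi0.
  apply: le_trans (Mills_mul_le (a + c)).
  by rewrite ler_wpM2r ?Mills_ge0// lerDr ltW.
have h3 := tail_mean_MillsN; have h4 := tail_mean_le; have h5 := Phi_ge0 c.
have h6 : tail_mean * (w * M (- w)) <= Phi c * phi0.
  apply: (@le_trans _ _ (tail_mean * (c * M (- c)))); first by rewrite ler_wpM2l.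
  have -> : tail_mean * (c * M (- c)) = Phi c * (c * M (a + c)) by rewrite mulrCA h3; ring.
  exact: ler_wpM2l.
have h7 : tail_mean * phi0 <= (1 - Phi c) * phi0 by rewrite ler_wpM2r// ltW.
by lra.
Qed.

Let d2b (w : R) : c <= w -> `|w * f2 w - tail_mean + expR (- a * (w - c))| <= 1.
Proof.
move=> cw; have p0 := @phi0_gt0 R; have i0 : 0 < (phi0 : R)^-1 by rewrite invr_gt0.
have w0 := le_trans c0 cw.
have e : w * f2 w - tail_mean + expR (- a * (w - c)) =
   (expR (- a * (w - c)) * (phi0 - w * M (w + a)) - tail_mean * (phi0 - w * M w)) / phi0.
  by rewrite /f2; field; rewrite gt_eqF.
have E0 := expR_ge0 (- a * (w - c)).
have E1 : expR (- a * (w - c)) <= 1.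
  by rewrite -expR0 ler_expR mulNr oppr_le0 mulr_ge0 ?(ltW a0)// subr_ge0.
have pl := tail_mean_le1; have pge := tail_mean_ge0.
have m1 : 0 <= w * M w by apply: mulr_ge0 => //; exact: Mills_ge0.
have m2 : 0 <= w * M (w + a) by apply: mulr_ge0 => //; exact: Mills_ge0.
have m3 := Mills_mul_le w.
have m4 : w * M (w + a) <= phi0.
  by apply: le_trans (Mills_mul_le (w + a)); rewrite ler_wpM2r ?Mills_ge0// lerDl ltW.
have h1 : 0 <= phi0 - w * M w <= phi0 by lra.
have h2 : 0 <= phi0 - w * M (w + a) <= phi0 by lra.
rewrite e normrM (gtr0_norm (x := phi0^-1))// ler_pdivrMr// mul1r.
move: (phi0 - w * M w) (phi0 - w * M (w + a)) h1 h2 => u v /andP[u0 u1] /andP[v0 v1].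
have A : 0 <= expR (- a * (w - c)) * v <= phi0.
  by rewrite mulr_ge0//= -[leRHS]mul1r; apply: ler_pM.
have B : 0 <= tail_mean * u <= phi0.
  by rewrite mulr_ge0//= -[leRHS]mul1r; apply: ler_pM.
by rewrite ler_norml; lra.
Qed.

(** The derivative jumps at [c], but both branches keep it in [-1, 1], whatever [a] and [c] are. *)
Lemma stein_sol_lip u v : `|stein_sol u - stein_sol v| <= `|u - v|.
Proof.
apply: (lip_of_glue _ _ _ _ _ df1 df2 f12) => w; last exact: d2b.
by move=> /d1b; rewrite ler_norml; lra.
Qed.

Lemma stein_mul_lip w v : `|v * stein_sol v - w * stein_sol w| <= (`|w| + (2 * phi0)^-1) * `|v - w|.
Proof.
have -> : v * stein_sol v - w * stein_sol w = w * (stein_sol v - stein_sol w) + (v - w) * stein_sol v by ring.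
rewrite (le_trans (ler_normD _ _))// !normrM mulrDl lerD//.
  by rewrite ler_wpM2l// stein_sol_lip.
by rewrite mulrC ler_wpM2r// stein_sol_bound.
Qed.

(* smooth_part is a primitive of w f(w), the continuous part of f', where f = stein_sol. *)
Definition smooth_part (w : R) : R := stein_sol w - exp_prim w + tail_mean * w.

Let k1 (w : R) : R := f1 w + tail_mean * w.
Let k2 (w : R) : R := f2 w - (1 - expR (- a * (w - c))) / a + tail_mean * w.

Let kE w : smooth_part w = if w <= c then k1 w else k2 w.
Proof. by rewrite /smooth_part /k1 /k2 /stein_sol /exp_prim; case: ifP => _; rewrite ?subr0. Qed.

(** Taylor estimate for a function with derivative w f(w); [stein_mul_lip] supplies the Lipschitz
    constant seen from [w], in which [a] does not occur. *)
Lemma stein_smooth w y :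
  y ^+ 2 * (w * stein_sol w) - y * (smooth_part (w + y) - smooth_part w) <=
    (`|w| + (2 * phi0)^-1) * `|y| ^+ 3 / 2.
Proof.
set L := `|w| + _; set G := w * stein_sol w.
have k12 : k1 c = k2 c by rewrite /k1 /k2 f12 subrr mulr0 expR0 subrr mul0r subr0.
have a1 : a != 0 by rewrite gt_eqF.
have dk1 (v : R) : is_derive v 1 k1 (v * f1 v).
  apply: (is_derive_eq (is_derive_add_linear f1 _ tail_mean v (df1 v))).
  by rewrite subrK.
have dk2 (v : R) : is_derive v 1 k2 (v * f2 v).
  apply: (is_derive_eq (is_derive_add_linear _ _ tail_mean v
    (is_derive_sub _ _ _ _ v (df2 v) (is_derive_exp_primitive a c v a1)))).
  by rewrite addrK subrK.
have gl v : v <= c -> `|v * f1 v - G| <= L * `|v - w|.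
  by move=> vc; have := stein_mul_lip w v; rewrite [stein_sol v]/stein_sol vc.
have gr v : c <= v -> `|v * f2 v - G| <= L * `|v - w|.
  move=> cv; have := stein_mul_lip w v; rewrite [stein_sol v]/stein_sol; case: ifPn => // vc.
  by have -> : v = c by [apply/eqP; rewrite eq_le vc]; rewrite f12.
by rewrite !kE; exact: (taylor_of_glue _ _ _ _ _ dk1 dk2 k12 _ _ _ _ gl gr).
Qed.

End Stein.

(** * Increments of the primitive of the exponential tail *)

Section primitive.
Context {R : realType} (a c : R).
Hypothesis a0 : 0 < a.
Local Notation h := (exp_tail a c).
Local Notation K := (exp_prim a c).

Lemma exp_tail_ge0 (w : R) : 0 <= h w.
Proof. by rewrite /exp_tail; case: ifP => // _; exact: expR_ge0. Qed.

Lemma exp_tail_le1 (w : R) : h w <= 1.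
Proof.
rewrite /exp_tail; case: ifPn => // wc; rewrite -expR0 ler_expR mulNr oppr_le0.
by rewrite -ltNge in wc; rewrite mulr_ge0 ?(ltW a0)// subr_ge0 ltW.
Qed.

(** Beyond [c] the tail decreases, so its mean over [u, v] is at least its value at [v]. *)
Lemma exp_prim_sub_ge (u v : R) : c < u -> u <= v -> (v - u) * h v <= K v - K u.
Proof.
move=> cu uv; have cv := lt_le_trans cu uv.
rewrite /exp_prim /exp_tail (lt_geF cu) (lt_geF cv).
have -> : (1 - expR (- a * (v - c))) / a - (1 - expR (- a * (u - c))) / a =
    (expR (- a * (u - c)) - expR (- a * (v - c))) / a by ring.
rewrite ler_pdivlMr//.
have -> : expR (- a * (u - c)) = expR (a * (v - u)) * expR (- a * (v - c)).
  by rewrite -expRD; congr expR; ring.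
have F1 := expR_ge1Dx (a * (v - u)); have E0 := expR_ge0 (- a * (v - c)).
set F := expR (a * (v - u)) in F1 *; set E := expR (- a * (v - c)) in E0 *.
have -> : F * E - E = (F - 1) * E by ring.
by rewrite mulrAC ler_wpM2r//; lra.
Qed.

Lemma exp_prim_ge0 (u : R) : 0 <= K u.
Proof.
rewrite /exp_prim; case: ifPn => // uc; rewrite divr_ge0 ?(ltW a0)// subr_ge0.
rewrite -expR0 ler_expR mulNr oppr_le0 mulr_ge0 ?(ltW a0)// subr_ge0 ltW//.
by rewrite ltNge.
Qed.

Lemma exp_prim_le_inv (u : R) : K u <= a^-1.
Proof.
rewrite /exp_prim; case: ifPn => uc; first by rewrite invr_ge0 ltW.
by rewrite ler_pdivrMr// mulVf ?gt_eqF// gerBl expR_ge0.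
Qed.

Lemma exp_prim_homo (u v : R) : u <= v -> K u <= K v.
Proof.
move=> uv; have [uc|cu] := leP u c.
  by rewrite {1}/exp_prim uc exp_prim_ge0.
rewrite -subr_ge0; apply: le_trans (exp_prim_sub_ge u v cu uv).
by rewrite mulr_ge0 ?exp_tail_ge0// subr_ge0.
Qed.

(** To the left of [y] the tail is at least [h y], unless the jump at [c] lies between [u] and [y];
    the indicator pays for that case. *)
Lemma exp_prim_rise (u v y : R) : u <= v -> v <= y ->
  (v - u) * (h y - (u <= c < y)%R%:R) <= K v - K u.
Proof.
move=> uv vy; have [uc|cu] := leP u c; have [yc|cy] := leP y c; rewrite /=.
- by rewrite {1}/exp_tail yc subr0 mulr0 subr_ge0 exp_prim_homo.
- apply: (@le_trans _ _ 0); last by rewrite subr_ge0 exp_prim_homo.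
  by rewrite mulr_ge0_le0 ?subr_ge0// subr_le0 exp_tail_le1.
- by move: cu; rewrite ltNge (le_trans uv (le_trans vy yc)).
- rewrite subr0; apply: le_trans (exp_prim_sub_ge _ _ cu uv).
  rewrite ler_wpM2l ?subr_ge0// /exp_tail (lt_geF cy) (lt_geF (lt_le_trans cu uv)).
  by rewrite ler_expR !mulNr lerN2 ler_pM2l// lerB.
Qed.

(** To the right of [y] there is no downward jump, only a decay by at most the factor e^(-a (v -
    y)). The deficit is kept as a weight on [h y], because estimating it by a (v - y) would bring in
    the size of [a]. *)
Lemma exp_prim_fall (u v y : R) : y <= u -> u <= v ->
  (v - u) * (h y - (1 - expR (- a * (v - y))) * h y) <= K v - K u.
Proof.
move=> yu uv; have [yc|cy] := leP y c.
  by rewrite /exp_tail yc mulr0 subr0 mulr0 subr_ge0 exp_prim_homo.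
apply: le_trans (exp_prim_sub_ge _ _ (lt_le_trans cy yu) uv).
rewrite ler_wpM2l ?subr_ge0// /exp_tail (lt_geF cy) (lt_geF (lt_le_trans cy (le_trans yu uv))).
set A := expR (- a * (v - y)); set B := expR (- a * (y - c)); have -> : B - (1 - A) * B = A * B by ring.
by rewrite /A /B -expRD ler_expR; lra.
Qed.

(* The interval [al, be] is cut at the point of it closest to y. *)
Lemma exp_prim_clamp (al be y y1 w : R) : al <= be ->
  y1 = Num.max al (Num.min y be) ->
  (be - al) * h (w + y) - (K (w + be) - K (w + al)) <=
    (y1 - al) * (w + al <= c < w + y)%R%:R +
    (be - y1) * ((1 - expR (- a * (be - y))) * h (w + y)).
Proof.
move=> ab y1E.
have ay1 : al <= y1 by rewrite y1E le_max lexx.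
have y1b : y1 <= be by rewrite y1E ge_max ab ge_min lexx orbT.
have H1 : (y1 - al) * (h (w + y) - (w + al <= c < w + y)%R%:R) <= K (w + y1) - K (w + al).
  have [yal|aly] := leP y al.
    have -> : y1 = al by rewrite y1E max_l// ge_min yal.
    by rewrite !subrr mul0r.
  have y1y : y1 <= y by rewrite y1E ge_max (ltW aly) ge_min lexx.
  have -> : y1 - al = (w + y1) - (w + al) by ring.
  by apply: exp_prim_rise; rewrite lerD2l.
have H2 : (be - y1) * (h (w + y) - (1 - expR (- a * (be - y))) * h (w + y)) <= K (w + be) - K (w + y1).
  have [bey|ybe] := leP be y.
    have -> : y1 = be by rewrite y1E min_r// max_r.
    by rewrite !subrr mul0r.
  have yy1 : y <= y1 by rewrite y1E le_max le_min lexx (ltW ybe) orbT.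
  have -> : be - y1 = (w + be) - (w + y1) by ring.
  have -> : be - y = (w + be) - (w + y) by ring.
  by apply: exp_prim_fall; rewrite lerD2l.
by lra.
Qed.

End primitive.

(** * Test functions for the concentration inequality *)

Section test_functions.
Context {R : realType} (de : R).
Hypothesis de0 : 0 < de.

(* b increases at rate at least th v on the de-neighbourhood of each v. *)
Definition test_for (b th : R -> R) := forall v y : R,
  `|y| * Num.min `|y| de * th v <= y * (b v - b (v - y)).

(** By monotonicity the increment over [y] may be shortened to length min(|y|, de), where the slope
    condition applies. *)
Lemma test_for_of_slope (b th : R -> R) : {homo b : x y / x <= y} ->
  (forall v, 0 <= th v) ->
  (forall v u1 u2, v - de <= u1 -> u1 <= u2 -> u2 <= v + de ->
    (u2 - u1) * th v <= b u2 - b u1) ->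
  test_for b th.
Proof.
move=> bh th0 H v y; have [y0|y0] := leP 0 y.
  rewrite ger0_norm// -mulrA ler_wpM2l//.
  have m1 : Num.min y de <= y by rewrite ge_min lexx.
  have m2 : Num.min y de <= de by rewrite ge_min lexx orbT.
  apply: (@le_trans _ _ (b v - b (v - Num.min y de))).
    have m0 : 0 <= Num.min y de by rewrite le_min y0 ltW.
    have := H v (v - Num.min y de) v; rewrite subKr; apply; lra.
  by rewrite lerB// bh//; lra.
rewrite ltr0_norm//.
have -> : y * (b v - b (v - y)) = (- y) * (b (v - y) - b v) by ring.
have {y0} : 0 <= - y by rewrite oppr_ge0 ltW.
move: (- y) => z z0.
rewrite -mulrA ler_wpM2l//.
have m1 : Num.min z de <= z by rewrite ge_min lexx.
have m2 : Num.min z de <= de by rewrite ge_min lexx orbT.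
have m0 : 0 <= Num.min z de by rewrite le_min z0 ltW.
apply: (@le_trans _ _ (b (v + Num.min z de) - b v)).
  have := H v v (v + Num.min z de).
  have -> : v + Num.min z de - v = Num.min z de by ring.
  by apply; lra.
by rewrite lerB// bh//; lra.
Qed.

Definition clamp (l r v : R) : R := Num.max l (Num.min v r).

Lemma clamp_homo l r : {homo clamp l r : x y / x <= y}.
Proof.
move=> x y xy; rewrite /clamp ge_max !le_max lexx/= le_min !ge_min xy lexx/=.
by rewrite !orbT.
Qed.

Lemma clampE l r v : l <= v -> v <= r -> clamp l r v = v.
Proof. by move=> lv vr; rewrite /clamp min_l// max_r. Qed.

Lemma clamp_ge l r v : l <= clamp l r v.
Proof. by rewrite /clamp le_max lexx. Qed.

Lemma clamp_le l r v : l <= r -> clamp l r v <= r.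
Proof. by move=> lr; rewrite /clamp ge_max lr ge_min lexx orbT. Qed.

(** The slope is 1 on the interval widened by [de] and 0 outside; centring halves the supremum
    norm. *)
Definition itv_test (l r v : R) : R := clamp (l - de) (r + de) v - (l + r) / 2.

Lemma itv_testP l r : l <= r -> test_for (itv_test l r) (fun v => (l < v <= r)%R%:R).
Proof.
move=> lr; apply: test_for_of_slope.
- by move=> x y xy; rewrite /itv_test lerD2r; apply: clamp_homo.
- by move=> v; rewrite ler0n.
move=> v u1 u2 h1 h12 h2; have [/andP[lv vr]|_] := boolP (l < v <= r); rewrite /=.
  have -> : itv_test l r u1 = u1 - (l + r) / 2 by rewrite /itv_test clampE//; lra.
  have -> : itv_test l r u2 = u2 - (l + r) / 2 by rewrite /itv_test clampE//; lra.
  by rewrite mulr1; lra.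
by rewrite mulr0 subr_ge0 /itv_test lerD2r; apply: clamp_homo.
Qed.

Lemma itv_test_bound l r v : l <= r -> `|itv_test l r v| <= (r - l) / 2 + de.
Proof.
move=> lr; have := clamp_ge (l - de) (r + de) v.
have := @clamp_le (l - de) (r + de) v; rewrite /itv_test ler_norml; move: de0.
by move: (clamp _ _ _) => z d0 H1 H2; have := H1 ltac:(lra); lra.
Qed.

Variables (a l q L : R).
Hypothesis a0 : 0 < a.

(** The slope is 1 from [l - de] to [l + de] and then q e^(-a (v - l - de)). The delay by [de] makes
    it dominate [q * exp_tail a l v] on the whole [de]-neighbourhood of [v]. The total rise is 2 de
    + q / a, which explains the centring. *)
Definition exp_test (v : R) : R :=
  clamp (l - de) (l + de) v + q * exp_prim a (l + de) v - (l + q / a / 2).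

Lemma exp_testP : 0 <= q <= 1 -> test_for exp_test (fun v => q * exp_tail a l v).
Proof.
move=> /andP[q0 q1].
have mono : {homo exp_test : x y / x <= y}.
  move=> x y xy; rewrite /exp_test lerD2r; apply: lerD; first exact: clamp_homo.
  by rewrite ler_wpM2l//; apply: exp_prim_homo.
apply: test_for_of_slope.
- exact: mono.
- by move=> v; rewrite mulr_ge0 ?exp_tail_ge0.
move=> v u1 u2 h1 h12 h2.
have [vl|lv] := leP v l.
  by rewrite /exp_tail vl !mulr0 subr_ge0 mono.
have th1 : q * exp_tail a l v <= 1.
  by rewrite -[leRHS]mul1r ler_pM ?exp_tail_ge0 ?exp_tail_le1.
have th0 : 0 <= q * exp_tail a l v by rewrite mulr_ge0 ?exp_tail_ge0.
have low x y : v - de <= x -> x <= y -> y <= l + de ->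
    (y - x) * (q * exp_tail a l v) <= exp_test y - exp_test x.
  move=> hx xy yl; rewrite /exp_test /exp_prim yl (le_trans xy yl) mulr0.
  have -> : clamp (l - de) (l + de) y = y by apply: clampE; lra.
  have -> : clamp (l - de) (l + de) x = x by apply: clampE; lra.
  by rewrite (@le_trans _ _ (y - x)) ?ler_piMr ?subr_ge0//; lra.
have high x y : l + de <= x -> x <= y -> y <= v + de ->
    (y - x) * (q * exp_tail a l v) <= exp_test y - exp_test x.
  move=> lx xy yv; rewrite /exp_test.
  have -> : clamp (l - de) (l + de) y = l + de by rewrite /clamp min_r ?max_r//; lra.
  have -> : clamp (l - de) (l + de) x = l + de by rewrite /clamp min_r ?max_r//; lra.
  have : (y - x) * exp_tail a l v <= exp_prim a (l + de) y - exp_prim a (l + de) x.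
    have [lx'|xl] := ltP (l + de) x.
      apply: le_trans (exp_prim_sub_ge a (l + de) a0 _ _ lx' xy).
      rewrite ler_wpM2l ?subr_ge0// /exp_tail (lt_geF lv) (lt_geF (lt_le_trans lx' xy)).
      by rewrite ler_expR !mulNr lerN2 ler_pM2l//; lra.
    have -> : x = l + de by apply/eqP; rewrite eq_le xl lx.
    have -> : exp_prim a (l + de) (l + de) = 0 by rewrite /exp_prim lexx.
    rewrite subr0 /exp_prim; case: ifPn => [yl|].
      have -> : y = l + de by apply/eqP; rewrite eq_le yl (le_trans lx).
      by rewrite subrr mul0r.
    rewrite -ltNge => ly; rewrite ler_pdivlMr// /exp_tail (lt_geF lv).
    have h5 : expR (- a * (v - l)) <= expR (- a * (y - (l + de))).
      by rewrite ler_expR !mulNr lerN2 ler_pM2l//; lra.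
    have h6 := expR_ge1Dx (a * (y - (l + de))).
    have h7 : expR (a * (y - (l + de))) * expR (- a * (y - (l + de))) = 1.
      by rewrite -expRD mulNr subrr expR0.
    have h8 := expR_ge0 (- a * (y - (l + de))).
    apply: (@le_trans _ _ ((y - (l + de)) * expR (- a * (y - (l + de))) * a)).
      by rewrite ler_wpM2r ?(ltW a0)// ler_wpM2l//; lra.
    have : (1 + a * (y - (l + de))) * expR (- a * (y - (l + de))) <= 1.
      by rewrite -[leRHS]h7 ler_wpM2r.
    by lra.
  have -> : (y - x) * (q * exp_tail a l v) = q * ((y - x) * exp_tail a l v) by ring.
  move=> /(ler_wpM2l q0); lra.
have [h3|h3] := leP u2 (l + de); first exact: low.
have [h4|h4] := leP (l + de) u1; first exact: high.
have := low u1 (l + de) h1 (ltW h4) (lexx _).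
have := high (l + de) u2 (lexx _) (ltW h3) h2.
by lra.
Qed.

(** The condition q <= a L limits the rise after [l + de] to [L], so the norm is that of [itv_test]
    for an interval of length [L], however large or small [a] is. *)
Lemma exp_test_bound v : 0 <= q -> q <= a * L -> `|exp_test v| <= L / 2 + de.
Proof.
move=> q0 qL; have := clamp_ge (l - de) (l + de) v.
have := @clamp_le (l - de) (l + de) v.
have k1 : 0 <= q * exp_prim a (l + de) v by rewrite mulr_ge0 ?exp_prim_ge0.
have k2 : q * exp_prim a (l + de) v <= q / a by rewrite ler_wpM2l ?exp_prim_le_inv.
have k3 : q / a <= L by rewrite ler_pdivrMr// mulrC.
rewrite /exp_test ler_norml; move: de0.
by move: (clamp _ _ _) => z d0 H1 H2; have := H1 ltac:(lra); lra.
Qed.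

End test_functions.

(** * Expectation, independence and exponential tilting *)

Definition Ex {d} {T : measurableType d} {R : realType} (P : probability T R)
  (f : T -> R) : R := \int[P]_x f x.

(** All absolute moments are finite. The class contains the bounded measurable functions and is
    closed under sums and products, so the integrability conditions of Stein's argument reduce to
    tameness of the summands. *)
Definition tame {d} {T : measurableType d} {R : realType} (P : probability T R)
  (f : T -> R) := measurable_fun setT f /\
  forall k, P.-integrable setT (EFin \o (fun x => `|f x| ^+ k)).

Section Tame.
Context {d} {T : measurableType d} {R : realType} {P : probability T R}.
Implicit Types f g : T -> R.
Local Notation Ex := (Ex P).
Local Notation tame := (tame P).

Lemma tame_meas f : tame f -> measurable_fun setT f.
Proof. by case. Qed.

Lemma tame_le f g : tame f -> measurable_fun setT g -> (forall x, `|g x| <= `|f x|) -> tame g.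
Proof.
move=> [mf h] mg gf; split => // k.
apply: (le_integrable measurableT _ _ (h k)).
  apply/measurable_EFinP; apply: measurable_funX; exact: measurableT_comp.
move=> x _ /=; rewrite lee_fin !normrX !normr_id.
by rewrite lerXn2r// nnegrE.
Qed.

Lemma tame_int f : tame f -> P.-integrable setT (EFin \o f).
Proof.
move=> [mf h]; apply: (le_integrable measurableT _ _ (h 1%N)).
  exact/measurable_EFinP.
by move=> x _ /=; rewrite lee_fin expr1 normr_id.
Qed.

Lemma tame_cst (c : R) : tame (fun=> c).
Proof.
split; first exact: measurable_cst.
move=> k; exact: finite_measure_integrable_cst.
Qed.

Lemma tame_bounded f (c : R) : measurable_fun setT f -> (forall x, `|f x| <= c) -> tame f.
Proof.
move=> mf fc; apply: (tame_le (fun=> c)) => //; first exact: tame_cst.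
by move=> x; rewrite (le_trans (fc x))// ler_norm.
Qed.

Lemma tame_dom f (F : nat -> T -> R) : measurable_fun setT f ->
  (forall k, P.-integrable setT (EFin \o F k)) ->
  (forall k x, `|f x| ^+ k <= F k x) -> tame f.
Proof.
move=> mf iF fF; split => // k; apply: (le_integrable measurableT _ _ (iF k)).
  apply/measurable_EFinP; apply: measurable_funX; exact: measurableT_comp.
move=> x _ /=; rewrite lee_fin normrX normr_id.
by apply: (le_trans (fF k x)); rewrite ler_norm.
Qed.

Lemma tameD f g : tame f -> tame g -> tame (fun x => f x + g x).
Proof.
move=> [mf hf] [mg hg].
apply: (tame_dom _ (fun k x => 2 ^+ k * (`|f x| ^+ k + `|g x| ^+ k))).
- exact: measurable_funD.
- move=> k.
  have := integrableZl measurableT (2 ^+ k) (integrableD measurableT (hf k) (hg k)).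
  by apply: eq_integrable.
- move=> k x; have n1 := normr_ge0 (f x); have n2 := normr_ge0 (g x).
  have n3 := ler_normD (f x) (g x).
  have [fg|/ltW gf] := leP `|f x| `|g x|.
    apply: (@le_trans _ _ ((2 * `|g x|) ^+ k)).
      by rewrite lerXn2r ?nnegrE ?mulr_ge0// (le_trans n3)// mulr_natl mulr2n lerD2r.
    by rewrite exprMn ler_wpM2l ?exprn_ge0// lerDr exprn_ge0.
  apply: (@le_trans _ _ ((2 * `|f x|) ^+ k)).
    by rewrite lerXn2r ?nnegrE ?mulr_ge0// (le_trans n3)// mulr_natl mulr2n lerD2l.
  by rewrite exprMn ler_wpM2l ?exprn_ge0// lerDl exprn_ge0.
Qed.

Lemma tameM f g : tame f -> tame g -> tame (fun x => f x * g x).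
Proof.
move=> [mf hf] [mg hg].
apply: (tame_dom _ (fun k x => `|f x| ^+ (k * 2) + `|g x| ^+ (k * 2))).
- exact: measurable_funM.
- move=> k; have := integrableD measurableT (hf (k * 2)%N) (hg (k * 2)%N).
  by apply: eq_integrable.
- move=> k x; rewrite normrM exprMn !exprM.
  have u0 : 0 <= `|f x| ^+ k by rewrite exprn_ge0.
  have v0 : 0 <= `|g x| ^+ k by rewrite exprn_ge0.
  by move: (_ ^+ k) (_ ^+ k) u0 v0 => u v u0 v0; nra.
Qed.

Lemma tameN f : tame f -> tame (fun x => - f x).
Proof.
move=> tf; apply: (tame_le f) => //; last by move=> x; rewrite normrN.
exact: measurableT_comp (tame_meas _ tf).
Qed.

Lemma tameB f g : tame f -> tame g -> tame (fun x => f x - g x).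
Proof. by move=> tf tg; apply: tameD => //; exact: tameN. Qed.

Lemma tame_norm f : tame f -> tame (fun x => `|f x|).
Proof.
move=> tf; apply: (tame_le f) => //; last by move=> x; rewrite normr_id.
exact: measurableT_comp (tame_meas _ tf).
Qed.

Lemma tameX f k : tame f -> tame (fun x => f x ^+ k).
Proof.
move=> tf; elim: k => [|k ih].
  by have -> : (fun x => f x ^+ 0) = (fun=> 1) by []; exact: tame_cst.
have -> : (fun x => f x ^+ k.+1) = (fun x => f x * f x ^+ k).
  by apply/funext => x; rewrite exprS.
exact: tameM.
Qed.

Lemma tame_sum (I : Type) (s : seq I) (p : pred I) (F : I -> T -> R) :
  (forall i, p i -> tame (F i)) -> tame (fun x => \sum_(i <- s | p i) F i x).
Proof.
move=> h; elim: s => [|i s ih].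
  by under eq_fun do rewrite big_nil; exact: tame_cst.
have [pi|npi] := boolP (p i).
  have -> : (fun x => \sum_(j <- i :: s | p j) F j x) =
            (fun x => F i x + \sum_(j <- s | p j) F j x).
    by apply/funext => x; rewrite big_cons pi.
  by apply: tameD => //; exact: h.
have -> // : (fun x => \sum_(j <- i :: s | p j) F j x) =
             (fun x => \sum_(j <- s | p j) F j x).
by apply/funext => x; rewrite big_cons (negbTE npi).
Qed.

Lemma eq_Ex f g : f =1 g -> Ex f = Ex g.
Proof. by move=> fg; congr Rintegral; apply/funext. Qed.

Lemma Ex_cst c : Ex (fun=> c) = c.
Proof.
rewrite /Ex /Rintegral integral_cst// (_ : (_ [set: T] = 1)%E) ?mule1//.
exact: probability_setT.
Qed.

Lemma ExD f g : tame f -> tame g -> Ex (fun x => f x + g x) = Ex f + Ex g.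
Proof. by move=> tf tg; rewrite /Ex RintegralD//; exact: tame_int. Qed.

Lemma ExB f g : tame f -> tame g -> Ex (fun x => f x - g x) = Ex f - Ex g.
Proof. by move=> tf tg; rewrite /Ex RintegralB//; exact: tame_int. Qed.

Lemma ExZl f c : tame f -> Ex (fun x => c * f x) = c * Ex f.
Proof. by move=> tf; rewrite /Ex RintegralZl//; exact: tame_int. Qed.

Lemma ExZr f c : tame f -> Ex (fun x => f x * c) = Ex f * c.
Proof. by move=> tf; rewrite mulrC -ExZl//; apply: eq_Ex => x; rewrite mulrC. Qed.

Lemma ExN f : tame f -> Ex (fun x => - f x) = - Ex f.
Proof.
by move=> tf; rewrite -mulN1r -ExZl//; apply: eq_Ex => x; rewrite mulN1r.
Qed.

Lemma Ex_le f g : tame f -> tame g -> (forall x, f x <= g x) -> Ex f <= Ex g.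
Proof. by move=> tf tg fg; rewrite /Ex le_Rintegral//; exact: tame_int. Qed.

Lemma Ex_ge0 f : (forall x, 0 <= f x) -> 0 <= Ex f.
Proof. by move=> f0; apply: Rintegral_ge0. Qed.

Lemma Ex_sum (I : Type) (s : seq I) (p : pred I) (F : I -> T -> R) :
  (forall i, p i -> tame (F i)) ->
  Ex (fun x => \sum_(i <- s | p i) F i x) = \sum_(i <- s | p i) Ex (F i).
Proof.
move=> h; elim: s => [|i s ih].
  by rewrite big_nil -[RHS](Ex_cst 0); apply: eq_Ex => x; rewrite big_nil.
rewrite big_cons; case: ifPn => pi.
  rewrite -ih -ExD; [|exact: h|exact: tame_sum].
  by apply: eq_Ex => x; rewrite big_cons pi.
by rewrite -ih; apply: eq_Ex => x; rewrite big_cons (negbTE pi).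
Qed.

End Tame.

(** * Independence of two variables and Fubini's theorem *)

Section Indep.
Context {d} {T : measurableType d} {R : realType} (P : probability T R).
Implicit Types U V : T -> R.

Definition mkRV {d'} {T' : measurableType d'} (f : T -> T')
  (mf : measurable_fun setT f) : {mfun T >-> T'} :=
  HB.pack f (isMeasurableFun.Build _ _ _ _ f mf).

Definition indep U V := forall A B : set R, measurable A -> measurable B ->
  P (U @^-1` A `&` V @^-1` B) = (P (U @^-1` A) * P (V @^-1` B))%E.

Section pair.
Context {U V : T -> R} (mU : measurable_fun setT U) (mV : measurable_fun setT V).

Let W := mkRV (fun x => (U x, V x)) (measurable_fun_pair mU mV).
Let LU := distribution P (mkRV U mU).
Let LV := distribution P (mkRV V mV).

Lemma measurable_preimageT {d'} {T' : measurableType d'} (f : T -> T') (A : set T') :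
  measurable_fun setT f -> measurable A -> measurable (f @^-1` A).
Proof. by move=> mf mA; rewrite -[X in measurable X]setTI; exact: mf. Qed.

(** The measure sending D to P((U, V) in D, C) agrees on rectangles with P(C) times the product law,
    and product measures are determined by rectangles. The additional event [C] carries the other
    variables through the induction of [bigX_merge]. *)
Lemma pair_law_restr (C : set T) : measurable C ->
  (forall A B, measurable A -> measurable B ->
     P (U @^-1` A `&` V @^-1` B `&` C) = (P (U @^-1` A) * P (V @^-1` B) * P C)%E) ->
  forall D : set (R * R), measurable D ->
  P ((fun x => (U x, V x)) @^-1` D `&` C) = ((LU \x LV)%E D * P C)%E.
Proof.
move=> mC h D mD.
have k0 : 0 <= fine (P C) by rewrite fine_ge0.
have PC : P C = (fine (P C))%:E by rewrite fineK// fin_num_measure.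
pose k : {nonneg R} := NngNum k0.
pose m' := pushforward (mrestr P mC) W.
have mE A B : measurable A -> measurable B -> m' (A `*` B) = (mscale k LU A * LV B)%E.
  move=> mA mB; rewrite /m' /pushforward /mrestr /mscale/=.
  transitivity (P (U @^-1` A `&` V @^-1` B `&` C)).
    by congr (P _).
  by rewrite h// PC/= muleC muleA.
transitivity ((mscale k LU \x LV)%E D).
  exact: (esym (@product_measure_unique _ _ _ _ R (mscale k LU) LV m' mE D mD)).
rewrite /product_measure1 ge0_integral_mscale//.
  by rewrite PC muleC.
exact: measurable_fun_xsection.
Qed.

Hypothesis iUV : indep U V.

Lemma indep_joint (D : set (R * R)) : measurable D ->
  P ((fun x => (U x, V x)) @^-1` D) = (LU \x LV)%E D.
Proof.
move=> mD; have := pair_law_restr setT measurableT _ D mD.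
rewrite setIT probability_setT mule1; apply => A B mA mB.
by rewrite setIT mule1; exact: iUV.
Qed.

Let joint_eq (g : R * R -> \bar R) :
  (\int[distribution P W]_z g z = \int[LU \x LV]_z g z)%E.
Proof.
by apply: eq_measure_integral => A mA _; first [exact: indep_joint|exact: esym (indep_joint _ mA)].
Qed.

Lemma indep_tonelli (g : R * R -> \bar R) : measurable_fun setT g ->
  (forall z, 0 <= g z)%E ->
  (\int[P]_x g (U x, V x) = \int[P]_x \int[P]_y g (U x, V y))%E.
Proof.
move=> mg g0.
transitivity (\int[distribution P W]_z g z)%E.
  by rewrite ge0_integral_distribution.
rewrite joint_eq fubini_tonelli1// ge0_integral_distribution//; last 2 first.
- exact: measurable_fun_fubini_tonelli_F.
- by move=> u; apply: integral_ge0.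
apply: eq_integral => x _ /=; rewrite /fubini_F ge0_integral_distribution//.
exact: measurableT_comp mg (measurable_pair1 _).
Qed.

Lemma indep_integrableM (f g : R -> R) : measurable_fun setT f -> measurable_fun setT g ->
  P.-integrable setT (EFin \o (f \o U)) -> P.-integrable setT (EFin \o (g \o V)) ->
  P.-integrable setT (EFin \o (fun x => f (U x) * g (V x))).
Proof.
move=> mf mg /integrableP[_ fU] /integrableP[_ gV].
have mfg : measurable_fun setT (fun z : R * R => (f z.1 * g z.2)%:E).
  by apply/measurable_EFinP; apply: measurable_funM; exact: measurableT_comp.
apply/integrableP; split.
  exact: measurableT_comp mfg (measurable_fun_pair mU mV).
rewrite (indep_tonelli (fun z : R * R => `|(f z.1 * g z.2)%:E|%E))//; last first.
  exact: measurableT_comp mfg.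
rewrite /=.
have gV0 : (0 <= \int[P]_y `|(g (V y))%:E|)%E by exact: integral_ge0.
have gVE : (\int[P]_y `|(g (V y))%:E|)%E = (fine (\int[P]_y `|(g (V y))%:E|)%E)%:E.
  by apply/esym/fineK; rewrite ge0_fin_numE.
under eq_integral => x _.
  under eq_integral => y _ do rewrite normrM EFinM.
  rewrite ge0_integralZl//; last by apply/measurable_EFinP; do 2 apply: measurableT_comp => //.
  over.
rewrite /= gVE ge0_integralZr//.
- have f0 : (0 <= \int[P]_x `|(f (U x))%:E|)%E by exact: integral_ge0.
  rewrite -gVE; apply: lte_mul_pinfty => //.
  by rewrite ge0_fin_numE.
- by apply/measurable_EFinP; do 2 apply: measurableT_comp => //.
- by rewrite -gVE.
Qed.

Variables (F : R -> R -> R).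
Hypothesis mF : measurable_fun setT (fun z : R * R => F z.1 z.2).
Hypothesis tF : P.-integrable setT (EFin \o (fun x => F (U x) (V x))).

Hypothesis tFu : forall u, P.-integrable setT (EFin \o (fun x => F u (V x))).

Let f (z : R * R) : \bar R := (F z.1 z.2)%:E.

Let mf : measurable_fun setT f.
Proof. exact/measurable_EFinP. Qed.

Let if_ : (LU \x LV)%E.-integrable setT f.
Proof.
apply/integrableP; split; first exact: mf.
rewrite -(joint_eq (fun z => `|f z|%E)) ge0_integral_distribution//; last first.
  exact: measurableT_comp mf.
by move/integrableP : tF => [].
Qed.

Let secE : (fun u => Ex P (fun x => F u (V x))) = fine \o (fubini_F LV f).
Proof.
apply/funext => u; rewrite /Ex /Rintegral /fubini_F/=; congr fine.
rewrite integral_distribution//; last exact: tFu.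
by apply/measurable_EFinP; exact: measurableT_comp mF (measurable_pair1 u).
Qed.

Let fub_int : LU.-integrable setT (EFin \o (fine \o fubini_F LV f)).
Proof.
have h := integrable_fubini_F if_.
apply: eq_integrable h => // u _ /=; rewrite fineK//.
rewrite /fubini_F/= integral_distribution//; last 2 first.
- by apply/measurable_EFinP; exact: measurableT_comp mF (measurable_pair1 u).
- exact: tFu.
exact: integrable_fin_num (tFu u).
Qed.

(** Both integrals run over [P] itself, so an independent copy of a variable can be used without
    enlarging the probability space. *)
Lemma indep_Ex : P.-integrable setT (EFin \o (fun x => Ex P (fun y => F (U x) (V y)))) /\
  Ex P (fun x => F (U x) (V x)) = Ex P (fun x => Ex P (fun y => F (U x) (V y))).
Proof.
have e1 : (fun x => Ex P (fun y => F (U x) (V y))) = (fine \o fubini_F LV f) \o U.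
  by rewrite -secE.
have mG : measurable_fun setT (EFin \o (fine \o fubini_F LV f)) by exact: measurable_int fub_int.
have iG : P.-integrable setT (EFin \o (fine \o fubini_F LV f) \o U).
  apply/integrableP; split; first exact: measurableT_comp mG mU.
  have /integrableP[_] := fub_int.
  rewrite ge0_integral_distribution//; exact: measurableT_comp mG.
split; first by rewrite e1.
rewrite e1 /Ex /Rintegral; congr fine.
transitivity (\int[LU]_u (EFin \o (fine \o fubini_F LV f)) u)%E; last first.
  by rewrite integral_distribution.
transitivity (\int[LU]_u fubini_F LV f u)%E; last first.
  apply: eq_integral => u _ /=; rewrite fineK//.
  rewrite /fubini_F/= integral_distribution//; last 2 first.
  - by apply/measurable_EFinP; exact: measurableT_comp mF (measurable_pair1 u).
  - exact: tFu.
  exact: integrable_fin_num (tFu u).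
rewrite integral12_prod_meas1// -joint_eq integral_distribution//.
Qed.

End pair.
End Indep.

(** * Merging mutually independent variables *)

Section Mutual.
Context {d} {T : measurableType d} {R : realType} {P : probability T R}.
Context {n : nat} (X : 'I_n -> T -> R) {idx : R} (op : Monoid.com_law idx).
Hypothesis mX : forall i, measurable_fun setT (X i).
Hypothesis mop : measurable_fun setT (fun z : R * R => op z.1 z.2).
Hypothesis iX : mutually_independent P X.

(** The operation is addition for the partial sums of the summands and multiplication for the
    density of the tilted law. *)
Definition bigX (A : {set 'I_n}) (x : T) : R := \big[op/idx]_(k in A) X k x.

Lemma bigX_rem (A : {set 'I_n}) j : j \in A ->
  bigX A = fun x => op (bigX (A :\ j) x) (X j x).
Proof.
by move=> jA; apply/funext => x; rewrite /bigX (big_setD1 j)//= Monoid.mulmC.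
Qed.

Lemma measurable_bigX (A : {set 'I_n}) : measurable_fun setT (bigX A).
Proof.
elim: {A}_.+1 {-2}A (ltnSn #|A|) => // m ih A Am.
have [->|[j jA]] := set_0Vmem A.
  rewrite (_ : bigX _ = fun=> idx); first exact: measurable_cst.
  by apply/funext => x; rewrite /bigX big_set0.
rewrite (bigX_rem _ _ jA).
have mZ : measurable_fun setT (bigX (A :\ j)).
  by apply: ih; rewrite (cardsD1 j) jA in Am.
exact: (measurableT_comp mop (measurable_fun_pair mZ (mX j))).
Qed.

(** Replacing the variables in [A] by their combination preserves independence. The sets [B k] are
    trivial on [A] but otherwise arbitrary: this lets the induction on the size of [A] move one
    variable from the combination into the rectangle. *)
Lemma bigX_merge (A : {set 'I_n}) (B : 'I_n -> set R) (D : set R) :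
  (forall k, measurable (B k)) -> (forall k, k \in A -> B k = setT) -> measurable D ->
  P (bigX A @^-1` D `&` \bigcap_(k in [set: 'I_n]) (X k @^-1` B k)) =
  (P (bigX A @^-1` D) * \prod_(k < n) P (X k @^-1` B k))%E.
Proof.
move=> mB BT mD.
elim: {A}_.+1 {-2}A (ltnSn #|A|) B D mB BT mD => // m ih A Am B D mB BT mD.
have [A0|[j jA]] := set_0Vmem A.
  have -> : bigX A = cst idx by apply/funext => x; rewrite /bigX A0 big_set0.
  rewrite -iX// preimage_cst; case: ifPn => _.
    by rewrite setTI probability_setT mul1e.
  by rewrite set0I measure0 mul0e.
have mZ := measurable_bigX (A :\ j).
have cA : (#|A :\ j| < m)%N by rewrite (cardsD1 j) jA in Am.
pose C := \bigcap_(k in [set: 'I_n]) (X k @^-1` B k).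
have mC : measurable C.
  apply: fin_bigcap_measurable => // k _; exact: measurable_preimageT.
(* The induction hypothesis for [A :\ j], with [E2] put into the slot [j] that [B'] leaves free. *)
have rect B' : (forall k, measurable (B' k)) -> (forall k, k \in A -> B' k = setT) ->
  forall E1 E2, measurable E1 -> measurable E2 ->
  P (bigX (A :\ j) @^-1` E1 `&` X j @^-1` E2 `&` \bigcap_(k in [set: 'I_n]) (X k @^-1` B' k)) =
  (P (bigX (A :\ j) @^-1` E1) * P (X j @^-1` E2) *
   P (\bigcap_(k in [set: 'I_n]) (X k @^-1` B' k)))%E.
  move=> mB' BT' E1 E2 mE1 mE2.
  pose B2 k := if k == j then E2 else B' k.
  have -> : bigX (A :\ j) @^-1` E1 `&` X j @^-1` E2 `&` \bigcap_(k in [set: 'I_n]) (X k @^-1` B' k) =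
     bigX (A :\ j) @^-1` E1 `&` \bigcap_(k in [set: 'I_n]) (X k @^-1` B2 k).
    apply/seteqP; split => x /=.
      move=> [[h1 h2] h3]; split => // k _ /=; rewrite /B2; case: eqP => [->//|_]; exact: h3.
    move=> [h1 h2]; split; first split => //.
      by have := h2 j I; rewrite /B2 /= eqxx.
    move=> k _ /=; have := h2 k I; rewrite /B2/=; case: eqP => // ->.
    by rewrite BT'.
  rewrite (ih (A :\ j) cA B2 E1)//; last 2 first.
  - by move=> k; rewrite /B2; case: ifP.
  - move=> k; rewrite in_setD1 /B2 => /andP[/negbTE -> kA]; exact: BT'.
  rewrite iX// (bigD1 j)//= [in RHS](bigD1 j)//= {1}/B2 eqxx BT'//.
  rewrite preimage_setT probability_setT mul1e muleA; congr (_ * _)%E.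
  by apply: eq_bigr => k /negbTE kj; rewrite /B2 kj.
have mD' : measurable ((fun z : R * R => op z.1 z.2) @^-1` D).
  exact: (measurable_preimageT _ _ mop mD).
(* From rectangles to the preimage of [D] under [op], once in presence of [C] and once without it;
   comparing the two gives the factorisation. *)
have h1 := pair_law_restr P mZ (mX j) C mC (rect B mB BT) _ mD'.
have h2 := pair_law_restr P mZ (mX j) setT measurableT _ _ mD'.
have {}h2 : P (bigX A @^-1` D) = (distribution P (mkRV _ mZ) \x distribution P (mkRV _ (mX j)))%E ((fun z : R * R => op z.1 z.2) @^-1` D).
  rewrite probability_setT mule1 setIT in h2.
  rewrite (bigX_rem _ _ jA) -h2// => E1 E2 mE1 mE2.
  have := rect (fun=> setT) (fun=> measurableT) (fun _ _ => erefl) E1 E2 mE1 mE2.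
  have -> : \bigcap_(k in [set: 'I_n]) (X k @^-1` [set: R]) = setT; last by rewrite probability_setT.
  by apply/seteqP; split.
rewrite [P (bigX A @^-1` D)]h2 -iX// -h1.
by congr (P (_ `&` _)); rewrite (bigX_rem _ _ jA).
Qed.

Lemma indep_bigX j (A : {set 'I_n}) : j \notin A -> indep P (X j) (bigX A).
Proof.
move=> jA E D mE mD.
pose B k := if k == j then E else setT.
have mB k : measurable (B k) by rewrite /B; case: ifP.
have e : \bigcap_(k in [set: 'I_n]) (X k @^-1` B k) = X j @^-1` E.
  apply/seteqP; split => x /=.
    by move=> /(_ j I); rewrite /B/= eqxx.
  by move=> Ex k _; rewrite /B/=; case: eqP => // ->.
rewrite setIC -{1}e bigX_merge//.
  rewrite muleC; congr (_ * _)%E.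
  by rewrite -iX// e.
by move=> k kA; rewrite /B; case: eqP => // kj; rewrite -kj kA in jA.
Qed.

End Mutual.

Lemma mutually_independent_comp {d} {T : measurableType d} {R : realType} {P : probability T R}
  {n : nat} (X : 'I_n -> T -> R) (g : 'I_n -> R -> R) :
  (forall i, measurable_fun setT (g i)) -> mutually_independent P X ->
  mutually_independent P (fun i x => g i (X i x)).
Proof.
move=> mg iX B mB; apply: (iX (fun i => g i @^-1` B i)) => j.
exact: measurable_preimageT.
Qed.

Section IndepEx.
Context {d} {T : measurableType d} {R : realType} {P : probability T R}.

Lemma indep_ExM (U V : T -> R) (f g : R -> R) :
  measurable_fun setT U -> measurable_fun setT V -> indep P U V ->
  measurable_fun setT f -> measurable_fun setT g ->
  P.-integrable setT (EFin \o (f \o U)) -> P.-integrable setT (EFin \o (g \o V)) ->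
  Ex P (fun x => f (U x) * g (V x)) = Ex P (f \o U) * Ex P (g \o V).
Proof.
move=> mU mV iUV mf mg fU gV.
have mF : measurable_fun setT (fun z : R * R => f z.1 * g z.2).
  by apply: measurable_funM; exact: measurableT_comp.
have tF := indep_integrableM P mU mV iUV f g mf mg fU gV.
have tFu u : P.-integrable setT (EFin \o (fun x => f u * g (V x))).
  by have := integrableZl measurableT (f u) gV; apply: eq_integrable.
have [_ ->] := indep_Ex P mU mV iUV (fun u v => f u * g v) mF tF tFu.
transitivity (Ex P (fun x => f (U x) * Ex P (g \o V))).
  by apply: eq_Ex => x; rewrite /Ex RintegralZl.
by rewrite /Ex RintegralZr.
Qed.

Context {n : nat} (X : 'I_n -> T -> R).
Hypothesis mX : forall i, measurable_fun setT (X i).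
Hypothesis iX : mutually_independent P X.
Variable g : 'I_n -> R -> R.
Hypothesis mg : forall i, measurable_fun setT (g i).
Hypothesis ig : forall i, P.-integrable setT (EFin \o (g i \o X i)).

Lemma Ex_prod (A : {set 'I_n}) :
  P.-integrable setT (EFin \o (fun x => \prod_(k in A) g k (X k x))) /\
  Ex P (fun x => \prod_(k in A) g k (X k x)) = \prod_(k in A) Ex P (g k \o X k).
Proof.
elim: {A}_.+1 {-2}A (ltnSn #|A|) => // m ih A Am.
have [->|[j jA]] := set_0Vmem A.
  have E0 : (fun x => \prod_(k in finset.set0) g k (X k x)) = fun=> 1.
    by apply/funext => x; rewrite big_set0.
  rewrite E0 big_set0; split; last exact: Ex_cst.
  exact: finite_measure_integrable_cst.
have {}Am : (#|A :\ j| < m)%N by rewrite (cardsD1 j) jA in Am.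
have [i1 e1] := ih _ Am.
have E : (fun x => \prod_(k in A) g k (X k x)) =
         fun x => g j (X j x) * idfun (\prod_(k in A :\ j) g k (X k x)).
  by apply/funext => x; rewrite (big_setD1 j)//=.
have mgX i : measurable_fun setT (fun x => g i (X i x)) by exact: measurableT_comp.
have iG := mutually_independent_comp X g mg iX.
have jA' : j \notin A :\ j by rewrite in_setD1 eqxx.
have mop : measurable_fun setT (fun z : R * R => z.1 * z.2).
  by apply: measurable_funM; [exact: measurable_fst|exact: measurable_snd].
have iP := indep_bigX _ ( *%R : Monoid.com_law 1) mgX mop iG j _ jA'.
have mZ := measurable_bigX (fun i x => g i (X i x)) ( *%R : Monoid.com_law 1) mgX mop (A :\ j).
have mid : measurable_fun setT (idfun : R -> R) by exact: measurable_id.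
rewrite E; split.
  exact: (indep_integrableM P (mgX j) mZ iP idfun idfun mid mid (ig j) i1).
rewrite (big_setD1 j)//= -e1.
exact: (indep_ExM _ _ idfun idfun (mgX j) mZ iP mid mid (ig j) i1).
Qed.

End IndepEx.

(** * Change of measure by a density *)

Section Tilt.
Context {d} {T : measurableType d} {R : realType} (P : probability T R).
Variable w : T -> R.
Hypothesis w0 : forall x, 0 <= w x.
Hypothesis mw : measurable_fun setT w.
Hypothesis w1 : (\int[P]_x (w x)%:E = 1)%E.

Definition tilt (A : set T) : \bar R := (\int[P]_(x in A) (w x)%:E)%E.

Let tilt0 : tilt set0 = 0%E.
Proof. exact: integral_set0. Qed.

Let tilt_ge0 A : (0 <= tilt A)%E.
Proof. by apply: integral_ge0 => x _; rewrite lee_fin. Qed.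

Let tilt_sigma_additive : semi_sigma_additive tilt.
Proof.
move=> /= F mF tF mUF; rewrite /tilt ge0_integral_bigcup//.
- by apply: is_cvg_ereal_nneg_natsum_cond => k _ _; exact: tilt_ge0.
- exact/measurable_EFinP/measurable_funTS.
- by move=> x _; rewrite lee_fin.
Qed.

HB.instance Definition _ := isMeasure.Build _ _ _ tilt
  tilt0 tilt_ge0 tilt_sigma_additive.

Let tilt_setT : tilt setT = 1%E.
Proof. exact: w1. Qed.

HB.instance Definition _ := Measure_isProbability.Build _ _ _ tilt tilt_setT.

Import HBNNSimple.

(** For simple functions this is the definition of [tilt]; monotone convergence on both sides does
    the rest. *)
Lemma ge0_integral_tilt (f : T -> \bar R) : measurable_fun setT f ->
  (forall x, 0 <= f x)%E ->
  (\int[tilt]_x f x = \int[P]_x (f x * (w x)%:E))%E.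
Proof.
move=> mf f0.
pose f_ := nnsfun_approx measurableT mf.
transitivity (limn (fun n => \int[tilt]_x (f_ n x)%:E))%E.
  rewrite -monotone_convergence//.
  - by apply: eq_integral => y _; apply/esym/cvg_lim => //; exact: cvg_nnsfun_approx.
  - by move=> n; exact/measurable_EFinP/measurable_funP.
  - by move=> n y _; rewrite lee_fin.
  - by move=> y _ m n mn; rewrite lee_fin; exact/lefP/nd_nnsfun_approx.
rewrite [X in limn X](_ : _ = (fun n => \int[P]_x ((f_ n x)%:E * (w x)%:E))%E); last first.
  apply/funext => n.
  under [LHS]eq_integral do rewrite fimfunE -fsumEFin//.
  rewrite [LHS]ge0_integral_fsum//; last 2 first.
    - by move=> r; exact/measurable_EFinP/measurableT_comp.
    - by move=> k x _; rewrite EFinM nnfun_muleindic_ge0.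
  under [RHS]eq_integral.
    move=> x xD; rewrite muleC fimfunE -fsumEFin// ge0_mule_fsumr; last first.
      by move=> r; rewrite EFinM nnfun_muleindic_ge0.
    over.
  rewrite [RHS]ge0_integral_fsum//; last 2 first.
    - move=> r; apply: emeasurable_funM; first exact/measurable_EFinP.
      by apply/measurable_EFinP/measurableT_comp.
    - move=> k x _; apply: mule_ge0; first by rewrite lee_fin.
      by rewrite EFinM nnfun_muleindic_ge0.
  apply: eq_fsbigr => r rf; rewrite integralZl_indic_nnsfun//= integral_indic// setIT.
  have r0 : 0 <= r by move: rf; rewrite inE => -[x _ <-].
  rewrite /tilt -ge0_integralZl//; last 2 first.
  - exact/measurable_EFinP/measurable_funTS.
  - by move=> x _; rewrite lee_fin.
  rewrite [LHS]integral_mkcond; apply: eq_integral => x _.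
  rewrite patchE EFinM muleCA indicE; case: ifP => _; first by rewrite mule1 muleC.
  by rewrite !mule0.
rewrite -monotone_convergence//.
- apply: eq_integral => x _; apply/cvg_lim => //.
  apply: cvgeZr => //; exact: cvg_nnsfun_approx.
- by move=> n; apply: emeasurable_funM; exact/measurable_EFinP.
- by move=> n x _; rewrite mule_ge0// lee_fin.
- by move=> x _ m n mn; rewrite lee_wpmul2r ?lee_fin//; exact/lefP/nd_nnsfun_approx.
Qed.

Lemma integrable_tilt (f : T -> R) : measurable_fun setT f ->
  P.-integrable setT (EFin \o (fun x => f x * w x)) -> tilt.-integrable setT (EFin \o f).
Proof.
move=> mf /integrableP[_ h]; apply/integrableP; split; first exact/measurable_EFinP.
rewrite ge0_integral_tilt//; last by apply: measurableT_comp => //; exact/measurable_EFinP.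
move: h; apply: le_lt_trans.
under [leRHS]eq_integral do rewrite /= normrM (ger0_norm (w0 _)) EFinM.
exact: lexx.
Qed.

Lemma integral_tilt (f : T -> R) : measurable_fun setT f ->
  P.-integrable setT (EFin \o (fun x => f x * w x)) ->
  (\int[tilt]_x (f x)%:E = \int[P]_x (f x * w x)%:E)%E.
Proof.
move=> mf h; rewrite integralE [RHS]integralE.
rewrite !ge0_integral_tilt//; last 2 first.
- by apply: measurable_funeneg; exact/measurable_EFinP.
- by apply: measurable_funepos; exact/measurable_EFinP.
congr (_ - _)%E; apply: eq_integral => x _.
  by rewrite !funeposE/= -!EFin_max -EFinM maxr_pMl ?mul0r.
by rewrite !funenegE/= -!EFin_max -EFinM maxr_pMl ?mul0r ?mulNr.
Qed.

Lemma tilt_exists_aux : exists Q : probability T R,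
    (forall A, Q A = (\int[P]_(x in A) (w x)%:E)%E) /\
    (forall f : T -> R, measurable_fun setT f ->
      P.-integrable setT (EFin \o (fun x => f x * w x)) ->
      Q.-integrable setT (EFin \o f) /\ Ex Q f = Ex P (fun x => f x * w x)).
Proof.
exists (tilt : probability T R); split => // f mf ifw; split.
  exact: integrable_tilt.
by rewrite /Ex /Rintegral; congr fine; exact: integral_tilt.
Qed.

End Tilt.

Lemma tilt_exists {d} {T : measurableType d} {R : realType} (P : probability T R) (w : T -> R) :
  (forall x, 0 <= w x) -> P.-integrable setT (EFin \o w) -> Ex P w = 1 ->
  exists Q : probability T R,
    (forall A, Q A = (\int[P]_(x in A) (w x)%:E)%E) /\
    (forall f : T -> R, measurable_fun setT f ->
      P.-integrable setT (EFin \o (fun x => f x * w x)) ->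
      Q.-integrable setT (EFin \o f) /\ Ex Q f = Ex P (fun x => f x * w x)).
Proof.
move=> w0 iw e1; have mw : measurable_fun setT w by apply/measurable_EFinP; exact: measurable_int iw.
apply: tilt_exists_aux => //.
rewrite -[LHS]fineK; last exact: integrable_fin_num iw.
by congr EFin; exact: e1.
Qed.

Section measurability.
Context {R : realType}.
Implicit Types c l r : R.

Lemma measurable_homo (f : R -> R) : {homo f : x y / x <= y} -> measurable_fun setT f.
Proof. by move=> hf; apply: nondecreasing_measurable => // x y; exact: hf. Qed.

Lemma measurable_gt_ind c : measurable_fun setT (fun w : R => (c < w)%R%:R : R).
Proof.
apply: measurable_homo => x y xy; rewrite ler_nat.
have [cx|//] := ltP c x; by rewrite (lt_le_trans cx xy).
Qed.

Lemma measurable_itv_ind l r : measurable_fun setT (fun w : R => (l < w <= r)%R%:R : R).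
Proof.
have -> : (fun w : R => (l < w <= r)%R%:R : R) =
          (fun w => (l < w)%R%:R * (1 - (r < w)%R%:R)).
  apply/funext => w; rewrite ltNge; case: (w <= l); rewrite /= ?mul0r// mul1r.
  by rewrite ltNge; case: (w <= r); rewrite /= ?subr0// subrr.
apply: measurable_funM; first exact: measurable_gt_ind.
apply: measurable_funB; [exact: measurable_cst|exact: measurable_gt_ind].
Qed.

Lemma measurable_exp_tail a c : measurable_fun setT (@exp_tail R a c).
Proof.
have -> : @exp_tail R a c = (fun w => (c < w)%R%:R * expR (- a * (w - c))).
  by apply/funext => w; rewrite /exp_tail ltNge; case: (w <= c); rewrite /= ?mul0r// mul1r.
apply: measurable_funM; first exact: measurable_gt_ind.
apply: measurableT_comp; first exact: measurable_expR.
apply: measurable_funM; first exact: measurable_cst.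
by apply: measurable_funB; [exact: measurable_id|exact: measurable_cst].
Qed.

Lemma measurable_lip (f : R -> R) : (forall u v, `|f u - f v| <= `|u - v|) ->
  measurable_fun setT f.
Proof.
move=> fl; apply: continuous_measurable_fun => x; apply/cvgrPdist_lt => e e0.
near=> y; apply: (le_lt_trans (fl _ _)); near: y.
by apply: cvgr_dist_lt.
Unshelve. all: by end_near. Qed.

End measurability.

(** * A one-sided Berry-Esseen bound *)

Section Variance.
Context {d} {T : measurableType d} {R : realType} {P : probability T R}.
Context {n : nat} (Y : 'I_n -> T -> R).
Hypothesis tY : forall i, tame P (Y i).
Hypothesis iY : mutually_independent P Y.
Local Notation E := (Ex P).

Definition psum (A : {set 'I_n}) (x : T) : R := \sum_(k in A) Y k x.
Local Notation S := psum.

Lemma tame_psum A : tame P (S A).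
Proof. by apply: tame_sum => i _; exact: tY. Qed.

Lemma psum_rem (A : {set 'I_n}) j x : j \in A -> S A x = S (A :\ j) x + Y j x.
Proof. by move=> jA; rewrite /psum (big_setD1 j)//= addrC. Qed.

Lemma indep_psum j (A : {set 'I_n}) : j \notin A -> indep P (Y j) (S A).
Proof.
have mop : measurable_fun setT (fun z : R * R => z.1 + z.2).
  by apply: measurable_funD; [exact: measurable_fst|exact: measurable_snd].
exact: (indep_bigX Y ( +%R : Monoid.com_law 0) (fun i => tame_meas _ (tY i)) mop iY).
Qed.

Lemma Ex_psumM j (A : {set 'I_n}) (f g : R -> R) : j \notin A ->
  measurable_fun setT f -> measurable_fun setT g ->
  tame P (fun x => f (Y j x)) -> tame P (fun x => g (S A x)) ->
  E (fun x => f (Y j x) * g (S A x)) = E (fun x => f (Y j x)) * E (fun x => g (S A x)).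
Proof.
move=> jA mf mg tf tg.
exact: (indep_ExM (Y j) (S A) f g (tame_meas _ (tY j)) (tame_meas _ (tame_psum A))
  (indep_psum _ _ jA) mf mg (tame_int _ tf) (tame_int _ tg)).
Qed.

Hypothesis EY : forall i, E (Y i) = 0.

Lemma Ex_psum_sqr (A : {set 'I_n}) :
  E (fun x => S A x ^+ 2) = \sum_(k in A) E (fun x => Y k x ^+ 2).
Proof.
elim: {A}_.+1 {-2}A (ltnSn #|A|) => // m ih A Am.
have [->|[j jA]] := set_0Vmem A.
  rewrite big_set0 -[RHS](Ex_cst (P := P) 0); apply: eq_Ex => x.
  by rewrite /psum big_set0 expr0n.
have {}Am : (#|A :\ j| < m)%N by rewrite (cardsD1 j) jA in Am.
rewrite (big_setD1 j)//= -ih//.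
have jA' : j \notin A :\ j by rewrite in_setD1 eqxx.
have tj := tY j; have tS := tame_psum (A :\ j).
have mid : measurable_fun setT (idfun : R -> R) by exact: measurable_id.
have e0 : E (fun x => Y j x * S (A :\ j) x) = 0.
  by rewrite (Ex_psumM j _ idfun idfun jA' mid mid tj tS) EY mul0r.
transitivity (E (fun x => Y j x ^+ 2 + (S (A :\ j) x ^+ 2 + 2 * (Y j x * S (A :\ j) x)))).
  by apply: eq_Ex => x; rewrite (psum_rem _ _ _ jA); ring.
rewrite ExD; [|exact: tameX|apply: tameD; [exact: tameX|apply: tameM; [exact: tame_cst|exact: tameM]]].
rewrite ExD; [|exact: tameX|apply: tameM; [exact: tame_cst|exact: tameM]].
by rewrite ExZl ?e0 ?mulr0 ?addr0//; exact: tameM.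
Qed.

End Variance.

(** * A concentration inequality for partial sums *)

Section Concentration.
Context {d} {T : measurableType d} {R : realType} {P : probability T R}.
Context {n : nat} (Y : 'I_n -> T -> R) (rho de : R).
Hypothesis tY : forall i, tame P (Y i).
Hypothesis iY : mutually_independent P Y.
Local Notation E := (Ex P).
Local Notation S := (psum Y).
Hypothesis EY : forall i, E (Y i) = 0.
Local Notation s i := (E (fun x => Y i x ^+ 2)).
Hypothesis s1 : \sum_i s i = 1.
Hypothesis Y4 : forall i, E (fun x => Y i x ^+ 4) <= rho ^+ 2 * s i.
Hypothesis rho0 : 0 < rho.
Hypothesis de0 : 0 < de.

Lemma s_ge0 i : 0 <= s i.
Proof. by apply: Ex_ge0 => x; rewrite sqr_ge0. Qed.

Lemma sum_s_le1 (A : {set 'I_n}) : \sum_(k in A) s k <= 1.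
Proof.
rewrite -s1 [leRHS](bigID (mem A))/= lerDl sumr_ge0// => k _; exact: s_ge0.
Qed.

Lemma Ex_abs_psum (A : {set 'I_n}) : E (fun x => `|S A x|) <= 1.
Proof.
have tS := tame_psum Y tY A.
apply: (@le_trans _ _ (E (fun x => 1 / 2 + S A x ^+ 2 / 2))).
  apply: Ex_le; first exact: tame_norm.
    by apply: tameD; [exact: tame_cst|apply: tameM; [exact: tameX|exact: tame_cst]].
  by move=> x; rewrite -[S A x ^+ 2]real_normK ?num_real//; have := sqr_ge0 (`|S A x| - 1); lra.
rewrite ExD; [|exact: tame_cst|apply: tameM; [exact: tameX|exact: tame_cst]].
rewrite Ex_cst ExZr; last exact: tameX.
by rewrite (Ex_psum_sqr Y tY iY EY); have := sum_s_le1 A; lra.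
Qed.

(** Jensen's inequality gives s^2 <= E Y^4 <= rho^2 s for the second moment s; the case s = 0 is
    treated apart before dividing. *)
Lemma s_le i : s i <= rho ^+ 2.
Proof.
have ty := tY i.
have : 0 <= E (fun x => (Y i x ^+ 2 - s i) ^+ 2) by apply: Ex_ge0 => x; rewrite sqr_ge0.
have -> : E (fun x => (Y i x ^+ 2 - s i) ^+ 2) = E (fun x => Y i x ^+ 4) - s i ^+ 2.
  transitivity (E (fun x => Y i x ^+ 4 - (2 * s i) * Y i x ^+ 2 + s i ^+ 2)).
    by apply: eq_Ex => x; ring.
  rewrite ExD; [|apply: tameB; [exact: tameX|apply: tameM; [exact: tame_cst|exact: tameX]]|exact: tame_cst].
  rewrite ExB; [|exact: tameX|apply: tameM; [exact: tame_cst|exact: tameX]].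
  by rewrite ExZl; [rewrite Ex_cst; ring|exact: tameX].
have := Y4 i; have := s_ge0 i.
set u := s i; set v := E (fun x => Y i x ^+ 4) => u0 v1 v2.
have [->|u1] := eqVneq u 0; first exact: sqr_ge0.
have {}u0 : 0 < u by rewrite lt_def u1.
by rewrite -(ler_pM2r u0) -expr2; lra.
Qed.

(** AM-GM with weight [rho]: |y| <= rho / 2 + y^2 / (2 rho). Multiplied by y^2, the same inequality
    gives [Ex_abs3]. *)
Lemma Ex_abs i : E (fun x => `|Y i x|) <= rho.
Proof.
have ty := tY i.
apply: (@le_trans _ _ (E (fun x => rho / 2 + Y i x ^+ 2 / (2 * rho)))).
  apply: Ex_le; first exact: tame_norm.
    by apply: tameD; [exact: tame_cst|apply: tameM; [exact: tameX|exact: tame_cst]].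
  move=> x; rewrite -[Y i x ^+ 2]real_normK ?num_real//.
  have -> : rho / 2 + `|Y i x| ^+ 2 / (2 * rho) = `|Y i x| + (`|Y i x| - rho) ^+ 2 / (2 * rho).
    by field; rewrite gt_eqF.
  by rewrite lerDl divr_ge0 ?sqr_ge0// mulr_ge0// ltW.
rewrite ExD; [|exact: tame_cst|apply: tameM; [exact: tameX|exact: tame_cst]].
rewrite Ex_cst ExZr; last exact: tameX.
apply: (@le_trans _ _ (rho / 2 + rho ^+ 2 / (2 * rho))).
  by rewrite lerD2l ler_wpM2r ?s_le// invr_ge0 mulr_ge0// ltW.
have -> // : rho / 2 + rho ^+ 2 / (2 * rho) = rho by field; rewrite gt_eqF.
Qed.

Lemma Ex_abs3 i : E (fun x => `|Y i x| ^+ 3) <= rho * s i.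
Proof.
have ty := tY i.
apply: (@le_trans _ _ (E (fun x => (rho / 2) * Y i x ^+ 2 + Y i x ^+ 4 / (2 * rho)))).
  apply: Ex_le; first by apply: tameX; exact: tame_norm.
    apply: tameD; apply: tameM; do ?[exact: tameX|exact: tame_cst].
  move=> x; rewrite -[Y i x ^+ 2]real_normK ?num_real// [Y i x ^+ 4](exprM _ 2 2) -[Y i x ^+ 2]real_normK ?num_real//.
  have -> : rho / 2 * `|Y i x| ^+ 2 + (`|Y i x| ^+ 2) ^+ 2 / (2 * rho) =
     `|Y i x| ^+ 3 + (`|Y i x| * (`|Y i x| - rho)) ^+ 2 / (2 * rho).
    by field; rewrite gt_eqF.
  by rewrite lerDl divr_ge0 ?sqr_ge0// mulr_ge0// ltW.
rewrite ExD; [|apply: tameM; [exact: tame_cst|exact: tameX]|apply: tameM; [exact: tameX|exact: tame_cst]].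
rewrite ExZl; last exact: tameX.
rewrite ExZr; last exact: tameX.
have -> : rho * s i = rho / 2 * s i + rho ^+ 2 * s i / (2 * rho) by field; rewrite gt_eqF.
by rewrite lerD2l ler_wpM2r ?Y4// invr_ge0 mulr_ge0// ltW.
Qed.

(* Truncation bounds the variance of the sum of trunc_sqr (Y k) by de^2, while the mean stays
   close to the sum of the second moments. *)
Definition trunc_sqr (y : R) : R := `|y| * Num.min `|y| de.

(** The constant 4/27 is the smallest possible: for |y| > de the difference of the two sides has a
    double zero at |y| = 3 de / 2, as the factorisation in the proof shows. *)
Lemma trunc_sqr_ge (y : R) : y ^+ 2 - (4 / 27 / de ^+ 2) * y ^+ 4 <= trunc_sqr y.
Proof.
rewrite /trunc_sqr -[y ^+ 2]real_normK ?num_real// [y ^+ 4](exprM _ 2 2) -[y ^+ 2]real_normK ?num_real//.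
have c0 : 0 <= 4 / 27 / de ^+ 2 by rewrite !mulr_ge0 ?invr_ge0 ?sqr_ge0.
move: `|y| (normr_ge0 y) => u u0; have [ud|du] := leP u de.
  by rewrite -expr2 gerBl mulr_ge0// sqr_ge0.
have -> : u * de = u ^+ 2 - 4 / 27 / de ^+ 2 * (u ^+ 2) ^+ 2 +
   u / de ^+ 2 * (4 / 27 * (u - 3 / 2 * de) ^+ 2 * (u + 3 * de)).
  by field; rewrite gt_eqF.
rewrite lerDl; apply: mulr_ge0; first by rewrite divr_ge0 ?sqr_ge0.
apply: mulr_ge0; first by apply: mulr_ge0; [lra|exact: sqr_ge0].
by rewrite addr_ge0 ?mulr_ge0// ltW.
Qed.

Lemma trunc_sqr_bound (y : R) : 0 <= trunc_sqr y <= de * `|y|.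
Proof.
have m0 : 0 <= Num.min `|y| de by rewrite le_min normr_ge0 ltW.
rewrite /trunc_sqr mulr_ge0//= mulrC ler_wpM2r// ge_min lexx orbT//.
Qed.

Lemma measurable_trunc_sqr : measurable_fun setT trunc_sqr.
Proof.
apply: measurable_funM; first exact: normr_measurable.
by apply: measurable_minr; [exact: normr_measurable|exact: measurable_cst].
Qed.

Lemma tame_trunc_sqr i : tame P (fun x => trunc_sqr (Y i x)).
Proof.
apply: (tame_le (fun x => de * Y i x)).
- by apply: tameM; [exact: tame_cst|exact: tY].
- exact: measurableT_comp measurable_trunc_sqr (tame_meas _ (tY i)).
- move=> x; have /andP[h0 h1] := trunc_sqr_bound (Y i x).
  by rewrite ger0_norm// normrM gtr0_norm.
Qed.

(** The quantity E S b(S) is estimated twice. It is at most [B] because E |S| <= 1. By independence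
    and centring it equals the sum of E Y_k (b(S) - b(S - Y_k)), which the test property bounds
    below by E H th(S), where [H] is a sum of truncated squares and hence nearly constant. *)
Lemma concentration (A : {set 'I_n}) (b th : R -> R) (B : R) :
  test_for de b th -> measurable_fun setT b -> measurable_fun setT th ->
  (forall v, `|b v| <= B) -> (forall v, 0 <= th v <= 1) ->
  E (fun x => th (S A x)) * ((1 - 4 / 27 / de ^+ 2 * rho ^+ 2) * \sum_(k in A) s k) <= B + de.
Proof.
move=> tst mb mth bB th01.
have tS := tame_psum Y tY A.
have mS A' := tame_meas _ (tame_psum Y tY A').
have tb A' : tame P (fun x => b (S A' x)).
  by apply: (tame_bounded _ B) => //; exact: measurableT_comp mb (mS A').
have tth : tame P (fun x => th (S A x)).
  apply: (tame_bounded _ 1); first exact: measurableT_comp mth (mS A).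
  by move=> x; have /andP[? ?] := th01 (S A x); rewrite ger0_norm.
have B0 : 0 <= B by apply: le_trans (bB 0).
pose H x := \sum_(k in A) trunc_sqr (Y k x).
have tH : tame P H by apply: tame_sum => k _; exact: tame_trunc_sqr.
have st1 : E (fun x => S A x * b (S A x)) <= B.
  apply: (@le_trans _ _ (E (fun x => `|S A x| * B))).
    apply: Ex_le; [exact: tameM|apply: tameM; [exact: tame_norm|exact: tame_cst]|].
    by move=> x; rewrite (le_trans (ler_norm _))// normrM ler_wpM2l.
  rewrite ExZr; last exact: tame_norm.
  by rewrite -[leRHS]mul1r ler_wpM2r// Ex_abs_psum.
have st2 : E (fun x => H x * th (S A x)) <= E (fun x => S A x * b (S A x)).
  have -> : E (fun x => S A x * b (S A x)) =
      E (fun x => \sum_(k in A) Y k x * (b (S A x) - b (S (A :\ k) x))).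
    transitivity (E (fun x => \sum_(k in A) Y k x * b (S A x))).
      by apply: eq_Ex => x; rewrite /psum mulr_suml.
    rewrite !Ex_sum; last 2 first.
    - by move=> k _; apply: tameM; [exact: tY|apply: tameB].
    - by move=> k _; apply: tameM; [exact: tY|].
    apply: eq_bigr => k kA.
    transitivity (E (fun x => Y k x * b (S A x) - Y k x * b (S (A :\ k) x))); last first.
      by apply: eq_Ex => x; rewrite mulrBr.
    rewrite ExB; [|apply: tameM; [exact: tY|by []]..].
    have mid : measurable_fun setT (idfun : R -> R) by exact: measurable_id.
    have kA' : k \notin A :\ k by rewrite in_setD1 eqxx.
    rewrite (Ex_psumM Y tY iY k _ idfun b kA' mid mb (tY k) (tb _)).
    by rewrite EY mul0r subr0.
  apply: Ex_le; first exact: tameM.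
    by apply: tame_sum => k _; apply: tameM; [exact: tY|apply: tameB].
  move=> x; rewrite /H mulr_suml; apply: ler_sum => k kA.
  have := tst (S A x) (Y k x); rewrite /trunc_sqr.
  by have -> : S A x - Y k x = S (A :\ k) x by rewrite (psum_rem _ _ _ x kA) addrK.
pose EH := E H.
(* Replacing [H] by its mean costs [de]: the variance of [H] is at most de^2, and |H - EH| <= de / 2
   + (H - EH)^2 / (2 de). *)
have st3 : EH * E (fun x => th (S A x)) - de <= E (fun x => H x * th (S A x)).
  pose V := E (fun x => (H x - EH) ^+ 2).
  have tHE : tame P (fun x => (H x - EH) ^+ 2).
    by apply: tameX; apply: tameB => //; exact: tame_cst.
  have V1 : V <= de ^+ 2.
    pose Z k x := trunc_sqr (Y k x) - E (fun x => trunc_sqr (Y k x)).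
    have tZ k : tame P (Z k) by apply: tameB; [exact: tame_trunc_sqr|exact: tame_cst].
    have EZ k : E (Z k) = 0.
      by rewrite ExB; [rewrite Ex_cst subrr|exact: tame_trunc_sqr|exact: tame_cst].
    have iZ : mutually_independent P Z.
      have mg k : measurable_fun setT (fun y => trunc_sqr y - E (fun x => trunc_sqr (Y k x))).
        by apply: measurable_funB; [exact: measurable_trunc_sqr|exact: measurable_cst].
      exact: (mutually_independent_comp Y (fun k y => trunc_sqr y - E (fun x => trunc_sqr (Y k x))) mg iY).
    have -> : V = E (fun x => psum Z A x ^+ 2).
      apply: eq_Ex => x; congr (_ ^+ 2); rewrite /psum /Z big_split/= sumrN; congr (_ - _).
      by rewrite /EH Ex_sum// => k _; exact: tame_trunc_sqr.
    rewrite (Ex_psum_sqr Z tZ iZ EZ).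
    apply: (@le_trans _ _ (\sum_(k in A) de ^+ 2 * s k)); last first.
      rewrite -mulr_sumr -[leRHS]mulr1 ler_wpM2l ?sqr_ge0//; exact: sum_s_le1.
    apply: ler_sum => k _.
    have -> : E (fun x => Z k x ^+ 2) = E (fun x => trunc_sqr (Y k x) ^+ 2) - E (fun x => trunc_sqr (Y k x)) ^+ 2.
      set e := E (fun x => trunc_sqr (Y k x)).
      transitivity (E (fun x => trunc_sqr (Y k x) ^+ 2 - (2 * e) * trunc_sqr (Y k x) + e ^+ 2)).
        by apply: eq_Ex => x; rewrite /Z -/e; ring.
      have thy := tame_trunc_sqr k.
      rewrite ExD; [|apply: tameB; [exact: tameX|apply: tameM; [exact: tame_cst|exact: thy]]|exact: tame_cst].
      rewrite ExB; [|exact: tameX|apply: tameM; [exact: tame_cst|exact: thy]].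
      by rewrite ExZl// Ex_cst -/e; ring.
    apply: (@le_trans _ _ (E (fun x => trunc_sqr (Y k x) ^+ 2))); first by rewrite gerBl sqr_ge0.
    rewrite -ExZl; last by apply: tameX; exact: tY.
    apply: Ex_le; [apply: tameX; exact: tame_trunc_sqr|apply: tameM; [exact: tame_cst|apply: tameX; exact: tY]|].
    move=> x; have /andP[h0 h1] := trunc_sqr_bound (Y k x).
    rewrite -[Y k x ^+ 2]real_normK ?num_real// -exprMn lerXn2r// nnegrE// mulr_ge0// ltW//.
  have -> : EH * E (fun x => th (S A x)) - de =
            E (fun x => EH * th (S A x) - de).
    by rewrite ExB; [rewrite ExZl// Ex_cst|apply: tameM => //; exact: tame_cst|exact: tame_cst].
  have d2 : 0 <= de / 2 - V / (2 * de).
    have -> : de / 2 = de ^+ 2 / (2 * de) by field; rewrite gt_eqF.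
    by rewrite subr_ge0 ler_wpM2r// invr_ge0 mulr_ge0// ltW.
  apply: (@le_trans _ _ (E (fun x => EH * th (S A x) - de) + (de / 2 - V / (2 * de)))).
    by rewrite lerDl.
  have -> : E (fun x => EH * th (S A x) - de) + (de / 2 - V / (2 * de)) =
     E (fun x => EH * th (S A x) - de + (de / 2 - (H x - EH) ^+ 2 / (2 * de))).
    rewrite [RHS]ExD; last 2 first.
    - by apply: tameB; [apply: tameM => //; exact: tame_cst|exact: tame_cst].
    - by apply: tameB; [exact: tame_cst|apply: tameM => //; exact: tame_cst].
    congr (_ + _); rewrite ExB; [|exact: tame_cst|apply: tameM => //; exact: tame_cst].
    by rewrite Ex_cst ExZr.
  apply: Ex_le; [|exact: tameM|].
    apply: tameD; first by apply: tameB; [apply: tameM => //; exact: tame_cst|exact: tame_cst].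
    by apply: tameB; [exact: tame_cst|apply: tameM => //; exact: tame_cst].
  move=> x; have /andP[t0 t1] := th01 (S A x).
  have e1 : 0 <= (`|H x - EH| - de) ^+ 2 / (2 * de) by rewrite divr_ge0 ?sqr_ge0 ?mulr_ge0// ltW.
  have e2 : (`|H x - EH| - de) ^+ 2 / (2 * de) = (H x - EH) ^+ 2 / (2 * de) - `|H x - EH| + de / 2.
    rewrite -[(H x - EH) ^+ 2]real_normK ?num_real//; field; by rewrite gt_eqF.
  have e3 : - `|H x - EH| <= (H x - EH) * th (S A x).
    rewrite lerNl -mulNr; apply: (@le_trans _ _ (`|H x - EH| * th (S A x))).
      by rewrite ler_wpM2r// -normrN ler_norm.
    by rewrite ler_piMr.
  by lra.
have st4 : (1 - 4 / 27 / de ^+ 2 * rho ^+ 2) * \sum_(k in A) s k <= EH.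
  rewrite /EH Ex_sum; last by move=> k _; exact: tame_trunc_sqr.
  rewrite mulr_sumr; apply: ler_sum => k _.
  apply: (@le_trans _ _ (E (fun x => Y k x ^+ 2 - (4 / 27 / de ^+ 2) * Y k x ^+ 4))).
    have t2 := tameX _ 2 (tY k); have t4 := tameX _ 4 (tY k).
    rewrite ExB//; last by apply: tameM => //; exact: tame_cst.
    rewrite ExZl//; have : 0 <= 4 / 27 / de ^+ 2 by rewrite !mulr_ge0 ?invr_ge0 ?sqr_ge0.
    by move=> /ler_wpM2l /(_ _ _ (Y4 k)); lra.
  apply: Ex_le; [|exact: tame_trunc_sqr|by move=> x; exact: trunc_sqr_ge].
  apply: tameB; first by apply: tameX.
  by apply: tameM; [exact: tame_cst|apply: tameX].
have Eth0 : 0 <= E (fun x => th (S A x)) by apply: Ex_ge0 => x; have /andP[] := th01 (S A x).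
have := ler_wpM2l Eth0 st4; rewrite [E _ * EH]mulrC; lra.
Qed.

End Concentration.

Lemma smooth_combine {R : realDomainType} (s a b c F rho : R) :
  2 * (s * (a - b)) <= 2 * (s * ((1 + F) * rho)) -> 2 * (s * b - c) <= (1 + F) * (rho * s) ->
  2 * (s * a - c) <= (1 + F) * 3 * rho * s.
Proof. by lra. Qed.

Lemma jump_combine {R : realDomainType} (v2 v Eh EK C : R) :
  v * (v * Eh - EK) <= v * (v * C) -> v2 = v * v -> v2 * Eh - v * EK <= v2 * C.
Proof. by move=> H ->; lra. Qed.

Lemma jump_arith1 {R : realFieldType} (v2 v H K y v3 C : R) :
  v2 * H - v * K <= v2 * (2 / 3 * (y + v3) + C) ->
  v2 * H <= v * K + v2 * (2 / 3) * y + (2 / 3 * (v2 * v3) + C * v2).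
Proof. by lra. Qed.

Lemma jump_arith2 {R : realFieldType} (v2 e0 K y v3 C rho : R) :
  v2 * (2 / 3) * y <= v2 * (2 / 3) * rho -> e0 <= K + v2 * (2 / 3) * y + (v3 + C) ->
  e0 - K <= 2 / 3 * rho * v2 + v3 + C.
Proof. by lra. Qed.

Lemma jump_arith3 {R : realFieldType} (a b y n r : R) :
  a - b <= 2 / 3 * r * y + 2 / 3 * n + 32 / 15 * r * y ->
  a - ((2 / 3 * r + 32 / 15 * r) * y + 2 / 3 * n) <= b.
Proof. by lra. Qed.

Lemma jump_arith4 {R : realFieldType} (a b s n r : R) :
  n <= r * s -> a - ((2 / 3 * r + 32 / 15 * r) * s + 2 / 3 * n) <= b ->
  a - b <= (4 / 3 + 32 / 15) * r * s.
Proof. by lra. Qed.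

(** * Stein's method for the sum *)

Section BerryEsseen.
Context {d} {T : measurableType d} {R : realType} {P : probability T R}.
Context {n : nat} (Y : 'I_n -> T -> R) (rho : R).
Hypothesis tY : forall i, tame P (Y i).
Hypothesis iY : mutually_independent P Y.
Local Notation E := (Ex P).
Local Notation S := (psum Y).
Hypothesis EY : forall i, E (Y i) = 0.
Local Notation s i := (E (fun x => Y i x ^+ 2)).
Hypothesis s1 : \sum_i s i = 1.
Hypothesis Y4 : forall i, E (fun x => Y i x ^+ 4) <= rho ^+ 2 * s i.
Hypothesis rho0 : 0 < rho.

Definition others (i : 'I_n) : {set 'I_n} := finset.setC (finset.set1 i).

Lemma in_others i k : (k \in others i) = (k != i).
Proof. by rewrite finset.in_setC finset.in_set1. Qed.

Lemma notin_others i : i \notin others i.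
Proof. by rewrite in_others eqxx. Qed.

Definition total (x : T) : R := \sum_i Y i x.
Local Notation W := total.

Lemma totalE i x : W x = S (others i) x + Y i x.
Proof.
rewrite /total (bigD1 i)//= addrC; congr (_ + _).
by apply: eq_bigl => k; rewrite in_others.
Qed.

Lemma tame_total : tame P W.
Proof. by apply: tame_sum => i _; exact: tY. Qed.

Hypothesis rho7 : rho <= 1 / 7.

(* 4/5 balances the width of the window against the loss 4/27 (rho/de)^2 in concentration. *)
Let de := 4 / 5 * rho.
Let de0 : 0 < de. Proof. by rewrite /de mulr_gt0//; lra. Qed.
Let sum_others i : 1 - rho ^+ 2 <= \sum_(k in others i) s k.
Proof.
have := s1; rewrite (bigD1 i)//=.
have -> : \sum_(k < n | k != i) s k = \sum_(k in others i) s k.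
  by apply: eq_bigl => k; rewrite in_others.
by have := s_le Y rho tY Y4 i; lra.
Qed.

Let conc i (b th : R -> R) (B : R) :
  test_for de b th -> measurable_fun setT b -> measurable_fun setT th ->
  (forall v, `|b v| <= B) -> (forall v, 0 <= th v <= 1) ->
  E (fun x => th (S (others i) x)) <= 4 / 3 * (B + de).
Proof.
move=> h1 h2 h3 h4 h5.
have := concentration Y rho de tY iY EY s1 Y4 de0 (others i) b th B h1 h2 h3 h4 h5.
set e := E _; have e0 : 0 <= e by apply: Ex_ge0 => x; have /andP[] := h5 (S (others i) x).
(* This is (4/27) (5/4)^2. Together with the factor 1 - 1/49 for the omitted summand, 1 - 25/108
   still leaves at least 3/4. *)
have -> : 4 / 27 / de ^+ 2 * rho ^+ 2 = 25 / 108.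
  by rewrite /de; field; rewrite gt_eqF.
move=> h; rewrite -ler_pdivrMl; last by lra.
have -> : (4 / 3)^-1 * e = e * (3 / 4) by field.
apply: le_trans h; rewrite ler_wpM2l//.
have := sum_others i; have : rho ^+ 2 <= 1 / 49 by have := rho0; have := rho7; nra.
by move: (\sum_(k in _) _) => u; lra.
Qed.

Lemma concentration_itv i (l r : R) : l <= r ->
  E (fun x => (l < S (others i) x <= r)%R%:R) <= 2 / 3 * (r - l) + 32 / 15 * rho.
Proof.
move=> lr.
have -> : 2 / 3 * (r - l) + 32 / 15 * rho = 4 / 3 * ((r - l) / 2 + de + de).
  by rewrite /de; field.
apply: (conc i (itv_test de l r) (fun v => (l < v <= r)%R%:R)).
- exact: itv_testP.
- apply: measurable_homo => x y xy; rewrite /itv_test lerD2r; exact: clamp_homo.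
- exact: measurable_itv_ind.
- by move=> v; exact: itv_test_bound.
- by move=> v; case: (_ < _ <= _); rewrite /= ?lexx ?ler01.
Qed.

Variables (a c : R).
Hypothesis (a0 : 0 < a) (c0 : 0 <= c).

(** The weight 1 - e^(-aL) is at most a L and so offsets the mass 1 / a of the tail: the bound is
    that for an interval of length [L], uniformly in [a]. *)
Lemma concentration_exp i (l L : R) : 0 <= L ->
  E (fun x => (1 - expR (- a * L)) * exp_tail a l (S (others i) x)) <= 2 / 3 * L + 32 / 15 * rho.
Proof.
move=> L0; set q := 1 - _.
have q0 : 0 <= q <= 1.
  rewrite /q subr_ge0 gerBl expR_ge0 andbT -expR0 ler_expR mulNr oppr_le0.
  by rewrite mulr_ge0// ltW.
have qL : q <= a * L by have := expR_ge1Dx (- a * L); rewrite /q; lra.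
have -> : 2 / 3 * L + 32 / 15 * rho = 4 / 3 * (L / 2 + de + de).
  by rewrite /de; field.
have /andP[q00 q01] := q0.
apply: (conc i (exp_test de a l q) (fun v => q * exp_tail a l v)).
- exact: exp_testP.
- apply: measurable_homo => x y xy; rewrite /exp_test lerD2r; apply: lerD; first exact: clamp_homo.
  by rewrite ler_wpM2l//; apply: exp_prim_homo.
- by apply: measurable_funM; [exact: measurable_cst|exact: measurable_exp_tail].
- by move=> v; exact: exp_test_bound.
- move=> v; rewrite mulr_ge0 ?exp_tail_ge0//= -[leRHS]mul1r.
  by apply: ler_pM => //; [exact: exp_tail_ge0|exact: exp_tail_le1].
Qed.

Local Notation h := (exp_tail a c).
Local Notation K := (exp_prim a c).
Local Notation f := (stein_sol a c).
Local Notation k := (smooth_part a c).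
Local Notation p := (tail_mean a c).
Local Notation F := ((2 * phi0 : R)^-1).

Let mh : measurable_fun setT h := measurable_exp_tail a c.
Let mK : measurable_fun setT K.
Proof. by apply: measurable_homo => x y; exact: exp_prim_homo. Qed.
Let mf : measurable_fun setT f.
Proof. by apply: measurable_lip => u v; exact: stein_sol_lip. Qed.

Let tame_h (Z : T -> R) : tame P Z -> tame P (fun x => h (Z x)).
Proof.
move=> tZ; apply: (tame_bounded _ 1).
  exact: measurableT_comp mh (tame_meas _ tZ).
by move=> x; rewrite ger0_norm ?exp_tail_ge0 ?exp_tail_le1.
Qed.

Let tame_K (Z : T -> R) : tame P Z -> tame P (fun x => K (Z x)).
Proof.
move=> tZ; apply: (tame_bounded _ a^-1).
  exact: measurableT_comp mK (tame_meas _ tZ).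
by move=> x; rewrite ger0_norm ?exp_prim_ge0 ?exp_prim_le_inv.
Qed.

Let tame_f (Z : T -> R) : tame P Z -> tame P (fun x => f (Z x)).
Proof.
move=> tZ; apply: (tame_bounded _ F).
  exact: measurableT_comp mf (tame_meas _ tZ).
by move=> x; exact: stein_sol_bound.
Qed.

Let tame_k (Z : T -> R) : tame P Z -> tame P (fun x => k (Z x)).
Proof.
move=> tZ; rewrite /smooth_part; apply: tameD; first by apply: tameB; [exact: tame_f|exact: tame_K].
by apply: tameM => //; exact: tame_cst.
Qed.

Let tS i := tame_psum Y tY (others i).

(** By independence the second moment of Y_i times E V f(V) is E Y_i^2 V f(V), with V the sum of the
    other summands. Passing from W f(W) to V f(V) costs (1 + F) rho, and the Taylor estimate half as
    much; this is the factor 3/2. *)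
Let smooth i : s i * E (fun x => W x * f (W x)) -
    E (fun x => Y i x * (k (W x) - k (S (others i) x))) <=
  (1 + F) * (3 / 2) * rho * s i.
Proof.
pose V := S (others i); have tV : tame P V := tS i.
have ty := tY i; have tW := tame_total.
have F0 : 0 <= F by rewrite invr_ge0 mulr_ge0// ltW// phi0_gt0.
have mn : measurable_fun setT (fun v : R => `|v|) by exact: normr_measurable.
have mabs : measurable_fun setT (fun v : R => `|v| + F).
  by apply: measurable_funD; [exact: normr_measurable|exact: measurable_cst].
have tVF : tame P (fun x => `|V x| + F).
  by apply: tameD; [exact: tame_norm|exact: tame_cst].
have EVF : E (fun x => `|V x| + F) <= 1 + F.
  rewrite ExD; [|exact: tame_norm|exact: tame_cst].
  by rewrite Ex_cst lerD2r Ex_abs_psum.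
have gV : tame P (fun x => V x * f (V x)) by apply: tameM => //; exact: tame_f.
have gW : tame P (fun x => W x * f (W x)) by apply: tameM => //; exact: tame_f.
have mg : measurable_fun setT (fun v : R => v * f v).
  by apply: measurable_funM => //; exact: measurable_id.
have e1 : s i * E (fun x => V x * f (V x)) = E (fun x => Y i x ^+ 2 * (V x * f (V x))).
  have m2 : measurable_fun setT (fun y : R => y ^+ 2) by exact: measurable_funX.
  by rewrite (Ex_psumM Y tY iY i (others i) (fun y => y ^+ 2) (fun v => v * f v) (notin_others i) m2 mg)//; exact: tameX.
have st1 : s i * (E (fun x => W x * f (W x)) - E (fun x => V x * f (V x))) <= s i * ((1 + F) * rho).
  rewrite ler_wpM2l ?s_ge0// -ExB//.
  apply: (@le_trans _ _ (E (fun x => `|Y i x| * (`|V x| + F)))).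
    apply: Ex_le; [exact: tameB|by apply: tameM => //; exact: tame_norm|].
    move=> x; rewrite (le_trans (ler_norm _))//.
    have := stein_mul_lip a c a0 c0 (V x) (W x).
    have -> : W x - V x = Y i x by rewrite (totalE i) addrAC subrr add0r.
    by rewrite [leRHS]mulrC.
  rewrite (Ex_psumM Y tY iY i (others i) (fun y => `|y|) (fun v => `|v| + F) (notin_others i) mn mabs)//; last exact: tame_norm.
  rewrite mulrC; apply: ler_pM => //.
  - by apply: Ex_ge0 => x; rewrite addr_ge0.
  - by apply: Ex_ge0 => x.
  - exact: (Ex_abs Y rho tY Y4 rho0).
have st2 : E (fun x => Y i x ^+ 2 * (V x * f (V x)) - Y i x * (k (W x) - k (V x))) <=
    (1 + F) * (rho * s i) / 2.
  apply: (@le_trans _ _ (E (fun x => (`|Y i x| ^+ 3 * (`|V x| + F)) * (1 / 2)))).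
    apply: Ex_le.
    - apply: tameB; first by apply: tameM => //; exact: tameX.
      by apply: tameM => //; apply: tameB; exact: tame_k.
    - apply: tameM; last exact: tame_cst.
      by apply: tameM => //; apply: tameX; exact: tame_norm.
    - move=> x; have := stein_smooth a c a0 c0 (V x) (Y i x).
      rewrite -(totalE i) => /le_trans; apply.
      by rewrite mul1r -[_ * _ ^+ 3]mulrC.
  have t3 : tame P (fun x => `|Y i x| ^+ 3) by apply: tameX; exact: tame_norm.
  have m3 : measurable_fun setT (fun y : R => `|y| ^+ 3).
    by apply: measurable_funX; exact: normr_measurable.
  rewrite ExZr; last exact: tameM.
  rewrite (Ex_psumM Y tY iY i (others i) (fun y => `|y| ^+ 3) (fun v => `|v| + F) (notin_others i) m3 mabs)//.
  have : E (fun x => `|Y i x| ^+ 3) * E (fun x => `|V x| + F) <= (rho * s i) * (1 + F).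
    apply: ler_pM => //.
    - by apply: Ex_ge0 => x; rewrite exprn_ge0.
    - by apply: Ex_ge0 => x; rewrite addr_ge0.
    - exact: (Ex_abs3 Y rho tY Y4 rho0).
  by rewrite mul1r ler_pM2r ?invr_gt0// [leRHS]mulrC.
rewrite ExB in st2; last 2 first.
- by apply: tameM => //; exact: tameX.
- by apply: tameM => //; apply: tameB; exact: tame_k.
rewrite -e1 in st2; rewrite -/V.
have half (G r u : R) : 2 * ((1 + G) * (3 / 2) * r * u) = (1 + G) * 3 * r * u by field.
rewrite -(ler_pM2l (ltr0n R 2)) half.
apply: (smooth_combine _ _ (E (fun x => V x * f (V x)))); first by rewrite ler_pM2l.
by rewrite mulrC -ler_pdivlMr.
Qed.

(** Here [v] stands for the value of Y_i in the increment of the primitive and [u] for the value of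
    an independent copy inside [h]. The window between 0 and [v] is cut by [exp_prim_clamp] at the
    point nearest to [u]; both error terms then have length at most |u| + |v|, to which
    concentration of the other summands applies. *)
Let jump_fixed i (u v : R) :
  v ^+ 2 * E (fun x => h (u + S (others i) x)) -
  v * E (fun x => K (v + S (others i) x) - K (S (others i) x)) <=
  v ^+ 2 * (2 / 3 * (`|u| + `|v|) + 32 / 15 * rho).
Proof.
pose V := S (others i); have tV : tame P V := tS i.
have tVu (z : R) : tame P (fun x => V x + z) by apply: tameD => //; exact: tame_cst.
pose al := Num.min 0 v; pose be := Num.max 0 v.
pose y1 := Num.max al (Num.min u be).
have ab : al <= be by rewrite /al /be ge_min le_max lexx.
have bal : be - al = `|v|.
  rewrite /be /al; case: (leP 0 v) => v0; first by rewrite subr0 ger0_norm.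
  by rewrite sub0r ltr0_norm.
have au : u - al <= `|u| + `|v|.
  have := ler_norm u; have := ler_norm (- v); rewrite normrN /al.
  by have := normr_ge0 v; case: (leP 0 v); lra.
have bu : be - u <= `|u| + `|v|.
  have := ler_norm (- u); have := ler_norm v; rewrite normrN /be.
  by have := normr_ge0 v; case: (leP 0 v); lra.
have ay1 : al <= y1 by rewrite le_max lexx.
have y1b : y1 <= be by rewrite ge_max ab ge_min lexx orbT.
pose th1 x : R := (V x + al <= c < V x + u)%R%:R.
pose th2 x := (1 - expR (- a * (be - u))) * h (V x + u).
have tth1 : tame P th1.
  apply: (tame_bounded _ 1); last first.
    by move=> x; rewrite /th1; case: (_ <= _ < _); rewrite /= ?normr1 ?normr0.
  have -> : th1 = (fun w => (c - u < w <= c - al)%R%:R) \o V.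
    by apply/funext => x; rewrite /th1/= andbC ltrBlDr -lerBrDr.
  exact: measurableT_comp (measurable_itv_ind _ _) (tame_meas _ tV).
have tth2 : tame P th2 by apply: tameM; [exact: tame_cst|exact: tame_h].
set C := 2 / 3 * (`|u| + `|v|) + 32 / 15 * rho.
have E1 : (y1 - al) * E th1 <= (y1 - al) * C.
  have [ual|alu] := leP u al.
    have -> : y1 = al by rewrite /y1 max_l// ge_min ual.
    by rewrite subrr !mul0r.
  rewrite ler_wpM2l ?subr_ge0//.
  have -> : E th1 = E (fun x => (c - u < S (others i) x <= c - al)%R%:R).
    by apply: eq_Ex => x; rewrite /th1 /V andbC ltrBlDr -lerBrDr.
  apply: le_trans (concentration_itv i _ _ _) _; first by lra.
  by rewrite /C; lra.
have E2 : (be - y1) * E th2 <= (be - y1) * C.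
  have [beu|ube] := leP be u.
    have -> : y1 = be by rewrite /y1 min_r// max_r.
    by rewrite subrr !mul0r.
  rewrite ler_wpM2l ?subr_ge0//.
  have -> : E th2 = E (fun x => (1 - expR (- a * (be - u))) * exp_tail a (c - u) (S (others i) x)).
    apply: eq_Ex => x; rewrite /th2 /V /exp_tail; congr (_ * _).
    by rewrite lerBrDr; congr (if _ then _ else expR _); ring.
  apply: le_trans (concentration_exp i _ _ _) _; first by lra.
  by rewrite /C; lra.
have tK z : tame P (fun x => K (V x + z)) by exact: tame_K.
have H : `|v| * E (fun x => h (V x + u)) - E (fun x => K (V x + be) - K (V x + al)) <= `|v| * C.
  rewrite -ExZl; last exact: tame_h.
  rewrite -ExB; [|by apply: tameM; [exact: tame_cst|exact: tame_h]|exact: tameB].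
  apply: (@le_trans _ _ (E (fun x => (y1 - al) * th1 x + (be - y1) * th2 x))).
    apply: Ex_le.
    - apply: tameB; first by apply: tameM; [exact: tame_cst|exact: tame_h].
      exact: tameB.
    - by apply: tameD; apply: tameM => //; exact: tame_cst.
    - move=> x; have := exp_prim_clamp a c a0 al be u y1 (V x) ab erefl.
      by rewrite bal.
  rewrite ExD; [|by apply: tameM => //; exact: tame_cst..].
  have e1 : E (fun x => (y1 - al) * th1 x) = (y1 - al) * E th1 by exact: ExZl.
  have e2 : E (fun x => (be - y1) * th2 x) = (be - y1) * E th2 by exact: ExZl.
  rewrite e1 e2 (_ : `|v| * C = (y1 - al) * C + (be - y1) * C).
    exact: lerD.
  by rewrite -bal; ring.
have -> : E (fun x => h (u + S (others i) x)) = E (fun x => h (V x + u)).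
  by apply: eq_Ex => x; rewrite addrC.
have -> : v * E (fun x => K (v + S (others i) x) - K (S (others i) x)) =
          `|v| * E (fun x => K (V x + be) - K (V x + al)).
  rewrite /be /al; case: (leP 0 v) => v0.
    rewrite (ger0_norm v0); apply: (congr1 ( *%R v)); apply: eq_Ex => x.
    by rewrite addr0 [v + _]addrC.
  rewrite (ltr0_norm v0) mulNr -mulrN; apply: (congr1 ( *%R v)).
  rewrite -ExN; last by apply: tameB.
  by apply: eq_Ex => x; rewrite addr0 opprB [v + _]addrC.
apply: jump_combine; first exact: ler_wpM2l (normr_ge0 v) _ _ H.
by rewrite -expr2 real_normK// num_real.
Qed.

(** The first term is a product of two expectations, so the Y_i inside W may be treated as
    independent of the one that is squared. Integrating [jump_fixed] over [u] turns |u| into [rho];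
    integrating over [v] then turns |v|^3 into rho times the second moment. Hence 4/3 = 2/3 +
    2/3. *)
Let jump i : s i * E (fun x => h (W x)) - E (fun x => Y i x * (K (W x) - K (S (others i) x))) <=
  (4 / 3 + 32 / 15) * rho * s i.
Proof.
pose V := S (others i); have tV : tame P V := tS i.
have ty := tY i; have tW := tame_total.
have mV := tame_meas _ tV; have my := tame_meas _ ty.
have iYV := indep_psum Y tY iY i (others i) (notin_others i).
have mD : measurable_fun setT (fun z : R * R => z.1 + z.2).
  by apply: measurable_funD; [exact: measurable_fst|exact: measurable_snd].
have tuV (u : R) : tame P (fun x => u + V x) by apply: tameD => //; exact: tame_cst.
have tyV : tame P (fun x => Y i x + V x) by exact: tameD.
have [iH eH] := indep_Ex P my mV iYV (fun u v => h (u + v))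
  (measurableT_comp mh mD) (tame_int _ (tame_h _ tyV)) (fun u => tame_int _ (tame_h _ (tuV u))).
pose Hf u := E (fun x => h (u + V x)).
pose Kd u := E (fun x => K (u + V x) - K (V x)).
have mKd : measurable_fun setT (fun z : R * R => z.1 * (K (z.1 + z.2) - K z.2)).
  apply: measurable_funM; first exact: measurable_fst.
  apply: measurable_funB; first exact: measurableT_comp mK mD.
  exact: measurableT_comp mK measurable_snd.
have tKd (u : R) : tame P (fun x => u * (K (u + V x) - K (V x))).
  by apply: tameM; [exact: tame_cst|apply: tameB; exact: tame_K].
have tyK : tame P (fun x => Y i x * (K (Y i x + V x) - K (V x))).
  by apply: tameM => //; apply: tameB; exact: tame_K.
have [iK eK] := indep_Ex P my mV iYV (fun u v => u * (K (u + v) - K v))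
  mKd (tame_int _ tyK) (fun u => tame_int _ (tKd u)).
have EhW : E (fun x => h (W x)) = E (fun x => Hf (Y i x)).
  rewrite /Hf -eH; by apply: eq_Ex => x; rewrite (totalE i) addrC.
have EKW : E (fun x => Y i x * (K (W x) - K (S (others i) x))) = E (fun x => Y i x * Kd (Y i x)).
  transitivity (E (fun x => Y i x * (K (Y i x + V x) - K (V x)))).
    by apply: eq_Ex => x; rewrite (totalE i) [S _ x + _]addrC.
  rewrite eK; apply: eq_Ex => x; rewrite /Kd ExZl//.
  by apply: tameB; exact: tame_K.
have iKd : P.-integrable setT (EFin \o (fun x => Y i x * Kd (Y i x))).
  apply: eq_integrable iK => // x _ /=; congr EFin; rewrite /Kd ExZl//.
  by apply: tameB; exact: tame_K.
have st1 v : v ^+ 2 * E (fun x => h (W x)) - v * Kd v <=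
    2 / 3 * rho * v ^+ 2 + 2 / 3 * `|v| ^+ 3 + 32 / 15 * rho * v ^+ 2.
  have iHv : P.-integrable setT (EFin \o (fun x => v ^+ 2 * Hf (Y i x))).
    by have := integrableZl measurableT (v ^+ 2) iH; apply: eq_integrable.
  have -> : v ^+ 2 * E (fun x => h (W x)) = E (fun x => v ^+ 2 * Hf (Y i x)).
    rewrite EhW /Ex; symmetry; exact: RintegralZl.
  have t1 : tame P (fun x => v * Kd v + (v ^+ 2 * (2 / 3)) * `|Y i x| + (2 / 3 * `|v| ^+ 3 + 32 / 15 * rho * v ^+ 2)).
    apply: tameD; last exact: tame_cst.
    by apply: tameD; [exact: tame_cst|apply: tameM; [exact: tame_cst|exact: tame_norm]].
  have : E (fun x => v ^+ 2 * Hf (Y i x)) <=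
     E (fun x => v * Kd v + (v ^+ 2 * (2 / 3)) * `|Y i x| + (2 / 3 * `|v| ^+ 3 + 32 / 15 * rho * v ^+ 2)).
    rewrite /Ex le_Rintegral//; first exact: tame_int.
    move=> x _; have := jump_fixed i (Y i x) v; rewrite -/V -/(Hf _) -/(Kd v).
    have -> : `|v| ^+ 3 = v ^+ 2 * `|v| by rewrite exprSr real_normK// num_real.
    exact: jump_arith1.
  have tn := tame_norm _ ty.
  move: (E (fun x => v ^+ 2 * Hf (Y i x))) => e0.
  rewrite ExD; [|by apply: tameD; [exact: tame_cst|apply: tameM; [exact: tame_cst|exact: tn]]|exact: tame_cst].
  rewrite ExD; [|exact: tame_cst|by apply: tameM; [exact: tame_cst|exact: tn]].
  rewrite !Ex_cst ExZl//.
  have := Ex_abs Y rho tY Y4 rho0 i => Ea.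
  have : v ^+ 2 * (2 / 3) * E (fun x => `|Y i x|) <= v ^+ 2 * (2 / 3) * rho.
    by rewrite ler_wpM2l// mulr_ge0 ?sqr_ge0//; lra.
  exact: jump_arith2.
rewrite EKW.
have t2 : tame P (fun x => Y i x ^+ 2) by exact: tameX.
have tn := tame_norm _ ty.
have t3 : tame P (fun x => `|Y i x| ^+ 3) by exact: tameX.
have -> : s i * E (fun x => h (W x)) = E (fun x => Y i x ^+ 2 * E (fun x => h (W x))) by rewrite ExZr.
have tL : tame P (fun x => Y i x ^+ 2 * E (fun x => h (W x))) by apply: tameM => //; exact: tame_cst.
have tB : tame P (fun x => (2 / 3 * rho + 32 / 15 * rho) * Y i x ^+ 2 + 2 / 3 * `|Y i x| ^+ 3).
  by apply: tameD; apply: tameM => //; exact: tame_cst.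
have : E (fun x => Y i x ^+ 2 * E (fun x => h (W x)) - ((2 / 3 * rho + 32 / 15 * rho) * Y i x ^+ 2 + 2 / 3 * `|Y i x| ^+ 3)) <=
   E (fun x => Y i x * Kd (Y i x)).
  rewrite {1 3}/Ex le_Rintegral//; first by apply: tame_int; exact: tameB.
  by move=> x _; have := st1 (Y i x); exact: jump_arith3.
rewrite ExB// ExD; [|by apply: tameM => //; exact: tame_cst..].
rewrite ExZl// ExZl//.
exact: (jump_arith4 _ _ _ _ _ (Ex_abs3 Y rho tY Y4 rho0 i)).
Qed.

(* 7 bounds (3/2)(1 + 1/(2 phi0)) + 4/3 + 32/15: the smooth part of f' and its jump. *)
Lemma stein_tail_pos : E (fun x => h (W x)) <= p + 7 * rho.
Proof.
have tW := tame_total.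
have tfW := tame_f _ tW; have thW := tame_h _ tW; have tKW := tame_K _ tW; have tkW := tame_k _ tW.
have gW : tame P (fun x => W x * f (W x)) by exact: tameM.
have Ewf : E (fun x => W x * f (W x)) =
    \sum_i E (fun x => Y i x * (f (W x) - f (S (others i) x))).
  transitivity (E (fun x => \sum_i Y i x * f (W x))).
    by apply: eq_Ex => x; rewrite mulr_suml.
  rewrite Ex_sum; last by move=> i _; apply: tameM => //; exact: tY.
  apply: eq_bigr => i _; have ty := tY i; have tfS := tame_f _ (tS i).
  transitivity (E (fun x => Y i x * f (W x) - Y i x * f (S (others i) x))); last first.
    by apply: eq_Ex => x; rewrite mulrBr.
  rewrite ExB; [|exact: tameM..].
  have mid : measurable_fun setT (idfun : R -> R) by exact: measurable_id.
  rewrite (Ex_psumM Y tY iY i _ idfun f (notin_others i) mid mf ty tfS).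
  by rewrite EY mul0r subr0.
have eq1 i : E (fun x => Y i x * (f (W x) - f (S (others i) x))) =
   E (fun x => Y i x * (k (W x) - k (S (others i) x))) +
   E (fun x => Y i x * (K (W x) - K (S (others i) x))) - p * s i.
  have ty := tY i; have tSi := tS i.
  have t1 : tame P (fun x => Y i x * (k (W x) - k (S (others i) x))).
    by apply: tameM => //; apply: tameB; exact: tame_k.
  have t2 : tame P (fun x => Y i x * (K (W x) - K (S (others i) x))).
    by apply: tameM => //; apply: tameB; exact: tame_K.
  rewrite -ExZl; last exact: tameX.
  rewrite -ExD// -ExB; [|exact: tameD|by apply: tameM; [exact: tame_cst|exact: tameX]].
  by apply: eq_Ex => x; rewrite /smooth_part (totalE i); ring.
(* Stein's equation, taken in expectation and distributed over the summands by means of the unit sum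
   of their second moments. *)
have tot : E (fun x => h (W x)) - p =
   \sum_i ((s i * E (fun x => W x * f (W x)) - E (fun x => Y i x * (k (W x) - k (S (others i) x)))) +
     (s i * E (fun x => h (W x)) - E (fun x => Y i x * (K (W x) - K (S (others i) x))))).
  transitivity (\sum_i (s i * (E (fun x => W x * f (W x)) + E (fun x => h (W x)) - p) -
      E (fun x => Y i x * (f (W x) - f (S (others i) x))))).
    rewrite big_split/= sumrN -mulr_suml s1 mul1r -Ewf; ring.
  by apply: eq_bigr => i _; rewrite eq1; ring.
have : E (fun x => h (W x)) - p <= \sum_i ((1 + F) * (3 / 2) * rho * s i + (4 / 3 + 32 / 15) * rho * s i).
  by rewrite tot; apply: ler_sum => i _; apply: lerD; [exact: smooth|exact: jump].
rewrite big_split/= -!mulr_sumr s1 !mulr1.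
have /andP[pl _] := @phi0_bounds R.
have F1 : F <= 50 / 39.
  have -> : 50 / 39 = (2 * (39 / 100))^-1 :> R by field.
  by rewrite lef_pV2 ?posrE ?mulr_gt0 ?phi0_gt0//; lra.
have : (1 + F) * (3 / 2) * rho <= (1 + 50 / 39) * (3 / 2) * rho.
  by rewrite ler_wpM2r ?(ltW rho0)//; lra.
by have := rho0; lra.
Qed.

End BerryEsseen.

(** Two boundary cases are added. For rho > 1/7 the bound exceeds 1. The value a = 0, needed at x =
    0, is reached from small b > 0: as e^(-bz) >= 1 - bz and c >= 0, the tail at 0 exceeds the tail
    at b by at most b |W|, and E |W| <= 1. *)
Lemma stein_tail {d} {T : measurableType d} {R : realType} {P : probability T R}
  {n : nat} (Y : 'I_n -> T -> R) (rho a c : R) :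
  (forall i, tame P (Y i)) -> mutually_independent P Y ->
  (forall i, Ex P (Y i) = 0) -> \sum_i Ex P (fun x => Y i x ^+ 2) = 1 ->
  (forall i, Ex P (fun x => Y i x ^+ 4) <= rho ^+ 2 * Ex P (fun x => Y i x ^+ 2)) ->
  0 < rho -> 0 <= a -> 0 <= c ->
  Ex P (fun x => exp_tail a c (\sum_i Y i x)) <= tail_mean a c + 7 * rho.
Proof.
move=> tY iY EY s1 Y4 rho0 a0 c0.
have tW : tame P (total Y) := tame_total Y tY.
have th b : 0 <= b -> tame P (fun x => exp_tail b c (total Y x)).
  move=> b0; apply: (tame_bounded _ 1).
    exact: measurableT_comp (measurable_exp_tail b c) (tame_meas _ tW).
  move=> x; rewrite /exp_tail; case: ifPn => [_|wc]; first by rewrite normr0.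
  rewrite ger0_norm ?expR_ge0// -expR0 ler_expR mulNr oppr_le0.
  by rewrite mulr_ge0// subr_ge0 ltW// ltNge.
have [r7|r7] := leP rho (1 / 7); last first.
  apply: (@le_trans _ _ 1); last first.
    by have : 0 <= tail_mean a c := tail_mean_ge0 a c; lra.
  rewrite -[leRHS](@Ex_cst _ _ _ P); apply: Ex_le; [exact: th|exact: tame_cst|].
  move=> x; rewrite /exp_tail; case: ifPn => [//|wc].
  rewrite -expR0 ler_expR mulNr oppr_le0.
  by rewrite mulr_ge0// subr_ge0 ltW// ltNge.
have pos b : 0 < b -> Ex P (fun x => exp_tail b c (total Y x)) <= tail_mean b c + 7 * rho.
  by move=> b0; exact: stein_tail_pos.
have [a_gt0|a_le0] := ltP 0 a; first exact: pos.
have {a_le0}a00 : a = 0 by apply/eqP; rewrite eq_le a_le0 a0.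
rewrite a00; apply/ler_addgt0Pr => b b0.
have pb : tail_mean b c <= tail_mean 0 c.
  by rewrite /tail_mean ler_wpM2l ?expR_ge0// Mills_homo// lerD2r ltW.
have EW : Ex P (fun x => `|total Y x|) <= 1.
  apply: le_trans (Ex_abs_psum Y tY iY EY s1 [set: 'I_n]%SET).
  by rewrite le_eqVlt; apply/orP; left; apply/eqP; apply: eq_Ex => x; rewrite /total /psum;
     congr (`|_|); apply: eq_bigl => k; rewrite finset.in_setT.
have tb := th b (ltW b0).
have tn : tame P (fun x => b * `|total Y x|).
  by apply: tameM; [exact: tame_cst|exact: tame_norm].
have : Ex P (fun x => exp_tail 0 c (total Y x)) <=
       Ex P (fun x => exp_tail b c (total Y x) + b * `|total Y x|).
  apply: Ex_le; [exact: th|exact: tameD|move=> x].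
  rewrite /exp_tail oppr0 mul0r expR0; case: ifPn => [_|wc].
    by rewrite add0r mulr_ge0// ltW.
  have h1 := expR_ge1Dx (- b * (total Y x - c)).
  have h2 : b * (total Y x - c) <= b * `|total Y x|.
    by rewrite ler_wpM2l ?(ltW b0)//; have := ler_norm (total Y x); lra.
  by have := lerD h1 h2; rewrite mulNr; lra.
rewrite ExD// ExZl; last exact: tame_norm.
move/le_trans; apply.
have H : b * Ex P (fun x => `|total Y x|) <= b * 1 by rewrite ler_wpM2l// ltW.
by rewrite mulr1 in H; have := lerD (pos b b0) H; move/le_trans; apply; rewrite lerD2r lerD2r.
Qed.

(** * Exponential moments under Bernstein's condition *)

(** Pascal's rule for partial sums; it lets the expansion of (1 - x)^(-p-1) be bounded by induction
    on [p], without infinite series. *)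
Lemma bin_series_eq {R : comPzRingType} (x : R) (p N : nat) :
  (1 - x) * (\sum_(0 <= k < N) 'C(k + p.+1, p.+1)%:R * x ^+ k) + 'C(N + p, p.+1)%:R * x ^+ N =
  \sum_(0 <= k < N) 'C(k + p, p)%:R * x ^+ k.
Proof.
elim: N => [|N ih]; first by rewrite !big_geq// mulr0 add0r add0n bin_small// mul0r.
rewrite !big_nat_recr//= -ih addSn binS natrD addnS binS natrD exprS; ring.
Qed.

Lemma bin_series_le {R : realFieldType} (x : R) (p N : nat) : 0 <= x -> x < 1 ->
  \sum_(0 <= k < N) 'C(k + p, p)%:R * x ^+ k <= (1 - x)^-1 ^+ p.+1.
Proof.
move=> x0 x1; have d0 : 0 < 1 - x by rewrite subr_gt0.
elim: p => [|p ih].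
  rewrite expr1 -[leRHS]mul1r ler_pdivlMr// mulrC.
  under eq_bigr do rewrite addn0 bin0 mul1r.
  elim: N => [|N ih]; first by rewrite big_geq// mulr0.
  rewrite big_nat_recr//= mulrDr.
  have -> : (1 - x) * (\sum_(0 <= i < N) x ^+ i) = 1 - x ^+ N.
    elim: N {ih} => [|N ih]; first by rewrite big_geq// mulr0 expr0 subrr.
    by rewrite big_nat_recr//= mulrDr ih exprS; ring.
  have := exprn_ge0 N.+1 x0; rewrite exprS; lra.
rewrite exprS -ler_pdivrMl ?invr_gt0// invrK; apply: le_trans ih.
by rewrite -(bin_series_eq x p N) lerDl mulr_ge0// exprn_ge0.
Qed.

Lemma series_exp_even {R : realType} (y : R) (N : nat) :
  series (exp_coeff y) N.*2 + series (exp_coeff (- y)) N.*2 =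
  2 * \sum_(0 <= k < N) y ^+ k.*2 / (k.*2)`!%:R.
Proof.
elim: N => [|N ih]; first by rewrite /series/= !big_geq// mulr0 addr0.
rewrite /series/= doubleS !big_nat_recr//=.
move: ih; rewrite /series/= => ih.
rewrite /exp_coeff/= !exprS mulrDr -ih.
have -> : (- y) ^+ N.*2 = y ^+ N.*2 by rewrite -mul2n !exprM sqrrN.
by ring.
Qed.

Lemma cvg_cosh_series {R : realType} (y : R) :
  2 * \sum_(0 <= k < N) y ^+ k.*2 / (k.*2)`!%:R @[N --> \oo] --> expR y + expR (- y).
Proof.
under eq_fun do rewrite -series_exp_even.
have h (z : R) : series (exp_coeff z) N.*2 @[N --> \oo] --> expR z.
  have c : series (exp_coeff z) N @[N --> \oo] --> expR z by exact: is_cvg_series_exp_coeff.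
  apply: (cvg_comp _ _ _ c); apply/cvgnyPge => A.
  by near=> N; rewrite (@leq_trans N)//; [near: N; exact: nbhs_infty_ge|rewrite -addnn leq_addr].
by apply: cvgD; exact: h.
Unshelve. all: by end_near. Qed.

Lemma expR_abs_le {R : realType} (y : R) : expR `|y| <= expR y + expR (- y).
Proof.
by case: (ger0P y) => _; rewrite ?lerDl ?lerDr expR_ge0.
Qed.

Lemma pow_le_exp {R : realType} (y : R) (k : nat) : 0 <= y -> y ^+ k <= k`!%:R * expR y.
Proof.
case: k => [|k] y0; first by rewrite expr0 fact0 mul1r -expR0 ler_expR.
rewrite -ler_pdivrMl ?ltr0n ?fact_gt0// mulrC.
by have := expR_ge1Dxn k y0; lra.
Qed.

Section ExponentialMoments.
Context {d} {T : measurableType d} {R : realType} {P : probability T R}.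
Variables (X : T -> R) (eps : R).
Hypothesis tX : tame P X.
Hypothesis eps0 : 0 < eps.
Local Notation E := (Ex P).
Local Notation s2 := (E (fun x => X x ^+ 2)).
Hypothesis bern : forall k, E (fun x => X x ^+ k.+2) <= (k.+2)`!%:R / 2 * eps ^+ k * s2.

Let mX := tame_meas _ tX.

Lemma moment2_ge0 : 0 <= s2. Proof. by apply: Ex_ge0 => x; rewrite sqr_ge0. Qed.

Let tpow k (c : R) : tame P (fun x => (c * X x) ^+ k).
Proof. by apply: tameX; apply: tameM => //; exact: tame_cst. Qed.

(** The cosh series has nonnegative terms, so monotone convergence needs only the even moments;
    Bernstein's condition bounds them by a geometric series of ratio (mu eps)^2. *)
Lemma integrable_exp_abs (mu : R) : 0 <= mu -> mu * eps < 1 ->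
  P.-integrable setT (EFin \o (fun x => expR (mu * `|X x|))).
Proof.
move=> mu0 me1; have ta0 : 0 <= mu * eps by rewrite mulr_ge0// ltW.
pose f N x := 2 * \sum_(0 <= k < N) (mu * X x) ^+ k.*2 / (k.*2)`!%:R.
have tf N : tame P (f N).
  apply: tameM; first exact: tame_cst.
  by apply: tame_sum => k _; apply: tameM; [exact: tpow|exact: tame_cst].
have f0 N x : 0 <= f N x.
  rewrite mulr_ge0// sumr_ge0// => k _.
  by rewrite mulr_ge0 ?invr_ge0// -mul2n exprM exprn_ge0// sqr_ge0.
pose B := 2 * (1 + mu ^+ 2 * s2 / 2 * (1 - (mu * eps) ^+ 2)^-1).
have fB N : E (f N.+1) <= B.
  have tt k : tame P (fun x => (mu * X x) ^+ k.*2 / (k.*2)`!%:R).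
    by apply: tameM; [exact: tpow|exact: tame_cst].
  rewrite /f ExZl; last by apply: tame_sum.
  rewrite ler_pM2l// Ex_sum//.
  rewrite big_nat_recl//=; apply: lerD.
    rewrite -[leRHS](@Ex_cst _ _ _ P); apply: Ex_le => //; first exact: tame_cst.
    by move=> x; rewrite expr0 divr1.
  have q1 : (mu * eps) ^+ 2 < 1 by rewrite expr_lt1.
  have := bin_series_le ((mu * eps) ^+ 2) 0 N (sqr_ge0 _) q1.
  rewrite expr1 => /(ler_wpM2l (_ : 0 <= mu ^+ 2 * s2 / 2)) h.
  apply: le_trans (h _); last by rewrite mulr_ge0// mulr_ge0 ?sqr_ge0 ?moment2_ge0.
  rewrite mulr_sumr; apply: ler_sum => k _; rewrite addn0 bin0 mul1r.
  rewrite ExZr; last exact: tpow.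
  under eq_Ex do rewrite exprMn.
  rewrite ExZl; last exact: tameX.
  rewrite ler_pdivrMr ?ltr0n ?fact_gt0//.
  have := bern k.*2; rewrite -doubleS.
  move/(ler_wpM2l (exprn_ge0 (k.+1).*2 mu0)) => /le_trans; apply.
  rewrite le_eqVlt; apply/orP; left; apply/eqP.
  have -> : mu ^+ (k.+1).*2 = mu ^+ 2 * mu ^+ k.*2 by rewrite -exprD doubleS.
  rewrite -exprM exprMn mul2n; move: (_`!%:R) (mu ^+ k.*2) (eps ^+ k.*2) (E _) => u1 u2 u3 u4.
  by field.
have cv : (\int[P]_x (f N x)%:E @[N --> \oo] --> \int[P]_x (limn (fun N => (f N x)%:E)))%E.
  apply: (@cvg_monotone_convergence _ _ _ P setT measurableT (fun N x => (f N x)%:E)).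
  - by move=> N; apply/measurable_EFinP; exact: tame_meas.
  - by move=> N x _; rewrite lee_fin.
  - move=> x _ m n mn; rewrite lee_fin /f ler_pM2l//.
    rewrite (big_cat_nat _ mn)//= lerDl sumr_ge0// => k _.
    by rewrite mulr_ge0 ?invr_ge0// -mul2n exprM exprn_ge0// sqr_ge0.
have lf x : limn (fun N => (f N x)%:E) = (expR (mu * X x) + expR (- (mu * X x)))%:E.
  apply: cvg_lim => //; apply: cvg_EFin; first by near=> N.
  exact: cvg_cosh_series.
have fBe N : (0 < N)%N -> (\int[P]_x (f N x)%:E <= B%:E)%E.
  case: N => // N _; rewrite -[leLHS]fineK; last exact: integrable_fin_num (tame_int _ (tf _)).
  by rewrite lee_fin; exact: fB.
have h : (\int[P]_x (limn (fun N => (f N x)%:E)) <= B%:E)%E.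
  rewrite -(cvg_lim _ cv)//; apply: lime_le; first by apply/cvg_ex; eexists; exact: cv.
  by exists 1%N => // N; exact: fBe.
have mexp (g : T -> R) : measurable_fun setT g -> measurable_fun setT (fun x => expR (g x)).
  by move=> mg; apply: measurableT_comp mg; exact: measurable_expR.
have mX' : measurable_fun setT (fun x => mu * X x).
  by apply: measurable_funM; [exact: measurable_cst|exact: mX].
have mabs : measurable_fun setT (fun x => expR (mu * `|X x|)).
  apply: mexp; apply: measurable_funM; first exact: measurable_cst.
  exact: tame_meas (tame_norm _ tX).
apply/integrableP; split; first exact/measurable_EFinP.
apply: (@le_lt_trans _ _ B%:E); last exact: ltry.
apply: le_trans h; under [leRHS]eq_integral do rewrite lf.
apply: ge0_le_integral => //.
- by apply: measurableT_comp => //; exact/measurable_EFinP.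
- apply/measurable_EFinP; apply: measurable_funD; apply: mexp => //.
  exact: measurableT_comp mX'.
- move=> x _; rewrite /= lee_fin ger0_norm ?expR_ge0//.
  by rewrite -[mu in mu * `|_|]ger0_norm// -normrM expR_abs_le.
Unshelve. all: by end_near. Qed.

Section Tilted.
Variable lam : R.
Hypothesis lam0 : 0 <= lam.
Hypothesis tau1 : lam * eps < 1.

Lemma integrable_pow_exp_abs (k : nat) :
  P.-integrable setT (EFin \o (fun x => `|X x| ^+ k * expR (lam * `|X x|))).
Proof.
(* Half of the available room: (lam + de) eps = (1 + lam eps) / 2 < 1, while |X|^k is at most k!
   de^(-k) e^(de |X|). *)
pose de := (1 - lam * eps) / 2 / eps.
have de0 : 0 < de by rewrite divr_gt0// divr_gt0// subr_gt0.
have h : (lam + de) * eps < 1.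
  rewrite mulrDl /de mulfVK ?gt_eqF//; have := tau1; move: (lam * eps) => u; lra.
have ld0 : 0 <= lam + de by rewrite addr_ge0// ltW.
have := integrableZl measurableT (k`!%:R * (de^-1) ^+ k) (integrable_exp_abs _ ld0 h).
have mabs := tame_meas _ (tame_norm _ tX).
apply: le_integrable => //.
- apply/measurable_EFinP; apply: measurable_funM; first exact: measurable_funX.
  apply: measurableT_comp; first exact: measurable_expR.
  by apply: measurable_funM; [exact: measurable_cst|exact: mabs].
- move=> x _ /=; rewrite lee_fin [leLHS]ger0_norm; last by rewrite mulr_ge0 ?expR_ge0// exprn_ge0.
  rewrite [leRHS]ger0_norm; last by rewrite !mulr_ge0 ?expR_ge0// exprn_ge0// invr_ge0 ltW.
  rewrite [(lam + de) * _]mulrDl expRD [expR (lam * _) * _]mulrC mulrA ler_pM2r ?expR_gt0//.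
  rewrite [k`!%:R * _]mulrC -mulrA exprVn -ler_pdivrMl ?invr_gt0 ?exprn_gt0// invrK.
  rewrite -exprMn; exact: pow_le_exp (mulr_ge0 (ltW de0) (normr_ge0 _)).
Qed.

Let mexp : measurable_fun setT (fun x => expR (lam * X x)).
Proof.
apply: measurableT_comp; first exact: measurable_expR.
by apply: measurable_funM; [exact: measurable_cst|exact: mX].
Qed.

Lemma integrable_pow_exp (k : nat) :
  P.-integrable setT (EFin \o (fun x => X x ^+ k * expR (lam * X x))).
Proof.
have := integrable_pow_exp_abs k; apply: le_integrable => //.
  by apply/measurable_EFinP; apply: measurable_funM; [exact: measurable_funX|exact: mexp].
move=> x _ /=; rewrite lee_fin [leRHS]ger0_norm; last by rewrite mulr_ge0 ?expR_ge0// exprn_ge0.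
rewrite normrM normrX (ger0_norm (expR_ge0 _)) ler_wpM2l ?exprn_ge0// ler_expR ler_wpM2l//.
exact: ler_norm.
Qed.

Lemma integrable_abs_pow_exp (k : nat) :
  P.-integrable setT (EFin \o (fun x => `|X x| ^+ k * expR (lam * X x))).
Proof.
have := integrable_pow_exp_abs k; apply: le_integrable => //.
  apply/measurable_EFinP; apply: measurable_funM; last exact: mexp.
  by apply: measurable_funX; exact: tame_meas (tame_norm _ tX).
have p0 (y z : R) : 0 <= `|y| ^+ k * expR z by rewrite mulr_ge0 ?expR_ge0// exprn_ge0.
move=> x _ /=; rewrite lee_fin (ger0_norm (p0 _ _)) (ger0_norm (p0 _ _)).
by rewrite ler_wpM2l ?exprn_ge0// ler_expR ler_wpM2l// ler_norm.
Qed.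

(** The exponential is expanded under the expectation, with |X|^j e^(lam |X|) as dominating
    function. Partial sums have at least two terms so that the moments of order 0 and 1, which
    Bernstein's condition does not cover, can be split off. *)
Lemma Ex_pow_exp_le (j : nat) (B : R) :
  (forall N, \sum_(0 <= k < N.+2) lam ^+ k / k`!%:R * E (fun x => X x ^+ (j + k)) <= B) ->
  E (fun x => X x ^+ j * expR (lam * X x)) <= B.
Proof.
move=> hB.
pose f N x := X x ^+ j * series (exp_coeff (lam * X x)) N.+2.
have tf N : tame P (f N).
  apply: tameM; first exact: tameX.
  by apply: tame_sum => k _; apply: tameM; [exact: tpow|exact: tame_cst].
have fB N : E (f N) <= B.
  apply: le_trans (hB N); rewrite le_eqVlt; apply/orP; left; apply/eqP.
  transitivity (E (fun x => \sum_(0 <= k < N.+2) (lam ^+ k / k`!%:R) * X x ^+ (j + k))).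
    apply: eq_Ex => x; rewrite /f /series/= mulr_sumr; apply: eq_bigr => k _.
    by rewrite /exp_coeff/= exprMn exprD; ring.
  rewrite Ex_sum; last by move=> k _; apply: tameM; [exact: tame_cst|exact: tameX].
  by apply: eq_bigr => k _; rewrite ExZl//; exact: tameX.
have [] := @dominated_convergence _ _ _ P setT measurableT (fun N x => (f N x)%:E)
  (fun x => (X x ^+ j * expR (lam * X x))%:E) (fun x => (`|X x| ^+ j * expR (lam * `|X x|))%:E).
- by move=> N; apply/measurable_EFinP; exact: tame_meas.
- apply/measurable_EFinP; apply: measurable_funM; [exact: measurable_funX|exact: mexp].
- apply: aeW => x _; apply: cvg_EFin; first by near=> N.
  apply: cvgMr; rewrite (_ : (fun N => _) = (fun N => series (exp_coeff (lam * X x)) (N + 2)%N)).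
    by rewrite cvg_shiftn; exact: is_cvg_series_exp_coeff.
  by apply/funext => N; rewrite addn2.
- exact: integrable_pow_exp_abs.
- apply: aeW => x N _; rewrite lee_fin /f normrM normrX ler_wpM2l ?exprn_ge0//.
  apply: (@le_trans _ _ (series (exp_coeff (lam * `|X x|)) N.+2)).
    rewrite (le_trans (ler_norm_sum _ _ _))//; apply: ler_sum => k _.
    rewrite /exp_coeff/= normrM normrX normrM (ger0_norm lam0) ler_wpM2l ?exprn_ge0 ?mulr_ge0//.
    by rewrite ger0_norm ?invr_ge0.
  have y0 : 0 <= lam * `|X x| by rewrite mulr_ge0.
  apply: nondecreasing_cvgn_le; last exact: is_cvg_series_exp_coeff.
  by apply/nondecreasing_seqP => k; rewrite /series/= big_nat_recr//= lerDl exp_coeff_ge0.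
move=> ig _ cv; rewrite -lee_fin /Ex /Rintegral fineK; last exact: integrable_fin_num ig.
rewrite -(cvg_lim _ cv)//; apply: lime_le; first by apply/cvg_ex; eexists; exact: cv.
apply: nearW => N; rewrite -[leLHS]fineK; last exact: integrable_fin_num (tame_int _ (tf N)).
by rewrite lee_fin; exact: fB.
Unshelve. all: by end_near. Qed.

End Tilted.
End ExponentialMoments.

Section ExponentialMomentBounds.
Context {d} {T : measurableType d} {R : realType} {P : probability T R}.
Variables (X : T -> R) (eps lam : R).
Hypothesis tX : tame P X.
Hypothesis eps0 : 0 < eps.
Local Notation E := (Ex P).
Local Notation s2 := (E (fun x => X x ^+ 2)).
Hypothesis EX : E X = 0.
Hypothesis bern : forall k, E (fun x => X x ^+ k.+2) <= (k.+2)`!%:R / 2 * eps ^+ k * s2.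
Hypothesis lam0 : 0 <= lam.
Hypothesis tau1 : lam * eps < 1.
Local Notation A j := (E (fun x => X x ^+ j * expR (lam * X x))).
Local Notation tau := (lam * eps).

Let tau0 : 0 <= tau. Proof. by rewrite mulr_ge0// ltW. Qed.
Let s20 : 0 <= s2. Proof. exact: moment2_ge0. Qed.
Let E0 : E (fun x => X x ^+ 0) = 1.
Proof. exact: Ex_cst. Qed.
Let E1 : E (fun x => X x ^+ 1) = 0.
Proof. exact: EX. Qed.
Let sqr_inv : (1 - tau)^-1 ^+ 1 = (1 - tau)^-1. Proof. exact: expr1. Qed.

Lemma exp_moment_ge1 : 1 <= A 0.
Proof.
have i0 := integrable_pow_exp X eps tX eps0 bern lam lam0 tau1 0.
have t1 : tame P (fun x => 1 + lam * X x).
  by apply: tameD; [exact: tame_cst|apply: tameM => //; exact: tame_cst].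
have : E (fun x => 1 + lam * X x) <= A 0.
  rewrite /Ex le_Rintegral//; first exact: tame_int.
  by move=> x _; rewrite expr0 mul1r expR_ge1Dx.
rewrite ExD; [|exact: tame_cst|by apply: tameM => //; exact: tame_cst].
by rewrite Ex_cst ExZl// EX mulr0 addr0.
Qed.

(** For odd [j] the product x^j (e^(lam x) - 1) is nonnegative for both signs of x. *)
Lemma exp_moment_odd_ge (j : nat) : odd j -> E (fun x => X x ^+ j) <= A j.
Proof.
move=> oj; have ij := integrable_pow_exp X eps tX eps0 bern lam lam0 tau1 j.
rewrite /Ex le_Rintegral//; first by apply: tame_int; exact: tameX.
move=> x _; have [x0|x0] := leP 0 (X x).
  rewrite ler_peMr ?exprn_ge0// -expR0 ler_expR mulr_ge0//.
apply: ler_niMr; first by rewrite exprn_odd_le0// ltW.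
by rewrite -expR0 ler_expR mulr_ge0_le0// ltW.
Qed.

Let term j k : (2 <= j + k)%N ->
  lam ^+ k / k`!%:R * E (fun x => X x ^+ (j + k)) <=
  lam ^+ k / k`!%:R * ((j + k)`!%:R / 2 * eps ^+ (j + k - 2) * s2).
Proof.
move=> jk; rewrite ler_wpM2l//; first by rewrite mulr_ge0 ?invr_ge0// exprn_ge0.
have := bern (j + k - 2); suff -> : (j + k - 2).+2 = (j + k)%N by [].
by rewrite -addn2 subnK.
Qed.

Lemma exp_moment0_le : A 0 <= 1 + lam ^+ 2 * s2 / 2 * (1 - tau)^-1.
Proof.
apply: (Ex_pow_exp_le X eps tX eps0 bern lam lam0 tau1) => N.
rewrite !big_nat_recl//= !add0n expr0 fact0 divr1 mul1r E0 E1 mulr0 add0r lerD2l.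
have := bin_series_le tau 0 N tau0 tau1; rewrite sqr_inv.
have l0 : 0 <= lam ^+ 2 * s2 / 2 by rewrite mulr_ge0// mulr_ge0// sqr_ge0.
move/(ler_wpM2l l0); apply: le_trans; rewrite mulr_sumr; apply: ler_sum => k _.
have := @term 0%N k.+2 erefl; rewrite !add0n => /le_trans; apply.
rewrite addn0 bin0 mul1r subn2/= exprMn -addn2 exprD le_eqVlt; apply/orP; left; apply/eqP.
have : (k + 2)`!%:R != 0 :> R by rewrite pnatr_eq0 -lt0n fact_gt0.
by move: (_`!%:R) (E _) (eps ^+ k) (lam ^+ k) => u1 u2 u3 u4 h; field.
Qed.

(** The coefficient of tau^k is k + 2 = (k + 1) + 1, whence two binomial series. The bound is the
    lam-derivative of the one in [exp_moment0_le]. *)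
Lemma exp_moment1_le : A 1 <= lam * s2 / 2 * ((1 - tau)^-1 ^+ 2 + (1 - tau)^-1).
Proof.
apply: (Ex_pow_exp_le X eps tX eps0 bern lam lam0 tau1) => N.
rewrite big_nat_recl//= addn0 E1 mulr0 add0r.
have h0 := bin_series_le tau 0 N.+1 tau0 tau1; rewrite sqr_inv in h0.
have h1 := bin_series_le tau 1 N.+1 tau0 tau1.
have l0 : 0 <= lam * s2 / 2 by rewrite mulr_ge0// mulr_ge0.
apply: le_trans (ler_wpM2l l0 (lerD h1 h0)); rewrite -big_split/= mulr_sumr.
apply: ler_sum => k _; have := @term 1%N k.+1 erefl; move/le_trans; apply.
rewrite !add1n subn2/= addn0 bin0 addn1 bin1 mul1r factS factS natrM exprS exprMn.
have : k.+1`!%:R != 0 :> R by rewrite pnatr_eq0 -lt0n fact_gt0.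
rewrite factS natrM mulf_eq0 negb_or => /andP[h2 h3].
rewrite le_eqVlt; apply/orP; left; apply/eqP.
rewrite !natrM -[k.+2%:R]natr1 -[k.+1%:R]natr1 in h2 *.
by move: (_`!%:R) (E _) (eps ^+ k) (lam ^+ k) (k%:R) h2 h3 => u1 u2 u3 u4 u5 h2 h3; field; rewrite h2 h3.
Qed.

Lemma exp_moment2_le : A 2 <= s2 * (1 - tau)^-1 ^+ 3.
Proof.
apply: (Ex_pow_exp_le X eps tX eps0 bern lam lam0 tau1) => N.
have h1 := bin_series_le tau 2 N.+2 tau0 tau1.
apply: le_trans (ler_wpM2l s20 h1); rewrite mulr_sumr; apply: ler_sum => k _.
have := @term 2%N k erefl; move/le_trans; apply.
rewrite !addKn le_eqVlt; apply/orP; left; apply/eqP.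
have := bin_fact (leq_addl k 2); rewrite addnK => e.
rewrite addnC -e mulnA !natrM exprMn.
have : k`!%:R != 0 :> R by rewrite pnatr_eq0 -lt0n fact_gt0.
by move: (k`!%:R) (E _) (eps ^+ k) (lam ^+ k) ('C(_, _)%:R) => u1 u2 u3 u4 u5 h2; field.
Qed.

(** Here (k + 4)! / (2 k!) is 12 times a binomial coefficient. *)
Lemma exp_moment4_le : A 4 <= 12 * eps ^+ 2 * s2 * (1 - tau)^-1 ^+ 5.
Proof.
apply: (Ex_pow_exp_le X eps tX eps0 bern lam lam0 tau1) => N.
have h1 := bin_series_le tau 4 N.+2 tau0 tau1.
have l0 : 0 <= 12 * eps ^+ 2 * s2 by rewrite mulr_ge0// mulr_ge0// sqr_ge0.
apply: le_trans (ler_wpM2l l0 h1); rewrite mulr_sumr; apply: ler_sum => k _.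
have := @term 4%N k erefl; move/le_trans; apply.
rewrite (_ : (4 + k - 2 = 2 + k)%N)//.
rewrite le_eqVlt; apply/orP; left; apply/eqP.
have := bin_fact (leq_addl k 4); rewrite addnK => e.
rewrite [(4 + k)%N]addnC -e mulnA !natrM exprMn exprD.
have : k`!%:R != 0 :> R by rewrite pnatr_eq0 -lt0n fact_gt0.
by move: (k`!%:R) (E _) (eps ^+ k) (lam ^+ k) ('C(_, _)%:R) => u1 u2 u3 u4 u5 h2; field.
Qed.

End ExponentialMomentBounds.

Lemma Ex_quartic {d} {T : measurableType d} {R : realType} {P : probability T R}
  (X : T -> R) (a b c e f : R) : tame P X ->
  Ex P (fun x => a * X x ^+ 4 + b * X x ^+ 3 + c * X x ^+ 2 + e * X x + f) =
  a * Ex P (fun x => X x ^+ 4) + b * Ex P (fun x => X x ^+ 3) +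
  c * Ex P (fun x => X x ^+ 2) + e * Ex P X + f.
Proof.
move=> tX; have tZ g k : tame P (fun x => g * X x ^+ k).
  by apply: tameM; [exact: tame_cst|exact: tameX].
have t1 : tame P (fun x => e * X x) by apply: tameM => //; exact: tame_cst.
have tk k : tame P (fun x => X x ^+ k) by exact: tameX.
have t2 := tameD _ _ (tZ a 4%N) (tZ b 3%N).
have t3 := tameD _ _ t2 (tZ c 2%N).
have t4 := tameD _ _ t3 t1.
rewrite (ExD _ _ t4 (tame_cst f)) (ExD _ _ t3 t1) (ExD _ _ t2 (tZ c 2%N)).
by rewrite (ExD _ _ (tZ a 4%N) (tZ b 3%N)) Ex_cst !ExZl.
Qed.

Lemma Ex_le_int {d} {T : measurableType d} {R : realType} {P : probability T R} (f g : T -> R) :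
  P.-integrable setT (EFin \o f) -> P.-integrable setT (EFin \o g) ->
  (forall x, f x <= g x) -> Ex P f <= Ex P g.
Proof. by move=> hf hg fg; apply: le_Rintegral. Qed.

(** * One summand under a law that tilts its distribution *)

Section OneVariableTilt.
Context {d} {T : measurableType d} {R : realType} {P Q : probability T R}.
Variables (X : T -> R) (eps lam t : R).
Hypothesis tX : tame P X.
Hypothesis eps0 : 0 < eps.
Local Notation E := (Ex P).
Local Notation EQ := (Ex Q).
Local Notation s2 := (E (fun x => X x ^+ 2)).
Hypothesis EX : E X = 0.
Hypothesis bern : forall k, E (fun x => X x ^+ k.+2) <= (k.+2)`!%:R / 2 * eps ^+ k * s2.
Hypothesis bern3 : - (3 * eps * s2) <= E (fun x => X x ^+ 3).
Hypothesis lam0 : 0 <= lam.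
Local Notation tau := (lam * eps).
Hypothesis tau_t : tau <= t.
Hypothesis t3 : t < 1 / 3.
Hypothesis drift : tau / 2 * ((1 - tau)^-1 ^+ 2 + (1 - tau)^-1) <= t.
Local Notation A j := (E (fun x => X x ^+ j * expR (lam * X x))).
Local Notation e := (A 0).
Hypothesis tiltQ : forall f : R -> R, measurable_fun setT f ->
  P.-integrable setT (EFin \o (fun x => f (X x) * expR (lam * X x))) ->
  Q.-integrable setT (EFin \o (fun x => f (X x))) /\
  EQ (fun x => f (X x)) = E (fun x => f (X x) * expR (lam * X x)) / e.

Let tau1 : tau < 1. Proof. by have := tau_t; have := t3; lra. Qed.
Let mX := tame_meas _ tX.
Let ip := integrable_pow_exp X eps tX eps0 bern lam lam0 tau1.
Let e1 : 1 <= e. Proof. exact: (exp_moment_ge1 X eps). Qed.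
Let e0 : 0 < e. Proof. exact: lt_le_trans e1. Qed.
Let s20 : 0 <= s2. Proof. exact: moment2_ge0. Qed.

Lemma tilt_tame : tame Q X.
Proof.
split => // k; have [] := tiltQ (fun y => `|y| ^+ k).
- by apply: measurable_funX; exact: normr_measurable.
- exact: (integrable_abs_pow_exp X eps).
- by [].
Qed.

Let tQ := tilt_tame.

Lemma tilt_moment j : EQ (fun x => X x ^+ j) * e = A j.
Proof.
have mp : measurable_fun setT (fun y : R => y ^+ j) by exact: measurable_funX.
have [_ ->] := tiltQ _ mp (ip j); by rewrite divfK// gt_eqF.
Qed.

Let q1 := EQ X.
Let q2 := EQ (fun x => X x ^+ 2).
Let q3 := EQ (fun x => X x ^+ 3).
Let q4 := EQ (fun x => X x ^+ 4).

Lemma tilt_mean_ge0 : 0 <= q1.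
Proof.
have h := tilt_moment 1; rewrite -(pmulr_lge0 _ e0) h.
by have := exp_moment_odd_ge X eps lam tX eps0 bern lam0 tau1 1 erefl; rewrite EX.
Qed.

(** As the mean is nonnegative and the normalisation [e] is at least 1, the normalisation may be
    dropped; [drift] bounds what remains. *)
Lemma tilt_mean_le : q1 <= s2 * t / eps.
Proof.
have h := tilt_moment 1; apply: (@le_trans _ _ (A 1)).
  by rewrite -h ler_peMr// tilt_mean_ge0.
apply: le_trans (exp_moment1_le X eps lam tX eps0 EX bern lam0 tau1) _.
rewrite ler_pdivlMr//; have := ler_wpM2l s20 drift.
by move: (_ + _) s2 => u v; lra.
Qed.

(** Nonnegativity of the variance of X^2 gives s2^2 <= E X^4, and Bernstein's condition at order 4
    gives E X^4 <= 12 eps^2 s2. *)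
Lemma moment2_le : s2 <= 12 * eps ^+ 2.
Proof.
have t2 : tame P (fun x => X x ^+ 2) by exact: tameX.
have : 0 <= E (fun x => 1 * X x ^+ 4 + 0 * X x ^+ 3 + (- (2 * s2)) * X x ^+ 2 + 0 * X x + s2 ^+ 2).
  apply: Ex_ge0 => x; apply: le_trans (sqr_ge0 (X x ^+ 2 - s2)) _.
  by rewrite le_eqVlt; apply/orP; left; apply/eqP; move: s2 => u; ring.
rewrite Ex_quartic// EX; have := bern 2; rewrite (_ : 4`!%:R / 2 = 12 :> R); last first.
  by rewrite (_ : 4`! = 24)%N//; field.
move=> h4 h; have [->|s2n] := eqVneq s2 0; first by rewrite mulr_ge0// sqr_ge0.
have sp : 0 < s2 by rewrite lt_neqAle eq_sym s2n s20.
rewrite -(ler_pM2r sp); move: h4 h; move: s2 (E _) (E _) => u1 u2 u3; lra.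
Qed.

Lemma norm_const_le : e <= 1 + 6 * tau ^+ 2 / (1 - tau).
Proof.
have d0 : 0 < 1 - tau by rewrite subr_gt0.
apply: le_trans (exp_moment0_le X eps lam tX eps0 EX bern lam0 tau1) _.
rewrite lerD2l ler_wpM2r ?invr_ge0 ?(ltW d0)//.
have := ler_wpM2l (sqr_ge0 lam) moment2_le; rewrite exprMn.
by move: (lam ^+ 2) (eps ^+ 2) s2 => u v w; lra.
Qed.

Let quad_int a b c : P.-integrable setT
  (EFin \o (fun x => (a * X x ^+ 2 + b * X x + c) * expR (lam * X x))).
Proof.
have h2 := integrableZl measurableT a (ip 2).
have h1 := integrableZl measurableT b (ip 1).
have h0 := integrableZl measurableT c (ip 0).
apply: eq_integrable (integrableD measurableT (integrableD measurableT h2 h1) h0) => //.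
by move=> x _ /=; rewrite -!EFinM -!EFinD; congr EFin; rewrite expr0 expr1; ring.
Qed.

Let mquad (a b c : R) : measurable_fun setT (fun y : R => a * y ^+ 2 + b * y + c).
Proof.
apply: measurable_funD; last exact: measurable_cst.
apply: measurable_funD; apply: measurable_funM; try exact: measurable_cst.
  exact: measurable_funX.
exact: measurable_id.
Qed.

Let quad_eq a b c : E (fun x => (a * X x ^+ 2 + b * X x + c) * expR (lam * X x)) =
  e * (a * q2 + b * q1 + c).
Proof.
have [_ h] := tiltQ (fun y => a * y ^+ 2 + b * y + c) (mquad a b c) (quad_int a b c).
have h' : EQ (fun x => a * X x ^+ 2 + b * X x + c) = a * q2 + b * q1 + c.
  transitivity (EQ (fun x => 0 * X x ^+ 4 + 0 * X x ^+ 3 + a * X x ^+ 2 + b * X x + c)).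
    by apply: eq_Ex => x; ring.
  by rewrite Ex_quartic// -/q2 -/q1; ring.
by rewrite -h' h mulrC divfK// gt_eqF.
Qed.

(* With X' an independent copy of X, e^2 Var_Q X = E (X - X')^2 e^(lam (X + X')) / 2, and
   e^u >= 1 + u; shift_ineq is the inner integral at X' = y. *)
Let shift_ineq (y : R) : s2 + y ^+ 2 + lam * (E (fun x => X x ^+ 3) - y * s2 + y ^+ 3) <=
  e * (q2 - 2 * y * q1 + y ^+ 2) * expR (lam * y).
Proof.
have -> : e * (q2 - 2 * y * q1 + y ^+ 2) * expR (lam * y) =
  E (fun x => ((expR (lam * y)) * X x ^+ 2 + (- (2 * y) * expR (lam * y)) * X x +
               y ^+ 2 * expR (lam * y)) * expR (lam * X x)).
  by rewrite quad_eq; ring.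
have -> : s2 + y ^+ 2 + lam * (E (fun x => X x ^+ 3) - y * s2 + y ^+ 3) =
  E (fun x => 0 * X x ^+ 4 + lam * X x ^+ 3 + (1 - lam * y) * X x ^+ 2 +
     (- (2 * y) - lam * y ^+ 2) * X x + (y ^+ 2 + lam * y ^+ 3)).
  by rewrite Ex_quartic// EX; ring.
apply: Ex_le_int; [|exact: quad_int|].
  apply: tame_int; apply: tameD; last exact: tame_cst.
  by repeat (apply: tameD); apply: tameM => //; try exact: tame_cst; exact: tameX.
move=> x; have h := expR_ge1Dx (lam * X x + lam * y); rewrite expRD in h.
have := ler_wpM2l (sqr_ge0 (X x - y)) h; move: (expR _) (expR _) => u v; lra.
Qed.

(** Taking y = X in [shift_ineq] and integrating gives s2 + lam E X^3 <= e^2 Var_Q X; the lower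
    bound on the third moment produces 3 tau. *)
Lemma tilt_var_ge : s2 * (1 - 3 * tau) <= e ^+ 2 * (q2 - q1 ^+ 2).
Proof.
pose m3 := E (fun x => X x ^+ 3).
have H : E (fun x => 0 * X x ^+ 4 + lam * X x ^+ 3 + 1 * X x ^+ 2 + (- (lam * s2)) * X x + (s2 + lam * m3)) <=
   E (fun x => (e * X x ^+ 2 + (- (2 * e * q1)) * X x + e * q2) * expR (lam * X x)).
  apply: Ex_le_int; [|exact: quad_int|].
    apply: tame_int; apply: tameD; last exact: tame_cst.
    by repeat (apply: tameD); apply: tameM => //; try exact: tame_cst; exact: tameX.
  move=> x; have := shift_ineq (X x); rewrite -/m3.
  by move: (expR _) m3 s2 e q1 q2 => u u1 u2 u3 u4 u5; lra.
rewrite quad_eq Ex_quartic// EX -/m3 in H.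
have h3 : lam * (- (3 * eps * s2)) <= lam * m3 by rewrite ler_wpM2l.
by move: H h3; rewrite -/m3; move: m3 s2 e q1 q2 => u1 u2 u3 u4 u5; nra.
Qed.

Lemma tilt_moment3_ge : - (3 * eps * s2) <= q3.
Proof.
have h := exp_moment_odd_ge X eps lam tX eps0 bern lam0 tau1 3 erefl.
have b0 : 0 <= 3 * eps * s2 by rewrite mulr_ge0// mulr_ge0// ltW.
have h' : - (3 * eps * s2) <= q3 * e by rewrite tilt_moment; exact: le_trans h.
have [q30|q30] := leP 0 q3; first by rewrite (le_trans _ q30)// oppr_le0.
by apply: le_trans h' _; apply: ler_neMr => //; exact: ltW.
Qed.

Lemma tilt_variance : EQ (fun x => (X x - q1) ^+ 2) = q2 - q1 ^+ 2.
Proof.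
transitivity (EQ (fun x => 0 * X x ^+ 4 + 0 * X x ^+ 3 + 1 * X x ^+ 2 + (- (2 * q1)) * X x + q1 ^+ 2)).
  by apply: eq_Ex => x; move: q1 => u; ring.
by rewrite Ex_quartic// -/q1 -/q2; ring.
Qed.

Lemma tilt_variance_ge : s2 * (1 - 3 * tau) <=
  (1 + 6 * tau ^+ 2 / (1 - tau)) ^+ 2 * EQ (fun x => (X x - q1) ^+ 2).
Proof.
apply: le_trans tilt_var_ge _; rewrite -tilt_variance ler_wpM2r//.
  by apply: Ex_ge0 => x; rewrite sqr_ge0.
rewrite ler_sqr ?nnegrE ?(ltW e0)//; first exact: norm_const_le.
exact: le_trans (ltW e0) norm_const_le.
Qed.

Lemma tilt_mean_le12 : q1 <= 12 * eps * t.
Proof.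
apply: le_trans tilt_mean_le _; rewrite ler_pdivrMr//.
have t0 : 0 <= t by apply: le_trans tau_t; rewrite mulr_ge0// ltW.
by have := ler_wpM2r t0 moment2_le; move: s2 => u; lra.
Qed.

(** The central moment is expanded and -3 q1^4 dropped. With q1 <= 12 eps t and q3 >= -3 eps s2, the
    two mixed terms have the constants 4 * 12 * 3 = 12 * 12 and 6 * 12^2 = 12 * 72. *)
Lemma tilt_moment4_le : EQ (fun x => (X x - q1) ^+ 4) <=
  12 * eps ^+ 2 * s2 * ((1 - tau)^-1 ^+ 5 + 12 * t + 72 * t ^+ 2 * (1 - tau)^-1 ^+ 3).
Proof.
have -> : EQ (fun x => (X x - q1) ^+ 4) = q4 - 4 * q1 * q3 + 6 * q1 ^+ 2 * q2 - 3 * q1 ^+ 4.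
  transitivity (EQ (fun x => 1 * X x ^+ 4 + (- (4 * q1)) * X x ^+ 3 +
    (6 * q1 ^+ 2) * X x ^+ 2 + (- (4 * q1 ^+ 3)) * X x + q1 ^+ 4)).
    by apply: eq_Ex => x; move: q1 => u; ring.
  by rewrite Ex_quartic// -/q1 -/q2 -/q3 -/q4; ring.
have m0 := tilt_mean_ge0; have m12 := tilt_mean_le12.
have t0 : 0 <= t by apply: le_trans tau_t; rewrite mulr_ge0// ltW.
have h4 : q4 <= 12 * eps ^+ 2 * s2 * (1 - tau)^-1 ^+ 5.
  apply: le_trans (exp_moment4_le X eps lam tX eps0 bern lam0 tau1).
  rewrite -tilt_moment ler_peMr//; apply: Ex_ge0 => x.
  by rewrite (exprM _ 2 2) sqr_ge0.
have h2 : q2 <= s2 * (1 - tau)^-1 ^+ 3.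
  apply: le_trans (exp_moment2_le X eps lam tX eps0 bern lam0 tau1).
  by rewrite -tilt_moment ler_peMr//; apply: Ex_ge0 => x; rewrite sqr_ge0.
have h3 : 4 * q1 * - q3 <= 4 * (12 * eps * t) * (3 * eps * s2).
  apply: le_trans (_ : 4 * q1 * (3 * eps * s2) <= _).
    by rewrite ler_wpM2l ?mulr_ge0// lerNl tilt_moment3_ge.
  by rewrite ler_wpM2r ?mulr_ge0 ?(ltW eps0)// ler_wpM2l.
have h1 : q1 ^+ 2 * q2 <= (12 * eps * t) ^+ 2 * (s2 * (1 - tau)^-1 ^+ 3).
  apply: ler_pM => //; first exact: sqr_ge0.
    by apply: Ex_ge0 => x; rewrite sqr_ge0.
  by rewrite ler_sqr ?nnegrE// (le_trans m0).
have h5 : 0 <= q1 ^+ 4 by rewrite exprn_ge0.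
move: h1 h2 h3 h4 h5.
by move: (_ ^-1 ^+ 5) (_^-1 ^+ 3) s2 q1 q2 q3 q4 (q1 ^+ 4) => u1 u2 u3 u4 u5 u6 u7 u8; lra.
Qed.

End OneVariableTilt.

Lemma Ex_indic {d} {T : measurableType d} {R : realType} (P : probability T R) (A : set T) :
  measurable A -> Ex P (\1_A) = fine (P A).
Proof. by move=> mA; rewrite /Ex /Rintegral integral_indic// setIT. Qed.

(** * The tilted sum *)

Section JointTilt.
Context {d} {T : measurableType d} {R : realType} {P : probability T R}.
Context {n : nat} (X : 'I_n -> T -> R) (lam : R).
Hypothesis mX : forall i, measurable_fun setT (X i).
Hypothesis iX : mutually_independent P X.
Local Notation A i := (Ex P (fun x => X i x ^+ 0 * expR (lam * X i x))).
Hypothesis A0 : forall i, 0 < A i.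
Hypothesis iA : forall i, P.-integrable setT (EFin \o (fun x => X i x ^+ 0 * expR (lam * X i x))).
Local Notation S x := (\sum_i X i x).

Let g i (y : R) : R := expR (lam * y) / A i.
Let w x := \prod_(k in [set: 'I_n]%SET) g k (X k x).

Let mexp : measurable_fun setT (fun y : R => expR (lam * y)).
Proof.
apply: measurableT_comp; first exact: measurable_expR.
by apply: measurable_funM; [exact: measurable_cst|exact: measurable_id].
Qed.

Let mg i : measurable_fun setT (g i).
Proof. by apply: measurable_funM; [exact: mexp|exact: measurable_cst]. Qed.

Let ig_gen i (f : R -> R) : P.-integrable setT (EFin \o (fun x => f (X i x) * expR (lam * X i x))) ->
  P.-integrable setT (EFin \o (fun x => f (X i x) * g i (X i x))).
Proof.
move=> h; have := integrableZl measurableT (A i)^-1 h; apply: eq_integrable => // x _ /=.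
by rewrite -EFinM; congr EFin; rewrite /g; ring.
Qed.

Let Eg i (f : R -> R) : P.-integrable setT (EFin \o (fun x => f (X i x) * expR (lam * X i x))) ->
  Ex P (fun x => f (X i x) * g i (X i x)) = Ex P (fun x => f (X i x) * expR (lam * X i x)) / A i.
Proof.
move=> h; rewrite mulrC.
transitivity (Ex P (fun x => (A i)^-1 * (f (X i x) * expR (lam * X i x)))).
  by apply: eq_Ex => x; rewrite /g; ring.
exact: RintegralZl.
Qed.

Let iexp i : P.-integrable setT (EFin \o (fun x => 1 * expR (lam * X i x))).
Proof. by have := iA i; apply: eq_integrable => // x _ /=; rewrite expr0. Qed.

Let AE i : A i = Ex P (fun x => 1 * expR (lam * X i x)).
Proof. by apply: eq_Ex => x; rewrite expr0. Qed.

Let ig i : P.-integrable setT (EFin \o (g i \o X i)).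
Proof. by have := ig_gen i (fun=> 1) (iexp i); apply: eq_integrable => // x _ /=; rewrite mul1r. Qed.

Let Eg1 i : Ex P (g i \o X i) = 1.
Proof.
transitivity (Ex P (fun x => 1 * g i (X i x))); first by apply: eq_Ex => x; rewrite mul1r.
by rewrite (Eg i (fun=> 1))// -AE divff// gt_eqF.
Qed.

Lemma prod_exp x : w x = expR (lam * S x) / \prod_i A i.
Proof.
rewrite /w /g; under eq_bigl do rewrite finset.in_setT.
by rewrite big_split/= prodfV -expR_sum mulr_sumr.
Qed.

(** The density is a product of functions of the single variables. Multiplying each factor by an
    indicator or by a function of one variable keeps this form, so [Ex_prod] yields both the
    independence and the marginal laws under [Q]. *)
Lemma joint_tilt : exists Q : probability T R,
  [/\ mutually_independent Q X,
      (forall i (f : R -> R), measurable_fun setT f ->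
        P.-integrable setT (EFin \o (fun x => f (X i x) * expR (lam * X i x))) ->
        Q.-integrable setT (EFin \o (fun x => f (X i x))) /\
        Ex Q (fun x => f (X i x)) = Ex P (fun x => f (X i x) * expR (lam * X i x)) / A i) &
      forall y : R, fine (P [set x | y < S x]) =
        (\prod_i A i) * Ex Q (fun x => (y < S x)%R%:R * expR (- lam * S x))].
Proof.
have [iw Ew] := Ex_prod X mX iX g mg ig [set: 'I_n]%SET.
have w0 x : 0 <= w x.
  by rewrite /w prodr_ge0// => k _; rewrite mulr_ge0 ?expR_ge0// invr_ge0 ltW.
have Ew1 : Ex P w = 1 by rewrite /w Ew big1.
have [Q [QE Qint]] := tilt_exists P w w0 iw Ew1.
have mS : measurable_fun setT (fun x => S x) by exact: measurable_sum.
have mw : measurable_fun setT w by apply/measurable_EFinP; exact: measurable_int iw.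
have single i (f : R -> R) : measurable_fun setT f ->
    P.-integrable setT (EFin \o (fun x => f (X i x) * expR (lam * X i x))) ->
    Q.-integrable setT (EFin \o (fun x => f (X i x))) /\
    Ex Q (fun x => f (X i x)) = Ex P (fun x => f (X i x) * expR (lam * X i x)) / A i.
  move=> mf hf.
  pose g' k y := if k == i then f y * g k y else g k y.
  have mg' k : measurable_fun setT (g' k).
    by rewrite /g'; case: (k == i) => //; exact: measurable_funM.
  have ig' k : P.-integrable setT (EFin \o (g' k \o X k)).
    by rewrite /g'; case: eqVneq => [->|_]; [exact: ig_gen|exact: ig].
  have [iw' Ew'] := Ex_prod X mX iX g' mg' ig' [set: 'I_n]%SET.
  have wE x : \prod_(k in [set: 'I_n]%SET) g' k (X k x) = f (X i x) * w x.
    rewrite (bigD1 i)/= ?finset.in_setT// /w [in RHS](bigD1 i)/= ?finset.in_setT// mulrA.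
    rewrite {1}/g' eqxx; congr (_ * _).
    by apply: eq_bigr => k /andP[_ ki]; rewrite /g' (negbTE ki).
  have [||Q1 Q2] := Qint (fun x => f (X i x)).
  - exact: measurableT_comp mf (mX i).
  - by apply: eq_integrable iw' => // x _ /=; rewrite wE.
  split => //; rewrite Q2 -(eq_Ex _ _ wE) Ew' (bigD1 i)/= ?finset.in_setT//.
  rewrite -(Eg i f hf) big1 ?mulr1; last first.
    by move=> k /andP[_ ki]; rewrite /g' (negbTE ki) Eg1.
  by rewrite /g' eqxx.
exists Q; split => //.
- move=> B mB.
  pose g' k y := \1_(B k) y * g k y.
  have mI k : measurable_fun setT (\1_(B k) : R -> R) by exact: measurable_indic.
  have mg' k : measurable_fun setT (g' k) by exact: measurable_funM.
  have iI k : P.-integrable setT (EFin \o (fun x => \1_(B k) (X k x) * expR (lam * X k x))).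
    apply: le_integrable (iexp k) => //.
      apply/measurable_EFinP; apply: measurable_funM; first exact: measurableT_comp (mI k) (mX k).
      exact: measurableT_comp mexp (mX k).
    move=> x _ /=; rewrite lee_fin mul1r normrM ler_piMl// indicE.
    by case: (_ \in _); rewrite /= ?normr1 ?normr0.
  have ig' k : P.-integrable setT (EFin \o (g' k \o X k)) by exact: ig_gen.
  have [iw' Ew'] := Ex_prod X mX iX g' mg' ig' [set: 'I_n]%SET.
  have mXB k : measurable (X k @^-1` B k) by rewrite -[_ @^-1` _]setTI; exact: mX.
  have mI' : measurable (\bigcap_(j in [set: 'I_n]) (X j @^-1` B j)).
    by apply: fin_bigcap_measurable => //; exact: finite_finset.
  have wE x : \prod_(k in [set: 'I_n]%SET) g' k (X k x) =
     \1_(\bigcap_(j in [set: 'I_n]) (X j @^-1` B j)) x * w x.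
    rewrite /g' big_split/=; congr (_ * _).
    rewrite indicE; case: (boolP (x \in _)) => /=.
      by rewrite inE => h; rewrite big1// => k _; rewrite indicE mem_set//; exact: h.
    move=> /negP h; apply/eqP/prodf_eq0.
    apply: contrapT => hn; apply: h; rewrite inE => k _ /=; apply: contrapT => hB.
    by apply: hn; exists k; rewrite ?finset.in_setT// indicE memNset.
  have [||Q1 Q2] := Qint (\1_(\bigcap_(j in [set: 'I_n]) (X j @^-1` B j))).
  - exact: measurable_indic.
  - by apply: eq_integrable iw' => // x _ /=; rewrite wE.
  rewrite Ex_indic// in Q2.
  rewrite -[LHS]fineK ?fin_num_measure// Q2 -(eq_Ex _ _ wE) Ew'.
  under eq_bigl do rewrite finset.in_setT.
  rewrite -prodEFin; apply: eq_bigr => k _.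
  rewrite -[RHS]fineK ?fin_num_measure// -Ex_indic//; congr EFin.
  have [_ h] := single k _ (mI k) (iI k).
  by rewrite [RHS]h -(Eg k (\1_(B k)))//.
- move=> y.
  have mind : measurable_fun setT (fun x => (y < S x)%R%:R : R).
    exact: measurableT_comp (measurable_gt_ind y) mS.
  have mSet : measurable [set x | y < S x].
    rewrite (_ : [set x | y < S x] = (fun x => S x) @^-1` `]y, +oo[%classic).
      by rewrite -[_ @^-1` _]setTI; exact: mS.
    by apply/seteqP; split => x /=; rewrite in_itv/= andbT.
  rewrite -Ex_indic//.
  have Z0 : \prod_i A i != 0 by apply/prodf_neq0 => i _; rewrite gt_eqF.
  pose f x := (y < S x)%R%:R * expR (- lam * S x).
  have fw x : f x * w x = (\prod_i A i)^-1 * \1_([set x | y < S x]) x.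
    rewrite prod_exp /f indicE.
    have -> : (x \in [set x | y < S x]) = (y < S x) by apply/idP/idP; rewrite inE.
    have e : expR (- lam * S x) * expR (lam * S x) = 1 by rewrite -expRD mulNr addNr expR0.
    transitivity ((y < S x)%R%:R * (expR (- lam * S x) * expR (lam * S x)) / \prod_i A i); first ring.
    by rewrite e mulr1 mulrC.
  have mf : measurable_fun setT f.
    apply: measurable_funM => //; apply: measurableT_comp; first exact: measurable_expR.
    by apply: measurable_funM; [exact: measurable_cst|].
  have tI : tame P (\1_([set x | y < S x]) : T -> R).
    apply: (tame_bounded _ 1); first exact: measurable_indic.
    by move=> x; rewrite indicE; case: (_ \in _); rewrite /= ?normr1 ?normr0.
  have [||_ ->] := Qint f => //.
    have := tame_int _ (tameM _ _ (tame_cst (\prod_i A i)^-1) tI).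
    by apply: eq_integrable => // x _ /=; rewrite fw.
  by rewrite (eq_Ex _ _ fw) ExZl// mulrA divff// mul1r.
Qed.

End JointTilt.

Section TailBound.
Context {d} {T : measurableType d} {R : realType} {P : probability T R}.
Context {n : nat} (X : 'I_n -> T -> R) (eps sigma lam t : R).
Hypothesis tX : forall i, tame P (X i).
Hypothesis iX : mutually_independent P X.
Local Notation E := (Ex P).
Local Notation s2 i := (E (fun x => X i x ^+ 2)).
Hypothesis EX : forall i, E (X i) = 0.
Hypothesis eps0 : 0 < eps.
Hypothesis bern : forall i k, E (fun x => X i x ^+ k.+2) <= (k.+2)`!%:R / 2 * eps ^+ k * s2 i.
Hypothesis bern3 : forall i, - (3 * eps * s2 i) <= E (fun x => X i x ^+ 3).
Hypothesis sigma0 : 0 < sigma.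
Hypothesis sigmaE : sigma ^+ 2 = \sum_i s2 i.
Hypothesis lam0 : 0 <= lam.
Local Notation tau := (lam * eps).
Hypothesis tau1 : tau < 1.
Local Notation A i := (E (fun x => X i x ^+ 0 * expR (lam * X i x))).
Local Notation S x := (\sum_i X i x).
Local Notation Z := (\prod_i A i).

Let mX i := tame_meas _ (tX i).
Let iA i := integrable_pow_exp (X i) eps (tX i) eps0 (bern i) lam lam0 tau1 0.
Let A1 i : 1 <= A i.
Proof. exact: (exp_moment_ge1 (X i) eps). Qed.
Let A0 i : 0 < A i. Proof. exact: lt_le_trans (A1 i). Qed.

Let mS : measurable_fun setT (fun x => S x).
Proof. exact: measurable_sum. Qed.

(** On the event, e^(-lam S) is at most e^(-lam y). This bound holds without any restriction on t
    and settles t >= 1/3. *)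
Lemma tail_le_exp (y : R) : fine (P [set x | y < S x]) <= Z * expR (- lam * y).
Proof.
have [Q [_ _ ->]] := joint_tilt X lam mX iX A0 iA.
rewrite ler_wpM2l//; first by rewrite prodr_ge0// => i _; exact: ltW.
have hb x : (y < S x)%R%:R * expR (- lam * S x) <= expR (- lam * y).
  case: (boolP (y < S x)) => h; last by rewrite mul0r expR_ge0.
  by rewrite mul1r ler_expR !mulNr lerN2 ler_wpM2l// ltW.
rewrite -[leRHS](@Ex_cst _ _ _ Q); apply: Ex_le => //; last exact: tame_cst.
apply: (tame_bounded _ (expR (- lam * y))).
  apply: measurable_funM; first exact: measurableT_comp (measurable_gt_ind y) mS.
  by apply: measurableT_comp; [exact: measurable_expR|apply: measurable_funM; [exact: measurable_cst|exact: mS]].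
by move=> x; rewrite ger0_norm// mulr_ge0 ?expR_ge0.
Qed.

Hypothesis tau_t : tau <= t.
Hypothesis t3 : t < 1 / 3.
Hypothesis drift : tau / 2 * ((1 - tau)^-1 ^+ 2 + (1 - tau)^-1) <= t.
Variables (l K1 : R).
Hypothesis l0 : 0 < l.
Hypothesis lE : l * (1 + 6 * tau ^+ 2 / (1 - tau)) ^+ 2 <= 1 - 3 * tau.
Hypothesis K0 : 0 < K1.
Hypothesis KE : 12 * ((1 - tau)^-1 ^+ 5 + 12 * t + 72 * t ^+ 2 * (1 - tau)^-1 ^+ 3) <= K1 ^+ 2.

(** [l] bounds below the ratio of tilted to original variances, and K1^2 bounds the tilted fourth
    central moments in units of eps^2 E X^2. The threshold is written through [t] so that it is the
    bound for the tilted mean. *)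
Lemma tail_le_tilted : fine (P [set x | sigma ^+ 2 * t / eps < S x]) <=
  Z * expR (- lam * (sigma ^+ 2 * t / eps)) *
  (Mills (lam * (sigma * Num.sqrt l)) + 7 * (eps / sigma * K1 / l)).
Proof.
set y := sigma ^+ 2 * t / eps.
have [Q [iQ Qf ->]] := joint_tilt X lam mX iX A0 iA.
pose m i := Ex Q (X i); pose v i := Ex Q (fun x => (X i x - m i) ^+ 2).
have tQ i : tame Q (X i).
  exact: (tilt_tame (X i) eps lam t (tX i) eps0 (bern i) lam0 tau_t t3 (Qf i)).
have vge i : l * s2 i <= v i.
  have h := tilt_variance_ge (X i) eps lam t (tX i) eps0 (EX i) (bern i) (bern3 i) lam0 tau_t t3 (Qf i).
  have e0 : 0 < 1 + 6 * tau ^+ 2 / (1 - tau).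
    apply: ltr_pwDl => //; apply: divr_ge0; first by apply: mulr_ge0 => //; exact: sqr_ge0.
    by rewrite subr_ge0 ltW.
  rewrite -(ler_pM2l (exprn_gt0 2 e0)); apply: le_trans h.
  have s20 : 0 <= s2 i by exact: moment2_ge0.
  by have := ler_wpM2l s20 lE; move: (s2 i) (_ ^+ 2) => u1 u2; lra.
have v0 i : 0 <= v i by apply: Ex_ge0 => x; rewrite sqr_ge0.
pose V := Num.sqrt (\sum_i v i).
have V2 : V ^+ 2 = \sum_i v i by rewrite sqr_sqrtr// sumr_ge0.
have V2ge : l * sigma ^+ 2 <= V ^+ 2.
  by rewrite V2 sigmaE mulr_sumr; apply: ler_sum.
have V2gt : 0 < V ^+ 2 by apply: lt_le_trans V2ge; rewrite mulr_gt0// exprn_gt0.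
have V0 : 0 < V.
  by rewrite lt_neqAle sqrtr_ge0 andbT eq_sym; apply/eqP => h; move: V2gt; rewrite h expr0n/= ltxx.
(* The fourth moment of [Y i] is at most eps^2 s2 K1^2 / V^4, while v >= l s2 and V^2 >= l sigma^2;
   each of these lower bounds contributes one factor [l] to the denominator of rho^2. *)
pose rho := eps / sigma * K1 / l.
have rho0 : 0 < rho by rewrite !mulr_gt0// invr_gt0.
pose Y i x := (X i x - m i) / V.
have tY i : tame Q (Y i).
  by apply: tameM; [apply: tameB => //; exact: tame_cst|exact: tame_cst].
have iY : mutually_independent Q Y.
  apply: (mutually_independent_comp X (fun i y => (y - m i) / V)) iQ => i.
  apply: measurable_funM; last exact: measurable_cst.
  by apply: measurable_funB; [exact: measurable_id|exact: measurable_cst].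
have tc i : tame Q (fun x => X i x - m i) by apply: tameB => //; exact: tame_cst.
have EY i : Ex Q (Y i) = 0.
  by rewrite /Y ExZr// ExB//; [rewrite Ex_cst subrr mul0r|exact: tame_cst].
have EY2 i : Ex Q (fun x => Y i x ^+ 2) = v i / V ^+ 2.
  by rewrite -exprVn -ExZr; [apply: eq_Ex => x; rewrite exprMn|exact: tameX].
have s1 : \sum_i Ex Q (fun x => Y i x ^+ 2) = 1.
  under eq_bigr do rewrite EY2.
  by rewrite -mulr_suml -V2 divff// gt_eqF.
have Y4 i : Ex Q (fun x => Y i x ^+ 4) <= rho ^+ 2 * Ex Q (fun x => Y i x ^+ 2).
  rewrite EY2.
  have -> : Ex Q (fun x => Y i x ^+ 4) = Ex Q (fun x => (X i x - m i) ^+ 4) / V ^+ 2 / V ^+ 2.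
    rewrite -mulrA -invfM -exprD -exprVn -ExZr; last exact: tameX.
    by apply: eq_Ex => x; rewrite exprMn.
  rewrite mulrA ler_pM2r ?invr_gt0// ler_pdivrMr//.
  have h := tilt_moment4_le (X i) eps lam t (tX i) eps0 (EX i) (bern i) (bern3 i) lam0 tau_t t3 drift (Qf i).
  apply: le_trans h _.
  have k1 : 12 * eps ^+ 2 * s2 i * ((1 - tau)^-1 ^+ 5 + 12 * t + 72 * t ^+ 2 * (1 - tau)^-1 ^+ 3) <=
    eps ^+ 2 * s2 i * K1 ^+ 2.
    have p0 : 0 <= eps ^+ 2 * s2 i by rewrite mulr_ge0 ?sqr_ge0// moment2_ge0.
    by have := ler_wpM2l p0 KE; move: (_ + _) (s2 i) (K1 ^+ 2) => u1 u2 u3; lra.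
  apply: (le_trans k1).
  have -> : eps ^+ 2 * s2 i * K1 ^+ 2 = rho ^+ 2 * ((l * s2 i) * (l * sigma ^+ 2)).
    rewrite /rho; move: (s2 i) => u; field; by rewrite !gt_eqF.
  rewrite -[leRHS]mulrA ler_wpM2l ?sqr_ge0//; apply: ler_pM => //.
    by rewrite mulr_ge0 ?(ltW l0)// moment2_ge0.
  by rewrite mulr_ge0 ?(ltW l0)// sqr_ge0.
pose M := \sum_i m i.
(* This makes the shift [c] nonnegative, as Stein's estimate requires. *)
have My : M <= y.
  have -> : y = \sum_i s2 i * t / eps by rewrite /y sigmaE !mulr_suml.
  apply: ler_sum => i _.
  exact: (tilt_mean_le (X i) eps lam t (tX i) eps0 (EX i) (bern i) lam0 tau_t t3 drift (Qf i)).
pose a := lam * V; pose c := (y - M) / V.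
have a0 : 0 <= a by rewrite mulr_ge0// ltW.
have c0 : 0 <= c by rewrite divr_ge0 ?subr_ge0// ltW.
have hE x : (y < S x)%R%:R * expR (- lam * S x) = expR (- lam * y) * exp_tail a c (\sum_i Y i x).
  have -> : \sum_i Y i x = (S x - M) / V by rewrite /Y -mulr_suml sumrB.
  rewrite /exp_tail /c ler_pM2r ?invr_gt0// lerD2r leNgt.
  case: (boolP (y < S x)) => h; last by rewrite mul0r mulr0.
  rewrite mul1r -expRD; congr expR; rewrite /a; move: (S x) => u.
  by field; rewrite gt_eqF.
have hint : tame Q (fun x => exp_tail a c (\sum_i Y i x)).
  apply: (tame_bounded _ 1).
    apply: measurableT_comp (measurable_exp_tail a c) _.
    by apply: measurable_sum => i; exact: tame_meas (tY i).
  move=> x; rewrite /exp_tail; case: ifPn => [_|wc]; first by rewrite normr0.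
  rewrite ger0_norm ?expR_ge0// -expR0 ler_expR mulNr oppr_le0.
  by rewrite mulr_ge0// subr_ge0 ltW// ltNge.
rewrite (eq_Ex _ _ hE) ExZl// -[leRHS]mulrA ler_wpM2l//.
  by rewrite prodr_ge0// => i _; exact: ltW.
rewrite ler_wpM2l ?expR_ge0//.
have := stein_tail Y rho a c tY iY EY s1 Y4 rho0 a0 c0.
move/le_trans; apply; rewrite lerD2r.
have Mc : Mills (a + c) <= Mills (lam * (sigma * Num.sqrt l)) :> R.
  apply: Mills_homo; apply: (@le_trans _ _ a); last by rewrite lerDl.
  rewrite ler_wpM2l// -(@ler_pXn2r _ 2)// ?nnegrE ?mulr_ge0 ?sqrtr_ge0 ?(ltW sigma0) ?(ltW V0)//.
  by rewrite exprMn sqr_sqrtr ?(ltW l0)// mulrC.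
apply: le_trans Mc; rewrite /tail_mean -[leRHS]mul1r ler_wpM2r ?Mills_ge0//.
by rewrite -expR0 ler_expR mulNr oppr_le0 divr_ge0// sqr_ge0.
Qed.

End TailBound.

(** * Estimates in one variable *)

Section Numeric.
Context {R : realType}.
Implicit Types t : R.

Lemma pow5_le t : 0 <= t -> t <= 1 / 3 -> (1 - t) ^+ 5 <= 1 - 5 * t + 10 * t ^+ 2 - 10 * t ^+ 3 + 5 * t ^+ 4.
Proof. move=> t0 t1; have : 0 <= t ^+ 5 by rewrite exprn_ge0. by lra. Qed.

Lemma pow7_le t : 0 <= t -> t <= 1 / 3 ->
  (1 - t) ^+ 7 <= 1 - 7 * t + 21 * t ^+ 2 - 35 * t ^+ 3 + 35 * t ^+ 4.
Proof.
move=> t0 t1; have : 0 <= t ^+ 5 * (21 - 7 * t + t ^+ 2).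
  by rewrite mulr_ge0 ?exprn_ge0//; nra.
by lra.
Qed.

Lemma pow10_le t : 0 <= t -> t <= 1 / 3 ->
  (1 - t) ^+ 10 <= 1 - 10 * t + 45 * t ^+ 2 - 12 * 10 * t ^+ 3 + 21 * 10 * t ^+ 4.
Proof.
move=> t0 t1.
have e : (1 - t) ^+ 10 = (1 - 5 * t + 10 * t ^+ 2 - 10 * t ^+ 3 + 5 * t ^+ 4 - t ^+ 5) ^+ 2 by ring.
have : 0 <= t ^+ 5 * (21 * 12 - 21 * 10 * t + 12 * 10 * t ^+ 2 - 45 * t ^+ 3 + 10 * t ^+ 4 - t ^+ 5).
  rewrite mulr_ge0 ?exprn_ge0//.
  have : 0 <= t ^+ 2 * (12 * 10 - 45 * t) by rewrite mulr_ge0 ?exprn_ge0//; lra.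
  have : 0 <= t ^+ 4 * (10 - t) by rewrite mulr_ge0 ?exprn_ge0//; lra.
  by lra.
by rewrite e; lra.
Qed.

(** The three truncated expansions add up to 1 + 7t - 38t^2 + 26t^3 + 77t^4 + 2520t^6, since the
    fifth powers cancel; for t <= 1/10 the last two terms stay below 11t^3. *)
Lemma fourth_poly_le_small t : 0 <= t -> t <= 1 / 10 ->
  (1 - t) ^+ 5 + 12 * t * (1 - t) ^+ 10 + 72 * t ^+ 2 * (1 - t) ^+ 7 <=
  1 + 7 * t - 38 * t ^+ 2 + 37 * t ^+ 3.
Proof.
move=> t0 t1; have t3 : t <= 1 / 3 by lra.
have h5 := pow5_le t t0 t3.
have h10 := ler_wpM2l t0 (pow10_le t t0 t3).
have h7 := ler_wpM2l (sqr_ge0 t) (pow7_le t t0 t3).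
have q3 : 0 <= t ^+ 3 by rewrite exprn_ge0.
have q4 : t ^+ 4 <= t ^+ 3 * (1 / 10) by rewrite exprSr ler_wpM2l.
have q6 : t ^+ 6 <= t ^+ 3 * (1 / 10) ^+ 3.
  by rewrite (exprD _ 3 3) ler_wpM2l// ler_pXn2r// nnegrE//; lra.
have e : t * (12 * 10 * t ^+ 3) * 12 = 72 * 20 * t ^+ 4 by ring.
move: h5 h10 h7 q3 q4 q6; move: ((1 - t) ^+ 5) ((1 - t) ^+ 7) ((1 - t) ^+ 10) => u5 u7 u10.
by move=> *; lra.
Qed.

(** The affine factor is chosen so that 49 (13.89 + 4.25t) <= (26.09 + 4t)^2, as needed in
    [fourth_bound]. *)
Lemma fourth_poly_bound_small t : 0 <= t -> t <= 1 / 10 ->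
  12 * ((1 - 3 * t) * ((1 - t) ^+ 5 + 12 * t * (1 - t) ^+ 10 + 72 * t ^+ 2 * (1 - t) ^+ 7)) <=
  (1389 / 100 + 17 / 4 * t) * (1 - t + 6 * t ^+ 2) ^+ 2.
Proof.
move=> t0 t1; have h := fourth_poly_le_small t t0 t1.
have t31 : 0 <= 1 - 3 * t by lra.
have := ler_wpM2l t31 h; move: (_ + _ + _) => u hu.
have q2 : 0 <= t ^+ 2 by rewrite exprn_ge0.
have q3 : t ^+ 3 <= t ^+ 2 * (1 / 10) by rewrite exprSr ler_wpM2l.
have q4 : 0 <= t ^+ 4 by rewrite exprn_ge0.
have q5 : 0 <= t ^+ 5 by rewrite exprn_ge0.
have sq : 0 <= (t - 52 / 1000) ^+ 2 by exact: sqr_ge0.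
apply: le_trans (ler_wpM2l _ hu) _; first by [].
by lra.
Qed.

(** Beyond 1/10 the inequality has room for the crude bounds (1 - t)^5 <= 0.6 and (1 - t)^2 <=
    0.81. *)
Lemma fourth_poly_bound_large t : 1 / 10 <= t -> t <= 1 / 3 ->
  12 * ((1 - 3 * t) * ((1 - t) ^+ 5 + 12 * t * (1 - t) ^+ 10 + 72 * t ^+ 2 * (1 - t) ^+ 7)) <=
  (1389 / 100 + 17 / 4 * t) * (1 - t + 6 * t ^+ 2) ^+ 2.
Proof.
move=> t1 t3; have t0 : 0 <= t by lra.
have p0 : 0 <= 1 - t by lra.
have b2 : (1 - t) ^+ 2 <= 81 / 100.
  by rewrite (_ : 81 / 100 = (9 / 10) ^+ 2); [rewrite ler_pXn2r ?nnegrE//; lra|field].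
have b5 : (1 - t) ^+ 5 <= 6 / 10.
  apply: (@le_trans _ _ ((9 / 10) ^+ 5)); first by rewrite ler_pXn2r ?nnegrE//; lra.
  by lra.
have c5 : 0 <= (1 - t) ^+ 5 by rewrite exprn_ge0.
have t31 : 0 <= 1 - 3 * t by lra.
have h : (1 - t) ^+ 5 + 12 * t * (1 - t) ^+ 10 + 72 * t ^+ 2 * (1 - t) ^+ 7 <=
  6 / 10 * (1 + 12 * t * (6 / 10) + 72 * t ^+ 2 * (81 / 100)).
  have -> : (1 - t) ^+ 5 + 12 * t * (1 - t) ^+ 10 + 72 * t ^+ 2 * (1 - t) ^+ 7 =
    (1 - t) ^+ 5 * (1 + 12 * t * (1 - t) ^+ 5 + 72 * t ^+ 2 * (1 - t) ^+ 2) by ring.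
  apply: ler_pM => //.
    by rewrite !addr_ge0// mulr_ge0 ?sqr_ge0// mulr_ge0// sqr_ge0.
  rewrite lerD//; last by rewrite ler_wpM2l// mulr_ge0// sqr_ge0.
  by rewrite lerD2l ler_wpM2l// mulr_ge0.
have := ler_wpM2l t31 h; move: (_ + _ * _ ^+ 10 + _) => u hu.
have [z z0 zE] : exists2 z, 0 <= z & t = 1 / 10 + z by exists (t - 1 / 10); lra.
have z3 : 0 <= z ^+ 3 by rewrite exprn_ge0.
have z4 : 0 <= z ^+ 4 by rewrite exprn_ge0.
have z5 : 0 <= z ^+ 5 by rewrite exprn_ge0.
have sq : 0 <= (z - 64 / 1000) ^+ 2 by exact: sqr_ge0.
apply: le_trans (ler_wpM2l _ hu) _; first by [].
by rewrite zE; lra.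
Qed.

Lemma mills_poly_bound t : 0 <= t -> t <= 1 / 3 ->
  (1 - 3 * t) * ((1 - t) ^+ 2 * (9 / 2 + 12 * t) + 36 * t ^+ 3) <= 9 / 2 - 948 / 100 * t.
Proof.
move=> t0 t3; have t2 : 0 <= t ^+ 2 by rewrite sqr_ge0.
have q3 : 0 <= t ^+ 3 by rewrite exprn_ge0.
nra.
Qed.

End Numeric.

(* Lower bound for the ratio of the tilted to the original variances. *)
Definition var_ratio {R : realType} (t : R) : R :=
  (1 - 3 * t) * (1 - t) ^+ 2 / (1 - t + 6 * t ^+ 2) ^+ 2.

(* Upper bound for the tilted centered fourth moments, in units of eps^2 E X^2. *)
Definition fourth_ratio {R : realType} (t : R) : R :=
  12 * ((1 - t)^-1 ^+ 5 + 12 * t + 72 * t ^+ 2 * (1 - t)^-1 ^+ 3).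

Lemma mills_numeric_ge0 {R : realFieldType} (t : R) : t < 1 / 3 -> 0 <= 9 / 2 - 948 / 100 * t.
Proof. by lra. Qed.

(** With 0.422 bounding phi0: 0.422 * 4.5 = 1.899 and 0.422 * 9.48 > 4. *)
Lemma mills_numeric_le {R : realFieldType} (t : R) : 0 <= t ->
  422 / 1000 * (9 / 2 - 948 / 100 * t) <= 19 / 10 - 4 * t.
Proof. by lra. Qed.

Section NumericFinal.
Context {R : realType}.
Variable t : R.
Hypotheses (t0 : 0 <= t) (t3 : t < 1 / 3).
Local Notation p := (1 - t).
Local Notation D := (1 - t + 6 * t ^+ 2).
Local Notation l := (var_ratio t).
Local Notation q := (Num.sqrt l).
Local Notation K := (Num.sqrt (fourth_ratio t)).

Let p0 : 0 < p. Proof. by have := t3; lra. Qed.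
Let t31 : 0 < 1 - 3 * t. Proof. by have := t3; lra. Qed.
Let tt : t <= 1 / 3. Proof. exact: ltW. Qed.
Let D0 : 0 < D.
Proof. by apply: ltr_wpDr => //; rewrite mulr_ge0// sqr_ge0. Qed.

Lemma var_ratio_gt0 : 0 < l.
Proof. by rewrite divr_gt0 ?exprn_gt0// mulr_gt0// exprn_gt0. Qed.

Lemma fourth_ratio_gt0 : 0 < fourth_ratio t.
Proof.
have pi : 0 < p^-1 by rewrite invr_gt0.
rewrite mulr_gt0//; apply: ltr_wpDr; first by rewrite !mulr_ge0 ?sqr_ge0 ?exprn_ge0// ltW.
by apply: ltr_wpDr; [rewrite mulr_ge0|rewrite exprn_gt0].
Qed.

Let q2 : q ^+ 2 = l. Proof. by rewrite sqr_sqrtr// ltW// var_ratio_gt0. Qed.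
Let q0 : 0 < q. Proof. by rewrite sqrtr_gt0 var_ratio_gt0. Qed.
Let K2 : K ^+ 2 = fourth_ratio t. Proof. by rewrite sqr_sqrtr// ltW// fourth_ratio_gt0. Qed.
Let K0 : 0 < K. Proof. by rewrite sqrtr_gt0 fourth_ratio_gt0. Qed.

Lemma var_ratio_le1 : l <= 1.
Proof.
rewrite ler_pdivrMr ?exprn_gt0// mul1r.
have h1 : (1 - 3 * t) * p ^+ 2 <= 1 * p ^+ 2 by rewrite ler_wpM2r ?sqr_ge0//; have := t0; lra.
apply: le_trans h1 _; rewrite mul1r ler_pXn2r ?nnegrE ?(ltW p0) ?(ltW D0)//.
by rewrite lerDl mulr_ge0// sqr_ge0.
Qed.

(** The squared factor increases with [tau]; at tau = t the product is exactly 1 - 3t, which is at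
    most 1 - 3 tau. *)
Lemma var_ratio_tau (tau : R) : 0 <= tau -> tau <= t ->
  l * (1 + 6 * tau ^+ 2 / (1 - tau)) ^+ 2 <= 1 - 3 * tau.
Proof.
move=> ta0 tat; have u0 : 0 < 1 - tau by apply: lt_le_trans p0 _; lra.
apply: (@le_trans _ _ (l * (D / p) ^+ 2)).
  have e : D / p = 1 + 6 * t ^+ 2 / p by field; rewrite gt_eqF.
  have h0 : 0 <= 6 * tau ^+ 2 / (1 - tau).
    by rewrite divr_ge0 ?(ltW u0)// mulr_ge0// sqr_ge0.
  have h1 : 6 * tau ^+ 2 / (1 - tau) <= 6 * t ^+ 2 / p.
    apply: ler_pM.
    - by rewrite mulr_ge0// sqr_ge0.
    - by rewrite invr_ge0 ltW.
    - by rewrite ler_wpM2l// ler_pXn2r.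
    - by rewrite lef_pV2 ?posrE//; lra.
  rewrite ler_wpM2l ?(ltW var_ratio_gt0)// e ler_pXn2r ?nnegrE// ?lerD2l//.
    by rewrite addr_ge0.
  by rewrite addr_ge0// (le_trans h0).
have -> : l * (D / p) ^+ 2 = 1 - 3 * t.
  by rewrite /var_ratio; field; rewrite !gt_eqF.
lra.
Qed.

Lemma fourth_ratio_tau (tau : R) : 0 <= tau -> tau <= t ->
  12 * ((1 - tau)^-1 ^+ 5 + 12 * t + 72 * t ^+ 2 * (1 - tau)^-1 ^+ 3) <= K ^+ 2.
Proof.
move=> ta0 tat; have u0 : 0 < 1 - tau by apply: lt_le_trans p0 _; lra.
have h : (1 - tau)^-1 <= p^-1 by rewrite lef_pV2 ?posrE//; lra.
have h0 : 0 <= (1 - tau)^-1 by rewrite invr_ge0 ltW.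
have h1 : 0 <= p^-1 by rewrite invr_ge0 ltW.
rewrite K2 ler_wpM2l// lerD//.
  by rewrite lerD2r ler_pXn2r.
rewrite ler_wpM2l//; first by rewrite mulr_ge0// sqr_ge0.
by rewrite ler_pXn2r.
Qed.

(** The left side is the term 7 rho divided by R(t), in units of eps / sigma. Squaring removes the
    roots; the right side is what [mills_bound] leaves of 27.99. *)
Lemma fourth_bound : 7 * K * q * p ^+ 4 <= 26 + 9 / 100 + 4 * t.
Proof.
have r0 : 0 <= 26 + 9 / 100 + 4 * t by have := t0; lra.
rewrite -(@ler_pXn2r _ 2)// ?nnegrE//; last by rewrite !mulr_ge0 ?exprn_ge0// ltW.
have -> : (7 * K * q * p ^+ 4) ^+ 2 = 49 * (K ^+ 2 * q ^+ 2 * p ^+ 8) by ring.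
have -> : K ^+ 2 * q ^+ 2 * p ^+ 8 =
  12 * ((1 - 3 * t) * (p ^+ 5 + 12 * t * p ^+ 10 + 72 * t ^+ 2 * p ^+ 7)) / D ^+ 2.
  rewrite K2 q2 /fourth_ratio /var_ratio; field; by rewrite !gt_eqF.
apply: (@le_trans _ _ (49 * (1389 / 100 + 17 / 4 * t))).
  rewrite ler_pM2l// ler_pdivrMr ?exprn_gt0//.
  have [h|h] := leP t (1 / 10); first exact: fourth_poly_bound_small.
  by apply: fourth_poly_bound_large => //; exact: ltW.
by have := sqr_ge0 t; have := t0; lra.
Qed.

(** The root [q] lies above its square, because the ratio is at most 1. After this replacement the
    numerator is a rational function divisible by [t], so the quotient stays bounded near t = 0. *)
Lemma mills_bound : 0 < t ->
  phi0 * q ^+ 2 * p ^+ 4 * ((1 + 3 / 2 * t - q) / t) <= 19 / 10 - 4 * t.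
Proof.
move=> tp; have [_ f1] := andP (@phi0_bounds R); have f0 := @phi0_gt0 R.
have q1 : q <= 1 by rewrite -[leRHS]sqrtr1 ler_wsqrtr// var_ratio_le1.
have ql : l <= q.
  by rewrite -[leLHS]q2 expr2 ler_piMr// ltW.
have pD : p <= D by rewrite lerDl mulr_ge0// sqr_ge0.
have h1 : (1 + 3 / 2 * t - q) / t <= 3 / 2 + (3 * p ^+ 2 + 12 * t * p + 36 * t ^+ 3) / D ^+ 2.
  have -> : 3 / 2 + (3 * p ^+ 2 + 12 * t * p + 36 * t ^+ 3) / D ^+ 2 = (1 + 3 / 2 * t - l) / t.
    by rewrite /var_ratio; field; rewrite !gt_eqF.
  by rewrite ler_pM2r ?invr_gt0//; lra.
have D2 : (D ^+ 2)^-1 <= (p ^+ 2)^-1.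
  by rewrite lef_pV2 ?posrE ?exprn_gt0// ler_pXn2r// nnegrE ltW.
have c0 : 0 <= 3 * p ^+ 2 + 12 * t * p + 36 * t ^+ 3.
  by rewrite !addr_ge0// ?mulr_ge0 ?exprn_ge0 ?(ltW p0)//; rewrite mulr_ge0.
have h2 : (1 + 3 / 2 * t - q) / t <= 3 / 2 + (3 * p ^+ 2 + 12 * t * p + 36 * t ^+ 3) / p ^+ 2.
  by apply: le_trans h1 _; rewrite lerD2l ler_wpM2l.
have h3 : q ^+ 2 <= 1 - 3 * t.
  rewrite q2 /var_ratio -mulrA ler_piMr ?(ltW t31)//.
  by rewrite ler_pdivrMr ?exprn_gt0// mul1r ler_pXn2r// nnegrE ltW.
have h40 : 0 <= (1 + 3 / 2 * t - q) / t by rewrite divr_ge0//; have := t0; lra.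
have h5 : q ^+ 2 * p ^+ 4 * ((1 + 3 / 2 * t - q) / t) <= 9 / 2 - 948 / 100 * t.
  apply: le_trans (mills_poly_bound t t0 tt).
  have -> : (1 - 3 * t) * (p ^+ 2 * (9 / 2 + 12 * t) + 36 * t ^+ 3) =
    (1 - 3 * t) * (p ^+ 2 * (9 / 2) + 12 * t * p ^+ 2 + 36 * t ^+ 3) by ring.
  apply: (@le_trans _ _ ((1 - 3 * t) * (p ^+ 4 * (3 / 2 + (3 * p ^+ 2 + 12 * t * p + 36 * t ^+ 3) / p ^+ 2)))).
    rewrite -mulrA; apply: ler_pM => //; rewrite ?sqr_ge0//.
      by rewrite mulr_ge0// exprn_ge0// ltW.
    by rewrite ler_wpM2l// exprn_ge0// ltW.
  rewrite ler_wpM2l ?(ltW t31)//.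
  have -> : p ^+ 4 * (3 / 2 + (3 * p ^+ 2 + 12 * t * p + 36 * t ^+ 3) / p ^+ 2) =
    p ^+ 4 * (9 / 2) + 12 * t * p ^+ 3 + 36 * t ^+ 3 * p ^+ 2 by field; rewrite gt_eqF.
  have pp : 0 <= p ^+ 2 <= 1 by rewrite sqr_ge0/= expr_le1 ?(ltW p0)//; have := t0; lra.
  have pp1 : p <= 1 by have := t0; lra.
  have t30 : 0 <= t ^+ 3 by rewrite exprn_ge0.
  have /andP[pp2 pp3] := pp.
  rewrite lerD//; last by rewrite ler_piMr// mulr_ge0.
  rewrite lerD//.
    by rewrite ler_wpM2r// (exprD _ 2 2) ler_piMr.
  by rewrite ler_wpM2l ?mulr_ge0// exprSr ler_piMr.
rewrite -[phi0 * _ * _]mulrA -[phi0 * _ * _]mulrA.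
apply: le_trans (ler_wpM2l (ltW f0) h5) _.
apply: (@le_trans _ _ (422 / 1000 * (9 / 2 - 948 / 100 * t))).
  have c1 : 0 <= 9 / 2 - 948 / 100 * t by exact: mills_numeric_ge0.
  exact: ler_wpM2r c1 _ _ f1.
exact: mills_numeric_le.
Qed.

End NumericFinal.

Lemma num8841 {R : realFieldType} : 8841 / 100 = 88 + 41 / 100 :> R.
Proof. by field. Qed.
Lemma num2799 {R : realFieldType} : 2799 / 100 = 28 - 1 / 100 :> R.
Proof. by field. Qed.

(** The two sides differ by less than one part in 10000, so the square root of 0.7 is needed to
    about five digits: 0.83662. *)
Lemma tenth_numeric {R : realFieldType} (u : R) : u ^+ 2 = 7 / 10 -> 0 < u ->
  (28 - 1 / 100) * (1 - 1 / 10 + 6 * (1 / 10) ^+ 2) ^+ 3 <=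
  (88 + 41 / 100) * (7 / 10 * u * (1 - 1 / 10) ^+ 7).
Proof.
move=> sq u0; have low : 836 / 1000 + 62 / 1000 / 100 <= u.
  by rewrite leNgt; apply/negP => h; nra.
by lra.
Qed.

(** * The function R: monotonicity and its value at 1/10 *)

Section RFunction.
Context {R : realType}.
Implicit Types s t : R.

Definition Rval t : R :=
  (1 - t + 6 * t ^+ 2) ^+ 3 / (powR (1 - 3 * t) (3 / 2) * (1 - t) ^+ 7).

Lemma Rfun_lt t : t < 1 / 3 -> Rfun t = (Rval t)%:E.
Proof. by move=> h; rewrite /Rfun h. Qed.

Lemma Rfun_ge t : 1 / 3 <= t -> Rfun t = +oo%E.
Proof. by move=> h; rewrite /Rfun ltNge h. Qed.

Lemma powR32 (a : R) : 0 <= a -> powR a (3 / 2) = Num.sqrt a ^+ 3.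
Proof.
move=> a0; have -> : 3 / 2 = 2^-1 * 3%:R :> R by rewrite mulrC.
by rewrite powRrM powR12_sqrt// powR_mulrn// sqrtr_ge0.
Qed.

Lemma Rval_ratio t : 0 <= t -> t < 1 / 3 ->
  Rval t * (Num.sqrt (var_ratio t) ^+ 3 * (1 - t) ^+ 4) = 1.
Proof.
move=> t0 t3; have p0 : 0 < 1 - t by lra.
have t31 : 0 < 1 - 3 * t by lra.
have D0 : 0 < 1 - t + 6 * t ^+ 2 by apply: ltr_wpDr => //; rewrite mulr_ge0// sqr_ge0.
have s0 : 0 < Num.sqrt (1 - 3 * t) by rewrite sqrtr_gt0.
have -> : Num.sqrt (var_ratio t) = Num.sqrt (1 - 3 * t) * (1 - t) / (1 - t + 6 * t ^+ 2).
  have -> : var_ratio t = (Num.sqrt (1 - 3 * t) * (1 - t) / (1 - t + 6 * t ^+ 2)) ^+ 2.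
    by rewrite exprMn exprMn exprVn sqr_sqrtr// ltW.
  by rewrite sqrtr_sqr ger0_norm// divr_ge0 ?(ltW D0)// mulr_ge0 ?sqrtr_ge0// ltW.
rewrite /Rval powR32 ?(ltW t31)//; move: (Num.sqrt _) s0 => u s0.
by field; rewrite !gt_eqF.
Qed.

(** The polynomial 1 - t + 6t^2 is not monotone. Divided by 1 - t it becomes 1 + 6t^2 / (1 - t),
    which increases, and the remaining denominator decreases. *)
Lemma Rval_homo s t : 0 <= s -> s <= t -> t < 1 / 3 -> Rval s <= Rval t.
Proof.
move=> s0 st t3; have t0 := le_trans s0 st.
have ps : 0 < 1 - s by lra. have pt : 0 < 1 - t by lra.
have s31 : 0 < 1 - 3 * s by lra. have t31 : 0 < 1 - 3 * t by lra.
have qs : 0 < Num.sqrt (1 - 3 * s) by rewrite sqrtr_gt0.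
have qt : 0 < Num.sqrt (1 - 3 * t) by rewrite sqrtr_gt0.
have E u : 0 < 1 - u -> 0 < 1 - 3 * u ->
    Rval u = (1 + 6 * u ^+ 2 / (1 - u)) ^+ 3 * (Num.sqrt (1 - 3 * u) ^+ 3 * (1 - u) ^+ 4)^-1.
  move=> pu u31; have qu : 0 < Num.sqrt (1 - 3 * u) by rewrite sqrtr_gt0.
  rewrite /Rval powR32 ?(ltW u31)//; move: (Num.sqrt _) qu => w qu.
  by field; rewrite !gt_eqF.
have D0 (u : R) : 0 < 1 - u -> 0 <= 6 * u ^+ 2 / (1 - u).
  by move=> pu; rewrite divr_ge0 ?(ltW pu)// mulr_ge0// sqr_ge0.
rewrite !E//; apply: ler_pM.
- by rewrite exprn_ge0// addr_ge0// D0.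
- by rewrite invr_ge0 mulr_ge0// exprn_ge0// ltW.
- have h : 6 * s ^+ 2 / (1 - s) <= 6 * t ^+ 2 / (1 - t).
    apply: ler_pM.
    + by rewrite mulr_ge0// sqr_ge0.
    + by rewrite invr_ge0 ltW.
    + by rewrite ler_wpM2l// ler_pXn2r.
    + by rewrite lef_pV2 ?posrE//; lra.
  by rewrite ler_pXn2r ?lerD2l// nnegrE addr_ge0// D0.
- rewrite lef_pV2 ?posrE ?mulr_gt0 ?exprn_gt0//; apply: ler_pM.
  + by rewrite exprn_ge0// ltW.
  + by rewrite exprn_ge0// ltW.
  + by rewrite ler_pXn2r ?nnegrE ?sqrtr_ge0// ler_wsqrtr//; lra.
  + by rewrite ler_pXn2r ?nnegrE ?(ltW pt) ?(ltW ps)//; lra.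
Qed.

Lemma Rfun_homo s t : 0 <= s -> s <= t -> (Rfun s <= Rfun t)%E.
Proof.
move=> s0 st; have [t3|t3] := ltP t (1 / 3); last by rewrite (Rfun_ge t)// leey.
by rewrite !Rfun_lt ?lee_fin ?Rval_homo// (le_lt_trans st).
Qed.

Lemma Rfun_tenth : ((2799 / 100 : R)%:E * Rfun (1 / 10 : R) <= (8841 / 100 : R)%:E)%E.
Proof.
rewrite Rfun_lt; last by lra.
rewrite -EFinM lee_fin num2799 num8841 /Rval powR32; last by lra.
have p7 : 0 <= 1 - 3 * (1 / 10) :> R by lra.
have sq : Num.sqrt (1 - 3 * (1 / 10)) ^+ 2 = 7 / 10 :> R by rewrite sqr_sqrtr//; lra.
have s0 : 0 < Num.sqrt (1 - 3 * (1 / 10)) :> R by rewrite sqrtr_gt0; lra.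
move: (Num.sqrt _) sq s0 => u sq s0.
rewrite [u ^+ 3]exprSr sq mulrA ler_pdivrMr; last first.
  by apply: mulr_gt0; [apply: mulr_gt0 => //|apply: exprn_gt0]; lra.
exact: tenth_numeric.
Qed.

End RFunction.

Lemma constant_2799_split {R : realFieldType} (u1 u2 r t : R) : 0 <= r ->
  u1 <= 26 + 9 / 100 + 4 * t -> u2 <= 19 / 10 - 4 * t -> r * u1 + r * u2 <= (28 - 1 / 100) * r.
Proof. by move=> r0 h1 h2; have := ler_wpM2l r0 (lerD h1 h2); lra. Qed.

(** * The choice of the tilt and the bound B_n *)

Section TiltParameter.
Context {R : realType}.
Variables (x r : R).
Hypotheses (x0 : 0 <= x) (r0 : 0 < r).
Local Notation t := (x * r).
Local Notation w := (Num.sqrt (1 + 2 * x * r)).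
Local Notation L := (xhat x r / w).

Let t0 : 0 <= t. Proof. by rewrite mulr_ge0// ltW. Qed.
Let w2 : w ^+ 2 = 1 + 2 * t. Proof. by rewrite sqr_sqrtr -mulrA//; have := t0; lra. Qed.
Let w1 : 1 <= w.
Proof. by rewrite -[leLHS]sqrtr1 ler_wsqrtr// -mulrA; have := t0; lra. Qed.
Let w0 : 0 < w. Proof. exact: lt_le_trans w1. Qed.
Let wp : 0 < 1 + w. Proof. by rewrite addr_gt0. Qed.
Let wt : w <= 1 + t.
Proof.
rewrite -(@ler_pXn2r _ 2)// ?nnegrE ?(ltW w0) ?addr_ge0// w2.
by have := sqr_ge0 t; lra.
Qed.
Let xw : x * r = (w ^+ 2 - 1) / 2. Proof. by rewrite w2; field. Qed.

Lemma tilt_ge0 : 0 <= L.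
Proof. by rewrite divr_ge0 ?(ltW w0)// divr_ge0 ?(ltW wp)// mulr_ge0. Qed.

(** Since 2t = (w - 1) (w + 1), the factor 1 + w of xhat cancels. All factors (1 - tau)^(-1) thereby
    become [w]. *)
Lemma tilt_tau : L * r = 1 - w^-1.
Proof.
have -> : L * r = 2 * (x * r) / (1 + w) / w by rewrite /xhat; field; rewrite !gt_eqF.
by rewrite xw; field; rewrite !gt_eqF.
Qed.

Lemma tilt_tau_lt1 : L * r < 1.
Proof. by rewrite tilt_tau gtrBl invr_gt0. Qed.

Lemma tilt_le : L <= x.
Proof.
rewrite /xhat ler_pdivrMr// ler_pdivrMr// [leLHS]mulrC -[leRHS]mulrA ler_wpM2l//.
by have := w1; have := w2; have := t0; lra.
Qed.

(** In fact an equality, (1 - 1/w) (w^2 + w) / 2 = (w^2 - 1) / 2 = t: the stationarity condition of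
    Bernstein's exponent. *)
Lemma tilt_drift : L * r / 2 * ((1 - L * r)^-1 ^+ 2 + (1 - L * r)^-1) <= t.
Proof.
rewrite tilt_tau subKr invrK xw le_eqVlt; apply/orP; left; apply/eqP.
by field; rewrite gt_eqF.
Qed.

(** Both sides are multiplied by q^3 (1 - t)^4 = 1 / R(t). This turns the term with R into a
    constant times [r] and leaves the two quantities of [fourth_bound] and [mills_bound]. *)
Lemma mills_shift_le : t < 1 / 3 ->
  Mills (L * Num.sqrt (var_ratio t)) + 7 * (r * Num.sqrt (fourth_ratio t) / var_ratio t) <=
  Mills x + 2799 / 100 * Rval t * r.
Proof.
move=> t3; set q := Num.sqrt (var_ratio t); set K := Num.sqrt (fourth_ratio t).
have p0 : 0 < 1 - t by lra.
have l0 := var_ratio_gt0 t t3.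
have q0 : 0 < q by rewrite sqrtr_gt0.
have q2 : q ^+ 2 = var_ratio t by rewrite sqr_sqrtr// ltW.
have q1 : q <= 1 by rewrite -[leRHS]sqrtr1 ler_wsqrtr// var_ratio_le1.
have U0 : 0 < q ^+ 3 * (1 - t) ^+ 4 by rewrite mulr_gt0 ?exprn_gt0.
have RU := Rval_ratio t t0 t3; rewrite -/q in RU.
have fb := fourth_bound t t0 t3; rewrite -/q -/K in fb.
have mb := mills_bound t t0 t3; rewrite -/q in mb.
have diff : (Mills (L * q) - Mills x) * (q ^+ 3 * (1 - t) ^+ 4) <= r * (19 / 10 - 4 * t).
  (* At x = 0 the two Mills terms coincide; reciprocals are used only for x > 0. *)
  have [xp|xn] := ltP 0 x; last first.
    have x00 : x = 0 by apply/eqP; rewrite eq_le xn x0.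
    rewrite /xhat x00 mulr0 !mul0r subrr mul0r mulr_ge0// ?(ltW r0)//; lra.
  have tp : 0 < t by rewrite mulr_gt0.
  have hp : 0 < xhat x r by rewrite divr_gt0// mulr_gt0.
  have a0 : 0 < L * q by rewrite mulr_gt0// divr_gt0.
  have ax : L * q <= x.
    by apply: le_trans tilt_le; rewrite ler_piMr// tilt_ge0.
  have h := Mills_sub_le (L * q) x a0 ax.
  (* From w <= 1 + t one gets (w^2 + w) / 2 <= 1 + 3t/2. Writing 1 / x as r / t then exhibits the
     difference as [r] times a function of [t], so it does not blow up for small x. *)
  have e : (L * q)^-1 - x^-1 <= r * ((1 + 3 / 2 * t - q) / t / q).
    have -> : (L * q)^-1 = (w ^+ 2 + w) / 2 / (x * q).
      by rewrite /xhat; field; rewrite !gt_eqF.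
    have -> : r * ((1 + 3 / 2 * t - q) / t / q) = (1 + 3 / 2 * t) / (x * q) - x^-1.
      by field; rewrite !gt_eqF.
    rewrite lerD2r ler_pM2r ?invr_gt0 ?mulr_gt0// w2; have := wt; lra.
  have h' := le_trans h (ler_wpM2l (ltW phi0_gt0) e).
  apply: le_trans (ler_wpM2r (ltW U0) h') _.
  have -> : phi0 * (r * ((1 + 3 / 2 * t - q) / t / q)) * (q ^+ 3 * (1 - t) ^+ 4) =
     r * (phi0 * q ^+ 2 * (1 - t) ^+ 4 * ((1 + 3 / 2 * t - q) / t)).
    by move: phi0 => f; field; rewrite !gt_eqF.
  by rewrite ler_wpM2l ?(ltW r0)// mb.
rewrite num2799 -lerBlDl addrAC -(ler_pM2r U0) mulrDl.
have -> : (28 - 1 / 100) * Rval t * r * (q ^+ 3 * (1 - t) ^+ 4) = (28 - 1 / 100) * r.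
  transitivity ((28 - 1 / 100) * r * (Rval t * (q ^+ 3 * (1 - t) ^+ 4))); first ring.
  by rewrite RU mulr1.
have -> : 7 * (r * K / var_ratio t) * (q ^+ 3 * (1 - t) ^+ 4) = r * (7 * K * q * (1 - t) ^+ 4).
  by rewrite -q2; field; rewrite gt_eqF.
apply: (@le_trans _ _ (r * (7 * K * q * (1 - t) ^+ 4) + r * (19 / 10 - 4 * t))).
  by rewrite [leRHS]addrC lerD2r.
exact: constant_2799_split (ltW r0) fb (lexx _).
Qed.

(** AM-GM replaces the factors by the n-th power of their mean, at most 1 + u. Then (1 + u)^n
    against e^(-n u) is exactly the factor with psi, and the rest of the exponent is -xhat^2 / 2. *)
Lemma prod_le_Bn (n : nat) (A s : 'I_n -> R) (sigma : R) : 0 < sigma ->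
  sigma ^+ 2 = \sum_i s i -> (forall i, 0 <= A i) ->
  (forall i, A i <= 1 + (L / sigma) ^+ 2 * s i / 2 * (1 - L * r)^-1) ->
  \prod_i A i * expR (- (L / sigma) * (x * sigma)) <= Bn n x r.
Proof.
move=> sg0 sE A0 A1.
(* An empty sum would make [sigma] zero; n > 0 is needed to divide by [n]. *)
have n0 : (0 < n)%N.
  case: n A s sE A0 A1 => // A s; rewrite big_ord0 => /eqP.
  by rewrite expf_eq0/= gt_eqF.
have nr : 0 < n%:R :> R by rewrite ltr0n.
have hp : 0 <= xhat x r by rewrite divr_ge0 ?(ltW wp)// mulr_ge0.
set u := xhat x r ^+ 2 / (2 * n%:R * w).
have u0 : 0 <= u by rewrite divr_ge0 ?sqr_ge0// ?mulr_ge0 ?(ltW w0)// ltW.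
have AGM : \prod_i A i <= (1 + u) ^+ n.
  have [] := leif_AGM (A := 'I_n) (E := A) (fun i _ => A0 i).
  rewrite card_ord => h _; apply: le_trans h _.
  rewrite ler_pXn2r ?nnegrE ?addr_ge0//.
    rewrite ler_pdivrMr//; apply: (le_trans (ler_sum _ (fun i _ => A1 i))).
    rewrite big_split/= sumr_const card_ord -mulr_suml -mulr_suml -mulr_sumr -sE.
    rewrite tilt_tau subKr invrK [(1 + u) * _]mulrDl [1 * n%:R]mul1r.
    rewrite lerD2l le_eqVlt; apply/orP; left; apply/eqP.
    by rewrite /u; field; rewrite !gt_eqF.
  by rewrite divr_ge0 ?(ltW nr)// sumr_ge0.
apply: (@le_trans _ _ ((1 + u) ^+ n * expR (- (L / sigma) * (x * sigma)))).
  by rewrite ler_wpM2r// expR_ge0.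
have u1 : 0 < 1 + u by rewrite ltr_pwDl.
have -> : (1 + u) ^+ n = expR (n%:R * ln (1 + u)) by rewrite expRM_natl lnK// posrE.
rewrite /Bn /Bfun /psi -/u -!expRD ler_expR le_eqVlt; apply/orP; left; apply/eqP.
(* Solving the definition of xhat for x gives x = xhat (1 + w) / 2, which splits the exponent into
   these two parts. *)
have -> : - (L / sigma) * (x * sigma) = - (xhat x r ^+ 2) / 2 - n%:R * u.
  rewrite /u /xhat; field; by rewrite !gt_eqF.
by move: (ln _) => v; ring.
Qed.

End TiltParameter.

Lemma expectationE {d} {T : measurableType d} {R : realType} (P : probability T R) (f : T -> R) :
  P.-integrable setT (EFin \o f) -> ('E_P[f] = (Ex P f)%:E)%E.
Proof.
move=> h; rewrite unlock /Ex /Rintegral fineK//; exact: integrable_fin_num h.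
Qed.

(** For x r >= 1/3 the function R is infinite, so the minimum with 1 is 1 and the passage to real
    numbers loses nothing. *)
Lemma F2E {R : realType} (x r : R) : 0 <= x -> 0 < r ->
  F2 x r = if x * r < 1 / 3 then Num.min (Mills x + 2799 / 100 * Rval (x * r) * r) 1 else 1.
Proof.
move=> x0 r0; rewrite /F2; case: (ltP (x * r) (1 / 3)) => h.
  by rewrite Rfun_lt// -!EFinM -EFinD -EFin_min.
have k0 : (0 < (2799 / 100 : R)%:E)%E by rewrite lte_fin num2799; lra.
have r0' : (0 < r%:E)%E by rewrite lte_fin.
by rewrite (Rfun_ge _ h) (gt0_muley k0) (gt0_mulye r0') addey// min_r ?leey.
Qed.

Lemma Bn_ge0 {R : realType} (n : nat) (x r : R) : 0 <= Bn n x r.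
Proof. by rewrite /Bn /Bfun mulr_ge0 ?expR_ge0. Qed.
Theorem theorem2 (d : measure_display) (T : measurableType d) (R : realType)
  (P : probability T R) (n : nat) (X : 'I_n -> {RV P >-> R})
  (eps sigma : R) :
  mutually_independent P (fun i => (X i : T -> R)) ->
  (forall i (k : nat), P.-integrable setT (fun w => (X i w ^+ k)%:E)) ->
  (forall i, ('E_P[X i] = 0)%E) ->
  0 < eps ->
  (forall i (k : nat), (3 <= k)%N ->
     (`| 'E_P[fun w => (X i w ^+ k)%R] | <=
        ((k`!)%:R / 2 * eps ^+ (k - 2))%:E * 'E_P[fun w => (X i w ^+ 2)%R])%E) ->
  0 < sigma ->
  sigma ^+ 2 = \sum_(i < n) fine ('E_P[fun w => (X i w ^+ 2)%R])%E ->
  (forall x : R, 0 <= x ->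
     (P [set w | (x * sigma < \sum_(i < n) X i w)%R]
        <= (Bn n x (eps / sigma) * F2 x (eps / sigma))%:E)%E
     /\ Bn n x (eps / sigma) * F2 x (eps / sigma) <= Bn n x (eps / sigma))
  /\ (forall s t : R, 0 <= s -> s <= t -> (Rfun s <= Rfun t)%E)
  /\ (forall alpha x : R, 0 <= alpha -> alpha < 1 / 3 ->
        0 <= x -> x <= alpha * sigma / eps ->
        (Rfun (x * (eps / sigma)) <= Rfun alpha)%E)
  /\ ((2799 / 100 : R)%:E * Rfun (1 / 10 : R) <= (8841 / 100 : R)%:E)%E.
Proof.
move=> iX intX E0 eps0 bernX sigma0 sigmaE.
have tX i : tame P (X i : T -> R).
  split; first exact: measurable_funPT.
  move=> k; have := integrable_abse (intX i k); apply: eq_integrable => // w _ /=.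
  by rewrite normrX.
have iXk i k : P.-integrable setT (EFin \o (fun w => X i w ^+ k)) := intX i k.
have EX i : Ex P (X i) = 0.
  have := E0 i; rewrite expectationE; last exact: (tame_int _ (tX i)).
  by case.
pose s2 i := Ex P (fun w => X i w ^+ 2).
have s20 i : 0 <= s2 i by exact: moment2_ge0.
have bernR i k : `|Ex P (fun w => X i w ^+ k.+3)| <= (k.+3)`!%:R / 2 * eps ^+ k.+1 * s2 i.
  by have := bernX i k.+3 erefl; rewrite !expectationE// -EFinM lee_fin.
have bern i k : Ex P (fun w => X i w ^+ k.+2) <= (k.+2)`!%:R / 2 * eps ^+ k * s2 i.
  (* At order 2 the condition is the identity 2! / 2 = 1; the assumption starts at order 3. *)
  case: k => [|k]; first by rewrite expr0 mulr1 divff// mul1r.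
  exact: le_trans (ler_norm _) (bernR i k).
have bern3 i : - (3 * eps * s2 i) <= Ex P (fun w => X i w ^+ 3).
  have := bernR i 0%N; rewrite ler_norml expr1 => /andP[h _].
  by rewrite (_ : 3 = 3`!%:R / 2)//; rewrite (_ : 3`! = 6)%N//; field.
have sE : sigma ^+ 2 = \sum_i s2 i.
  by rewrite sigmaE; apply: eq_bigr => i _; rewrite expectationE.
pose r := eps / sigma; have r0 : 0 < r by rewrite divr_gt0.
have epsE : eps = r * sigma by rewrite divfK// gt_eqF.
split; last first.
  split; first by move=> s t; exact: Rfun_homo.
  split; last exact: Rfun_tenth.
  move=> al x al0 al3 x0 xa; apply: Rfun_homo; first by rewrite mulr_ge0// ltW.
  by rewrite mulrA ler_pdivrMr// -ler_pdivlMr.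
move=> x x0; rewrite -/r; split; last first.
  apply: ler_piMr; first exact: Bn_ge0.
  rewrite (F2E x r x0 r0); case: (x * r < 1 / 3); last exact: lexx.
  by rewrite ge_min (lexx 1) orbT.
pose lam := xhat x r / Num.sqrt (1 + 2 * x * r) / sigma.
have tauE : lam * eps = xhat x r / Num.sqrt (1 + 2 * x * r) * r.
  by rewrite /lam /r mulrAC [RHS]mulrA.
have lam0 : 0 <= lam by rewrite divr_ge0 ?(ltW sigma0)// tilt_ge0.
have tau1 : lam * eps < 1 by rewrite tauE tilt_tau_lt1.
have yE : sigma ^+ 2 * (x * r) / eps = x * sigma.
  by rewrite /r; field; rewrite !gt_eqF.
pose A i := Ex P (fun w => X i w ^+ 0 * expR (lam * X i w)).
have A0 i : 0 <= A i by apply: Ex_ge0 => w; rewrite expr0 mul1r expR_ge0.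
have A1 i : A i <= 1 + lam ^+ 2 * s2 i / 2 * (1 - xhat x r / Num.sqrt (1 + 2 * x * r) * r)^-1.
  by rewrite -tauE; exact: (exp_moment0_le (X i) eps).
have ZB := prod_le_Bn x r x0 r0 n A s2 sigma sigma0 sE A0 A1.
set pr := P _.
have mS : measurable_fun setT (fun w => \sum_(i < n) X i w) by exact: measurable_sum.
have mSet : measurable [set w | x * sigma < \sum_(i < n) X i w].
  rewrite (_ : [set w | _] = (fun w => \sum_(i < n) X i w) @^-1` `]x * sigma, +oo[%classic).
    by rewrite -[_ @^-1` _]setTI; exact: mS.
  by apply/seteqP; split => w /=; rewrite in_itv/= andbT.
have pE : pr = (fine pr)%:E by rewrite fineK// fin_num_measure.
rewrite pE lee_fin.
have b1 : fine pr <= Bn n x r.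
  apply: le_trans ZB; exact: (tail_le_exp X eps lam tX iX EX eps0 bern lam0 tau1 (x * sigma)).
(* For x r >= 1/3 the exponential bound is all that is claimed. Below 1/3, [F2] is a minimum, so the
   exponential bound serves as one half and the tilted estimate as the other. *)
rewrite (F2E x r x0 r0); case: ifP => t3; last by rewrite mulr1.
rewrite minr_pMr; last exact: Bn_ge0.
rewrite mulr1 le_min b1 andbT.
have t0 : 0 <= x * r by rewrite mulr_ge0// ltW.
have tau_t : lam * eps <= x * r by rewrite tauE ler_wpM2r ?(ltW r0)// tilt_le.
have tau0 : 0 <= lam * eps by rewrite mulr_ge0// ltW.
have drift : lam * eps / 2 * ((1 - lam * eps)^-1 ^+ 2 + (1 - lam * eps)^-1) <= x * r.
  by rewrite tauE; exact: tilt_drift.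
have := tail_le_tilted X eps sigma lam (x * r) tX iX EX eps0 bern bern3 sigma0 sE lam0 tau1
  tau_t t3 drift (var_ratio (x * r)) (Num.sqrt (fourth_ratio (x * r)))
  (var_ratio_gt0 _ t3) (var_ratio_tau _ t0 t3 _ tau0 tau_t) _
  (fourth_ratio_tau _ t0 t3 _ tau0 tau_t).
rewrite yE -/pr => H.
apply: le_trans (H _) _; first by rewrite sqrtr_gt0 fourth_ratio_gt0.
rewrite -mulNr in ZB *.
have -> : lam * (sigma * Num.sqrt (var_ratio (x * r))) =
  xhat x r / Num.sqrt (1 + 2 * x * r) * Num.sqrt (var_ratio (x * r)).
  by rewrite /lam mulrA divfK// gt_eqF.
apply: ler_pM => //.
- by rewrite mulr_ge0 ?expR_ge0// prodr_ge0// => i _; exact: A0.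
- apply: addr_ge0; first exact: Mills_ge0.
  rewrite mulr_ge0// divr_ge0 ?(ltW (var_ratio_gt0 _ t3))// mulr_ge0 ?sqrtr_ge0//.
  exact: ltW.
- exact: mills_shift_le.
Qed.
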